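(* Let $n\in\{2,3\}$ and let $\Omega, H, V, A, B$ be as in the context. Assume: (i) for every $\bar f\in H$, $\mathcal{S}(\bar f)\neq\emptyset$; (ii) for every $\bar f\in H$ there is a constant $M(\bar f)>0$ such that $\|\bar u\|_{D(A)}\le M(\bar f)$ for all $\bar u\in\mathcal{S}(\bar f)$. Let $\bar f\in H$ and $\bar u,\bar v\in\mathcal{S}(\bar f)$. Then there exists a constant $\delta_1>0$, depending only on $\Omega$, $A$, $B$ and $M(\bar f)$, such that for every integer $N\ge 1$ and every set of nodes $E_N=\{x_1,\dots,x_N\}\subset\overline\Omega$: if $0<d_N\le\delta_1$ and $\bar u(x_j)=\bar v(x_j)$ for $j=1,\dots,N$, then $\bar u=\bar v$ in $\Omega$.
   Context: $\Omega\subset\mathbb{R}^n$ is a bounded domain with $C^{0,1}$ boundary. Functions are real-valued or $\mathbb{R}^n$-valued, and the same notation ($L^2(\Omega)$, $H^m(\Omega)$, etc.) is used for both. $H$ is a closed subspace of $L^2(\Omega)$, $V=H^1_0(\Omega)\cap H$, and $P$ is the orthogonal projection of $L^2(\Omega)$ onto $H$. $A$ is a closed linear operator from $D(A):=H^2(\Omega)\cap V$ to $H$ given by $Au=-P\{\sum_{i,j=1}^n\partial_{x_j}(a_{ij}\partial_{x_i}u)\}$, where: (A.1) $a_{ij}\in C^{0,1}(\overline\Omega)$; (A.2) $a_{ij}=a_{ji}$ on $\overline\Omega$; (A.3) there is $a>0$ with $\sum_{i,j}a_{ij}(x)\xi_i\xi_j\ge a|\xi|^2$ for all $x\in\overline\Omega$,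 $\xi\in\mathbb{R}^n$; (A.4) with $\|u\|_{D(A)}:=\|Au\|_{L^2(\Omega)}$, there are $a_1,a_2>0$ such that $a_1\|u\|_{H^2(\Omega)}\le\|u\|_{D(A)}\le a_2\|u\|_{H^2(\Omega)}$ for all $u\in D(A)$. $B$ is a nonlinear operator from $D(B):=H^2(\Omega)\cap V$ to $H$ with: (B.1) $B0=0$; (B.2) there are constants $C_B>0$, $p>1$ such that $\|Bu-Bv\|_{L^2(\Omega)}\le C_B(1+\|u\|_{H^2(\Omega)}^{p-1}+\|v\|_{H^2(\Omega)}^{p-1})\|u-v\|_{H^1(\Omega)}$ for all $u,v\in D(B)$. For $\bar f\in H$, $\mathcal{S}(\bar f)$ is the set of all $\bar u\in D(A)$ with $A\bar u+B\bar u=\bar f$ in $H$. For a set of nodes $E_N=\{x_1,\dots,x_N\}\subset\overline\Omega$, $d_N:=\max_{x\in\overline\Omega}\min_{1\le j\le N}|x-x_j|$. Elements of $D(A)$ are identified with their continuous representatives on $\overline\Omega$. *)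

(* Defs.v *)
From HB Require Import structures.
From mathcomp Require Import all_boot all_order all_algebra.
From mathcomp Require Import all_classical all_reals all_analysis.

Set Implicit Arguments.
Unset Strict Implicit.
Unset Printing Implicit Defensive.

Import Order.TTheory GRing.Theory Num.Theory.
Import numFieldNormedType.Exports.

Local Open Scope classical_set_scope.
Local Open Scope ring_scope.

(* R^n is 'rV[R]_n with the product sigma-algebra, as the library does for
   n.-tuple. *)
Definition measure_rV_display : measure_display -> measure_display.
Proof. exact. Qed.

Section measurable_rV.
Context {d} {T : sigmaRingType d}.
Variable n : nat.

Let coords : 'I_n -> 'rV[T]_n -> T := fun i x => x ord0 i.

Let rV_set0 : g_sigma_preimage coords set0.
Proof. exact: sigma_algebra0. Qed.

Let rV_setC A : g_sigma_preimage coords A -> g_sigma_preimage coords (~` A).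
Proof. exact: sigma_algebraC. Qed.

Let rV_bigcup (F : (set 'rV[T]_n)^nat) :
  (forall i, g_sigma_preimage coords (F i)) ->
  g_sigma_preimage coords (\bigcup_i (F i)).
Proof. exact: sigma_algebra_bigcup. Qed.

HB.instance Definition _ := @isMeasurable.Build (measure_rV_display d)
  'rV[T]_n (g_sigma_preimage coords) rV_set0 rV_setC rV_bigcup.

End measurable_rV.

Lemma measurable_rV_coord d (T : sigmaRingType d) n (i : 'I_n) :
  measurable_fun [set: 'rV[T]_n] (fun x => x ord0 i).
Proof.
move=> _ Y mY; rewrite setTI; apply: sub_sigma_algebra => /=.
rewrite -bigcup_seq/=; exists i => /=; first by rewrite mem_index_enum.
by exists Y => //; rewrite setTI.
Qed.

Lemma measurable_fun_rV d1 d2 (T1 : measurableType d1) (T2 : measurableType d2)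
    n (f : T1 -> 'rV[T2]_n) :
  (forall i, measurable_fun [set: T1] (fun x => f x ord0 i)) ->
  measurable_fun [set: T1] f.
Proof.
move=> mf _ Y mY; rewrite setTI.
have : measurable `<=` image_set_system setT f measurable.
  apply: smallest_sub; first exact/sigma_algebra_image/sigma_algebra_measurable.
  move=> A; rewrite -bigcup_seq => -[i _ [B mB <-]].
  rewrite /image_set_system/= !setTI.
  by rewrite -[X in measurable X]setTI; exact: mf.
by move=> /(_ _ mY); rewrite /image_set_system/= setTI.
Qed.

Section lebesgue_rV.
Context {R : realType}.

Definition rV_cons n (p : R * 'rV[R]_n) : 'rV[R]_n.+1 :=
  \row_i oapp (p.2 ord0) p.1 (unlift ord0 i).

Definition rV_uncons n (x : 'rV[R]_n.+1) : R * 'rV[R]_n :=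
  (x ord0 ord0, \row_i x ord0 (lift ord0 i)).

Lemma rV_consK n : cancel (@rV_cons n) (@rV_uncons n).
Proof.
move=> [a v]; rewrite /rV_uncons /rV_cons/= mxE unlift_none; congr pair.
by apply/rowP => i; rewrite !mxE liftK.
Qed.

Lemma measurable_rV_cons n : measurable_fun setT (@rV_cons n).
Proof.
apply: measurable_fun_rV => i; rewrite /rV_cons.
under eq_fun do rewrite mxE.
case: (unliftP ord0 i) => [j _|_] /=; last exact: measurable_fst.
rewrite (_ : (fun _ => _) = (fun y : 'rV[R]_n => y ord0 j) \o snd)//.
by apply: measurableT_comp => //; exact: measurable_rV_coord.
Qed.

Lemma measurable_rV_uncons n : measurable_fun setT (@rV_uncons n).
Proof.
apply/measurable_fun_pairP; split; first exact: measurable_rV_coord.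
apply: measurable_fun_rV => i /=.
under eq_fun do rewrite mxE; exact: measurable_rV_coord.
Qed.

Lemma prod_sigma_finite d1 d2 (T1 : measurableType d1) (T2 : measurableType d2)
    (m1 : {sigma_finite_measure set T1 -> \bar R})
    (m2 : {sigma_finite_measure set T2 -> \bar R}) :
  sigma_finite setT (m1 \x m2)%E.
Proof.
have /sigma_finiteP[F [TF ndF Foo]] := sigma_finiteT m1.
have /sigma_finiteP[G [TG ndG Goo]] := sigma_finiteT m2.
exists (fun n => F n `*` G n).
  rewrite -setXTT TF TG predeqE => -[x y]; split.
    move=> [/= [n _ Fnx] [k _ Gky]]; exists (maxn n k) => //; split.
    - by move: x Fnx; exact/subsetPset/ndF/leq_maxl.
    - by move: y Gky; exact/subsetPset/ndG/leq_maxr.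
  by move=> [n _ []/= ? ?]; split; exists n.
move=> k; have [? ?] := Foo k; have [? ?] := Goo k.
split; first exact: measurableX.
by rewrite product_measure1E// lte_mul_pinfty// ge0_fin_numE.
Qed.

Section step.
Variables (n : nat) (mu : {sigma_finite_measure set 'rV[R]_n -> \bar R}).

Definition lebesgue_rV_step : set 'rV[R]_n.+1 -> \bar R :=
  pushforward (lebesgue_measure \x mu)%E (@rV_cons n).

HB.instance Definition _ := Measure.copy lebesgue_rV_step
  (measure_function_pushforward__canonical__measure_function_Measure
    (lebesgue_measure \x mu)%E (@measurable_rV_cons n)).

Let step_sigma_finite : sigma_finite setT lebesgue_rV_step.
Proof.
have [F FT mF] := prod_sigma_finite (@lebesgue_measure R) mu.
exists (fun k => @rV_uncons n @^-1` F k).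
  by rewrite -preimage_bigcup -FT preimage_setT.
move=> k; have [mFk Fkoo] := mF k; split.
  by rewrite -[X in measurable X]setTI; exact: measurable_rV_uncons.
rewrite /lebesgue_rV_step /pushforward -comp_preimage.
by rewrite (_ : _ \o _ = id)//; apply/funext => p; exact: rV_consK.
Qed.

HB.instance Definition _ := Measure_isSigmaFinite.Build _ _ _
  lebesgue_rV_step step_sigma_finite.

End step.

Fixpoint lebesgue_rV (n : nat) :
    {sigma_finite_measure set 'rV[R]_n -> \bar R} :=
  if n is m.+1 then [the {sigma_finite_measure set _ -> \bar R} of
                     lebesgue_rV_step (lebesgue_rV m)]
  else [the {sigma_finite_measure set _ -> \bar R} of \d_(0 : 'rV[R]_0)].

Lemma lebesgue_rV_box n (A : 'I_n -> set R) : (forall i, measurable (A i)) ->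
  lebesgue_rV n [set x : 'rV[R]_n | forall i, A i (x ord0 i)] =
  (\prod_(i < n) lebesgue_measure (A i))%E.
Proof.
elim: n => [|n IHn] in A *.
  by move=> _; rewrite big_ord0 /= diracE mem_set// => /= -[].
move=> mA; rewrite big_ord_recl -IHn//= /lebesgue_rV_step /pushforward.
rewrite -product_measure1E//; last first.
  rewrite (_ : mkset _ = \bigcap_(i in [set: 'I_n])
      ((fun x : 'rV[R]_n => x ord0 i) @^-1` A (lift ord0 i))).
    apply: fin_bigcap_measurable => // i _.
    by rewrite -[X in measurable X]setTI; exact: measurable_rV_coord.
  by apply/seteqP; split => x /= Ax i => [_|]; exact: Ax.
  exact: mA.
congr (product_measure1 _ _ _); apply/seteqP; split => -[y v]/= H.
  by split => [|i]; [have := H ord0|have := H (lift ord0 i)];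
    rewrite mxE ?unlift_none ?liftK.
move=> i; case: H => Ay Av; rewrite mxE.
by case: (unliftP ord0 i) => [j ->|->] //=; exact: Av.
Qed.

End lebesgue_rV.

Section domains.
Context {R : realType}.

Definition enorm n (x : 'rV[R]_n) : R := Num.sqrt (\sum_i x ord0 i ^+ 2).

(* C^{0,1} boundary: near each boundary point, after an orthogonal change of
   coordinates y = x Q, the set is the region strictly above the graph, over
   the coordinates other than the k-th, of a Lipschitz function. *)
Definition lipschitz_boundary n (Omega : set 'rV[R]_n) : Prop :=
  forall x0, (closure Omega `\` interior Omega) x0 ->
  exists (r : R) (Q : 'M[R]_n) (k : 'I_n) (L : R) (gamma : 'rV[R]_n.-1 -> R),
    [/\ 0 < r, Q *m Q^T = 1%:M,
        forall y z, `|gamma y - gamma z| <= L * enorm (y - z) &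
        forall x, enorm (x - x0) < r ->
          (Omega x <-> gamma (col' k (x *m Q)) < (x *m Q) ord0 k)].

Definition bounded_lipschitz_domain n (Omega : set 'rV[R]_n) : Prop :=
  [/\ open Omega, connected Omega, Omega !=set0, bounded_set Omega &
      lipschitz_boundary Omega].

(* d_N for the nodes x_1, ..., x_N; for N >= 1 the infimum is a minimum and,
   the closure of Omega being compact, the supremum is a maximum. *)
Definition fill_distance n (Omega : set 'rV[R]_n) N (x : 'I_N -> 'rV[R]_n) : R :=
  sup [set inf [set enorm (y - x j) | j in [set: 'I_N]] | y in closure Omega].

End domains.

(* Elements of L^2(Omega; R^m) are represented by functions 'rV_n -> 'rV_m,
   whose values outside Omega are irrelevant; equality in L^2 is ae_eq. The
   scalar case is m = 1. *)
Section sobolev.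
Context {R : realType} {n m : nat}.
Local Notation E := 'rV[R]_n.
Local Notation F := (E -> 'rV[R]_m).
Variable Omega : set E.

Definition partial (i : 'I_n) (f : E -> R) : E -> R :=
  'D_(delta_mx ord0 i) (f : E -> R^o).

Definition partials (s : seq 'I_n) (f : E -> R) : E -> R := foldr partial f s.

Definition smooth (f : E -> R) : Prop :=
  forall s, continuous (partials s f) /\
    forall i x, derivable (partials s f : E -> R^o) x (delta_mx ord0 i).

Definition test_function (phi : E -> R) : Prop :=
  let supp := closure [set x | phi x != 0] in
  [/\ smooth phi, compact supp & supp `<=` Omega].

Definition ae_eq_on (u v : F) : Prop := ae_eq (@lebesgue_rV R n) Omega u v.

Definition L2 (u : F) : Prop := forall k : 'I_m,
  measurable_fun Omega (fun x => u x ord0 k) /\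
  (@lebesgue_rV R n).-integrable Omega (fun x => (u x ord0 k ^+ 2)%:E).

Definition L2_inner (u v : F) : R :=
  \int[@lebesgue_rV R n]_(x in Omega) (\sum_k u x ord0 k * v x ord0 k).

Definition L2_norm (u : F) : R := Num.sqrt (L2_inner u u).

Definition is_weak_derivative (s : seq 'I_n) (u g : F) : Prop :=
  forall phi k, test_function phi ->
    \int[@lebesgue_rV R n]_(x in Omega) (u x ord0 k * partials s phi x) =
    (-1) ^+ size s * \int[@lebesgue_rV R n]_(x in Omega) (g x ord0 k * phi x).

(* The L^2 weak derivative, unique up to ae_eq_on; 0 if there is none. *)
Definition weak_derivative (s : seq 'I_n) (u : F) : F :=
  xget 0 [set g | L2 g /\ is_weak_derivative s u g].

Definition Hk (k : nat) (u : F) : Prop :=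
  L2 u /\ forall s, (size s <= k)%N -> exists g, L2 g /\ is_weak_derivative s u g.

(* Sorted tuples of directions of length j are the multi-indices of order j. *)
Definition Hk_norm (k : nat) (u : F) : R :=
  Num.sqrt (\sum_(j < k.+1)
    \sum_(s : j.-tuple 'I_n | sorted leq [seq val i | i <- s])
      L2_norm (weak_derivative s u) ^+ 2).

(* H^1_0 is the closure of the test functions in H^1. *)
Definition H10 (u : F) : Prop :=
  Hk 1 u /\ forall e : R, 0 < e -> exists phi : F,
    (forall k, test_function (fun x => phi x ord0 k)) /\ Hk_norm 1 (u - phi) < e.

(* Taking v at distance 0 shows that such an H is saturated for ae_eq_on. *)
Definition closed_subspace (H : set F) : Prop :=
  [/\ H `<=` L2, H 0,
      forall (c : R) u v, H u -> H v -> H (c *: u + v) &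
      forall u, L2 u ->
        (forall e : R, 0 < e -> exists2 v, H v & L2_norm (u - v) < e) -> H u].

(* Orthogonal projection onto H, unique up to ae_eq_on. *)
Definition proj (H : set F) (f : F) : F :=
  xget 0 [set g | H g /\ forall h, H h -> L2_inner (f - g) h = 0].

(* V `&` H^2, with V = H^1_0 `&` H: the common domain of A and B. *)
Definition dom (H : set F) (u : F) : Prop := [/\ Hk 2 u, H10 u & H u].

Definition opA (H : set F) (a : 'I_n -> 'I_n -> E -> R) (u : F) : F :=
  - proj H (\sum_i \sum_j weak_derivative [:: j]
                            (fun x => a i j x *: weak_derivative [:: i] u x)).

Definition closed_linear_operator (H : set F) (D : set F) (A : F -> F) : Prop :=
  [/\ forall u, D u -> H (A u),
      forall (c : R) u v, D u -> D v ->
        ae_eq_on (A (c *: u + v)) (c *: A u + A v) &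
      forall (w : nat -> F) u f, (forall k, D (w k)) -> H u -> H f ->
        L2_norm (w k - u) @[k --> \oo] --> 0 ->
        L2_norm (A (w k) - f) @[k --> \oo] --> 0 ->
        D u /\ ae_eq_on (A u) f].

Definition lipschitz_coef (a : 'I_n -> 'I_n -> E -> R) : Prop :=
  forall i j, exists L : R, forall x y, closure Omega x -> closure Omega y ->
    `|a i j x - a i j y| <= L * enorm (x - y).

Definition symmetric_coef (a : 'I_n -> 'I_n -> E -> R) : Prop :=
  forall i j x, closure Omega x -> a i j x = a j i x.

Definition elliptic_coef (a : 'I_n -> 'I_n -> E -> R) : Prop :=
  exists2 c : R, 0 < c & forall x (xi : E), closure Omega x ->
    c * enorm xi ^+ 2 <= \sum_i \sum_j a i j x * xi ord0 i * xi ord0 j.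

Definition DA_norm (H : set F) (a : 'I_n -> 'I_n -> E -> R) (u : F) : R :=
  L2_norm (opA H a u).

Definition DA_norm_equiv (H : set F) (a : 'I_n -> 'I_n -> E -> R) : Prop :=
  exists a1 a2 : R, [/\ 0 < a1, 0 < a2 &
    forall u, dom H u -> a1 * Hk_norm 2 u <= DA_norm H a u <= a2 * Hk_norm 2 u].

Definition B_lipschitz (H : set F) (B : F -> F) : Prop :=
  exists CB p : R, [/\ 0 < CB, 1 < p &
    forall u v, dom H u -> dom H v ->
      L2_norm (B u - B v) <=
        CB * (1 + Hk_norm 2 u `^ (p - 1) + Hk_norm 2 v `^ (p - 1)) *
        Hk_norm 1 (u - v)].

Definition solutions (H : set F) (a : 'I_n -> 'I_n -> E -> R) (B : F -> F)
    (f : F) : set F :=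
  [set u | dom H u /\ ae_eq_on (opA H a u + B u) f].

(* The continuous representative, determined on the closure of Omega. *)
Definition cont_rep (u : F) : F :=
  xget 0 [set w | {within closure Omega, continuous w} /\ ae_eq_on u w].

End sobolev.

(* Main.v *)
Require Import Defs.
From mathcomp Require Import all_boot all_order all_algebra.
From mathcomp Require Import all_classical all_reals all_analysis.
From mathcomp Require Import measurable_realfun ring lra.
Import Order.TTheory GRing.Theory Num.Theory.
Import numFieldNormedType.Exports.
Local Open Scope classical_set_scope.
Local Open Scope ring_scope.

(** Let [w = u - v] be the difference of two solutions for the same right-hand
    side. Then [A w = B v - B u], so the equivalence of the norm of [D(A)] with
    the [H^2] norm and the Lipschitz bound on [B] give
    [|w|_(H^2) <= C |w|_(H^1)], where [C] depends on [u] and [v] only through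
    the a priori bound on their [H^2] norms. The nodes provide the opposite
    bound: if [w] vanishes at sufficiently dense nodes, then
    [|w|_(H^1) <= e |w|_(H^2)] with [e] as small as desired
    ([H1_norm_dense_zeros]). With [C * e = 1 / 2] both norms must vanish.

    The opposite bound has two ingredients. The first is the interpolation
    inequality [|d_i w|^2 <= |w| |d_ii w|] for [w] in [H^1_0] and [H^2]
    ([interpolation]), by which it suffices that the [L^2] norm of [w] be small
    relative to the [H^2] norm. The second is that the unit ball of [H^2] is
    equicontinuous on the closure of the domain in dimension at most three
    ([uniform_modulus]): as every point is close to a node, where [w] is zero,
    [w] is then uniformly small.

    The modulus of continuity is obtained without extension operators or the
    Fourier transform. Near each point of the closure the domain contains,
    translated to every vertex [y], the boxes [y + s [lo, hi]] of a truncated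
    cone; at the boundary this is the Lipschitz graph condition
    ([box_cone_boundary]). Let [K] be a smooth product kernel on the box
    [[lo, hi]] and let [f_s(y)] be the integral of [u] against
    [s^-n K ((z - y) / s)]. The derivative of this kernel in [s] is a divergence
    in [z], so the derivative of [f_s(y)] in [s] is a sum of averages of the
    gradient of [u], and the second derivative a sum of averages of second
    derivatives of [u] ([is_derive_average]). The latter are
    [O(s^(-n/2)) = O(s^(-3/2))] by the Cauchy-Schwarz inequality
    ([average_bound]); integrating twice, [f_s(y)] is Lipschitz in the square
    root of [s], with a constant proportional to the [H^2] norm and uniform in
    [y] ([average_lipschitz]). Hence [f_s(y)] has a limit as [s] tends to [0],
    with a rate. This limit is the integral of [K] times the continuous
    representative of [u] ([limit_ae_eq]), and it inherits a modulus of
    continuity from the averages at a fixed scale ([local_modulus]).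
    Compactness of the closure makes the modulus uniform. *)

Set Implicit Arguments.
Unset Strict Implicit.
Unset Printing Implicit Defensive.

(** * Boxes, Borel sets and affine changes of variables *)

Section boxes.
Context {R : realType} {n : nat}.
Local Notation E := 'rV[R]_n.
Implicit Types (x y : E) (lo hi : 'I_n -> R).

Definition obox lo hi : set E := [set x | forall i, lo i < x ord0 i < hi i].

Definition cbox lo hi : set E := [set x | forall i, lo i <= x ord0 i <= hi i].

Lemma ball_rVP x y (e : R) :
  0 < e -> ball x e y <-> forall i, `|x ord0 i - y ord0 i| < e.
Proof.
move=> e0; split; first by move=> [_ +] i; move=> /(_ ord0 i).
by move=> xy; split => // j i; rewrite ord1; exact: xy.
Qed.

Lemma coord_le_norm x i : `|x ord0 i| <= `|x|.
Proof.
by rewrite [leRHS]/Num.norm /= mx_normrE; apply/bigmax_geP; right => /=; exists (ord0, i).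
Qed.

Lemma obox_cbox lo hi : obox lo hi `<=` cbox lo hi.
Proof. by move=> x xB i; have /andP[/ltW-> /ltW->] := xB i. Qed.

Lemma obox_prod lo hi :
  obox lo hi = [set x : E | forall i, `]lo i, hi i[%classic (x ord0 i)].
Proof. by apply/seteqP; split => x /= xB i; have := xB i; rewrite in_itv. Qed.

Lemma measurable_rV_prod (A : 'I_n -> set R) : (forall i, measurable (A i)) ->
  measurable [set x : E | forall i, A i (x ord0 i)].
Proof.
move=> mA; rewrite (_ : mkset _ = \bigcap_(i in [set: 'I_n])
    ((fun x : E => x ord0 i) @^-1` A i)).
  apply: fin_bigcap_measurable => // i _.
  by rewrite -[X in measurable X]setTI; exact: measurable_rV_coord.
by apply/seteqP; split => x /= Ax i => [_|]; exact: Ax.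
Qed.

Lemma measurable_obox lo hi : measurable (obox lo hi).
Proof. by rewrite obox_prod; apply: (measurable_rV_prod (A := fun i => `]lo i, hi i[%classic)) => i; exact: measurable_itv. Qed.

Lemma cbox_prod lo hi :
  cbox lo hi = [set x : E | forall i, `[lo i, hi i]%classic (x ord0 i)].
Proof. by apply/seteqP; split => x /= xB i; have := xB i; rewrite in_itv. Qed.

Lemma measurable_cbox lo hi : measurable (cbox lo hi).
Proof. by rewrite cbox_prod; apply: (measurable_rV_prod (A := fun i => `[lo i, hi i]%classic)) => i; exact: measurable_itv. Qed.

Lemma obox_open lo hi : open (obox lo hi).
Proof.
rewrite openE => x xB.
have /= e0 : forall i, 0 < Num.min (x ord0 i - lo i) (hi i - x ord0 i).
  by move=> i; rewrite lt_min !subr_gt0; exact: xB.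
pose e := \big[Num.min/1]_i Num.min (x ord0 i - lo i) (hi i - x ord0 i).
have pe : 0 < e by apply: lt_bigmin => // i _; exact: e0.
apply/nbhs_ballP; exists e => //= y /(ball_rVP _ _ pe) xy i.
have : e <= Num.min (x ord0 i - lo i) (hi i - x ord0 i) by exact: bigmin_inf.
move: (xy i); rewrite ltr_norml le_min => /andP[+ +] /andP[+ +]; lra.
Qed.

Lemma compact_cbox lo hi : compact (cbox lo hi).
Proof.
rewrite cbox_prod.
by apply: (@rV_compact _ _ (fun i => `[lo i, hi i]%classic)) => i; exact: segment_compact.
Qed.

Lemma closed_cbox lo hi : closed (cbox lo hi).
Proof.
by apply: compact_closed; [exact: norm_hausdorff|exact: compact_cbox].
Qed.

Lemma obox_setI_closed :
  setI_closed [set A : set E | exists lo hi, A = obox lo hi].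
Proof.
move=> _ _ [l1 [h1 ->]] [l2 [h2 ->]].
exists (fun i => Num.max (l1 i) (l2 i)), (fun i => Num.min (h1 i) (h2 i)).
apply/seteqP; split => x /=.
  move=> [x1 x2] i; rewrite gt_max lt_min.
  have /andP[a b] := x1 i; have /andP[c d] := x2 i; by rewrite a b c d.
move=> x12; split => i; have := x12 i; rewrite gt_max lt_min;
  by move=> /andP[/andP[a b] /andP[c d]]; rewrite ?a ?b ?c ?d.
Qed.

Lemma obox_cover :
  \bigcup_k obox (fun=> - k%:R) (fun=> k%:R) = [set: E].
Proof.
apply/seteqP; split => // x _.
have [k xk] : exists k : nat, `|x| < k%:R.
  by exists (Num.bound `|x|); exact: archi_boundP.
exists k => // i /=; rewrite -ltr_norml; apply: le_lt_trans xk.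
exact: coord_le_norm.
Qed.

(** Boxes with rational data form a countable base; asking that the closed
    box stay inside lets test functions live on it. *)
Lemma countable_box_base : exists lo hi : nat -> 'I_n -> R,
  forall (O : set E) x, open O -> O x ->
  exists2 k, obox (lo k) (hi k) x & cbox (lo k) (hi k) `<=` O.
Proof.
pose T : countType := ('rV[rat]_n * nat)%type.
pose lo' (p : T) i : R := ratr (p.1 ord0 i) - p.2.+1%:R^-1.
pose hi' (p : T) i : R := ratr (p.1 ord0 i) + p.2.+1%:R^-1.
pose P k : T := odflt (0, 0%N) (unpickle k).
exists (lo' \o P), (hi' \o P) => O x oO Ox.
have /nbhs_ballP[e /= e0 eO] : nbhs x O by exact: open_nbhs_nbhs.
have [k ke] : exists k : nat, k.+1%:R^-1 < e / 2.
  have [k _ /(_ _ (leqnn k))] := near_infty_natSinv_lt (PosNum (divr_gt0 e0 (@ltr0Sn R 1))).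
  by exists k.
have kp : 0 < k.+1%:R^-1 :> R by rewrite invr_gt0.
set d : R := _^-1 in ke kp.
have qP i : exists q : rat, `|ratr q - x ord0 i| < d.
  have : x ord0 i - d < x ord0 i + d by lra.
  move=> /rat_in_itvoo[q]; rewrite in_itv/= => /andP[q1 q2]; exists q.
  by rewrite ltr_norml; apply/andP; split; lra.
have [q qx] := choice qP.
exists (pickle ((\row_i q i, k) : T)); rewrite /P /= /lo' /hi' pickleK /= -/d.
  move=> i; have := qx i; rewrite /= mxE ltr_norml => /andP[? ?].
  by apply/andP; split; lra.
move=> y yB; apply: eO; apply/ball_rVP => // i.
have := yB i; have := qx i; rewrite /= mxE /= ltr_norml => /andP[? ?] /andP[? ?].
by rewrite ltr_norml; apply/andP; split; lra.
Qed.

Lemma open_bigcup_obox (O : set E) : open O ->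
  exists (D : set nat) (lo hi : nat -> 'I_n -> R),
    (forall k, D k -> cbox (lo k) (hi k) `<=` O) /\
    O = \bigcup_(k in D) obox (lo k) (hi k).
Proof.
have [lo [hi base]] := countable_box_base => oO.
exists [set k | cbox (lo k) (hi k) `<=` O], lo, hi; split => //.
apply/seteqP; split; last first.
  by move=> x [k kO xk]; apply: kO; exact: obox_cbox.
by move=> x Ox; have [k xk kO] := base O x oO Ox; exists k.
Qed.

Lemma measurable_open (O : set E) : open O -> measurable O.
Proof.
move=> /open_bigcup_obox[D [lo [hi [_ ->]]]].
by apply: bigcup_measurable => k _; exact: measurable_obox.
Qed.

Lemma continuous_measurable_rV (D : set E) (f : E -> R) : open D ->
  (forall x, D x -> {for x, continuous f}) -> measurable_fun D f.
Proof.
move=> oD cf; apply: (measurability (@RGenOpens.G R)).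
  exact: RGenOpens.measurableE.
move=> _ [_ [a [b ->]] <-]; apply: measurable_open.
rewrite openE => x [Dx fx]; apply: filterI; first exact: open_nbhs_nbhs.
by apply: (cf x Dx); apply: open_nbhs_nbhs; split => //; exact: interval_open.
Qed.

Lemma measurable_oboxE :
  measurable = <<s [set A : set E | exists lo hi, A = obox lo hi] >>.
Proof.
apply/seteqP; split; last first.
  apply: smallest_sub; first exact: sigma_algebra_measurable.
  by move=> _ [lo [hi ->]]; exact: measurable_obox.
set G := [set A : set E | _].
apply: smallest_sub; first exact: smallest_sigma_algebra.
move=> A; rewrite -bigcup_seq => -[i _ [B mB <-]].
have sG : sigma_algebra setT <<s G >> by exact: smallest_sigma_algebra.
have : measurable `<=` image_set_system setT (fun x : E => x ord0 i) <<s G >>.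
  rewrite [X in X `<=` _](_ : measurable = <<s @RGenOpens.G R >>); last first.
    exact: RGenOpens.measurableE.
  apply: smallest_sub; first exact: sigma_algebra_image.
  move=> _ [a [b ->]]; rewrite /image_set_system/= setTI.
  have -> : (fun x : E => x ord0 i) @^-1` `]a, b[%classic =
    \bigcup_k obox (fun j => if j == i then a else - k%:R)
                   (fun j => if j == i then b else k%:R).
    apply/seteqP; split => x /=; rewrite ?in_itv/=.
      move=> xab; have : [set: E] x by [].
      rewrite -obox_cover => -[k _ xk]; exists k => // j /=.
      by case: eqVneq => [->//|_]; exact: xk.
    by move=> [k _ /(_ i)]; rewrite eqxx.
  case: sG => _ _; apply=> k; apply: sub_sigma_algebra; by do 2 eexists.
by move=> /(_ _ mB); rewrite /image_set_system/=.
Qed.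

End boxes.

Section invariance.
Context {R : realType} {n : nat}.
Local Notation E := 'rV[R]_n.
Local Notation mu := (@lebesgue_rV R n).
Implicit Types (x y a : E) (lo hi : 'I_n -> R).

Lemma lebesgue_obox lo hi :
  mu (obox lo hi) = (\prod_i Num.max 0 (hi i - lo i))%:E.
Proof.
rewrite obox_prod (lebesgue_rV_box (A := fun i => `]lo i, hi i[%classic))//.
  rewrite -prodEFin; apply: eq_bigr => i _; rewrite lebesgue_measure_itv/= lte_fin.
  by case: ltP => h; congr (_%:E); case: leP => //; lra.
Qed.

Lemma lebesgue_cbox lo hi : mu (cbox lo hi) = (\prod_i Num.max 0 (hi i - lo i))%:E.
Proof.
rewrite cbox_prod (lebesgue_rV_box (A := fun i => `[lo i, hi i]%classic))//.
  rewrite -prodEFin; apply: eq_bigr => i _; rewrite lebesgue_measure_itv/= lte_fin.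
  by case: ltP => h; congr (_%:E); case: leP => //; lra.
Qed.

Lemma bounded_finite_measure (O : set E) : bounded_set O -> measurable O ->
  (mu O < +oo)%E.
Proof.
move=> /pinfty_ex_gt0[M _ /= OM] mO.
apply: (@le_lt_trans _ _ (mu (cbox (fun=> - M) (fun=> M)))); last first.
  by rewrite lebesgue_cbox ltry.
apply: le_measure; rewrite ?inE//; first exact: measurable_cbox.
move=> x /OM xM i; rewrite -ler_norml; apply: le_trans xM.
exact: coord_le_norm.
Qed.

Lemma open_measure_gt0 (O : set E) : open O -> O !=set0 -> (0 < mu O)%E.
Proof.
move=> oO [x Ox]; have /nbhs_ballP[e /= e0 eO] : nbhs x O by exact: open_nbhs_nbhs.
apply: (@lt_le_trans _ _ (mu (obox (fun i => x ord0 i - e) (fun i => x ord0 i + e)))).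
  rewrite lebesgue_obox lte_fin; apply: prodr_gt0 => i _.
  by rewrite lt_max; apply/orP; right; lra.
apply: le_measure; rewrite ?inE//.
- exact: measurable_obox.
- exact: measurable_open.
- move=> y yB; apply: eO; apply/ball_rVP => // i.
  by have /andP[? ?] := yB i; rewrite ltr_norml; apply/andP; split; lra.
Qed.

Definition reflect_scale (a : E) (s : R) : E -> E := fun x => a - s *: x.

Lemma measurable_reflect_scale a s :
  measurable_fun [set: E] (reflect_scale a s).
Proof.
apply: measurable_fun_rV => i; rewrite /reflect_scale.
under eq_fun do rewrite !mxE.
apply: measurable_funB => //; apply: measurable_funM => //.
exact: measurable_rV_coord.
Qed.

Lemma preimage_reflect_scale a s lo hi : 0 < s ->
  reflect_scale a s @^-1` obox lo hi =
  obox (fun i => s^-1 * (a ord0 i - hi i)) (fun i => s^-1 * (a ord0 i - lo i)).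
Proof.
move=> s0; apply/seteqP; split => x /= xB i; have := xB i;
  rewrite /reflect_scale !mxE ltr_pdivrMl// ltr_pdivlMl//;
  by move=> /andP[? ?]; apply/andP; split; lra.
Qed.

(** Boxes form a pi-system, and on a box the two sides are products of
    lengths. *)
Lemma lebesgue_reflect_scale a s (A : set E) : 0 < s -> measurable A ->
  mu (reflect_scale a s @^-1` A) = ((s ^- n)%:E * mu A)%E.
Proof.
move=> s0 mA.
have k0 : 0 <= s ^- n by rewrite invr_ge0 exprn_ge0// ltW.
pose m1 := measure_function_pushforward__canonical__measure_function_Measure
    mu (measurable_reflect_scale a s).
pose m2 : {measure set E -> \bar R} := mscale (NngNum k0) mu.
have box l h : mu (reflect_scale a s @^-1` obox l h) = ((s ^- n)%:E * mu (obox l h))%E.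
  rewrite preimage_reflect_scale// !lebesgue_obox -EFinM; congr (_%:E).
  rewrite -exprVn -[in s^-1 ^+ n](card_ord n) -prodr_const -big_split/=.
  apply: eq_bigr => i _.
  rewrite -mulrBr opprB addrC addrA subrK maxr_pMr ?invr_ge0 1?ltW// mulr0.
  by congr (Num.max _ (_ * _)); rewrite addrC.
apply: (@measure_unique _ _ _ _ (fun k => obox (fun=> - k%:R) (fun=> k%:R))
  measurable_oboxE obox_setI_closed _ obox_cover m1 m2 _ _ _ mA).
- by move=> k; do 2 eexists.
- by move=> _ [l [h ->]]; exact: box.
- by move=> k; rewrite /m1/= /pushforward box lebesgue_obox -EFinM ltry.
Qed.

Lemma ge0_integral_reflect_scale a s (f : E -> \bar R) : 0 < s ->
  measurable_fun [set: E] f -> (forall x, 0 <= f x)%E ->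
  (\int[mu]_x f (a - s *: x)%R = (s ^- n)%:E * \int[mu]_x f x)%E.
Proof.
move=> s0 mf f0.
have k0 : 0 <= s ^- n by rewrite invr_ge0 exprn_ge0// ltW.
rewrite -[RHS](@ge0_integral_mscale _ _ _ mu setT measurableT (NngNum k0))//.
have := @ge0_integral_pushforward _ _ _ _ _ _ (measurable_reflect_scale a s)
  mu setT f measurableT mf (fun y _ => f0 y).
rewrite preimage_setT => <-.
apply: (@eq_measure_integral _ _ _ setT (mscale (NngNum k0) mu)
  (measure_function_pushforward__canonical__measure_function_Measure
    mu (measurable_reflect_scale a s))) => A mA _.
exact: lebesgue_reflect_scale.
Qed.

Lemma measurable_reflect a : measurable_fun [set: E] (fun x : E => a - x).
Proof.
rewrite (_ : (fun _ => _) = reflect_scale a 1).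
  exact: measurable_reflect_scale.
by apply/funext => x; rewrite /reflect_scale scale1r.
Qed.

Lemma integrable_reflect a (f : E -> R) :
  mu.-integrable setT (EFin \o f) ->
  mu.-integrable setT (EFin \o (fun x => f (a - x))).
Proof.
move=> /integrableP[mf foo]; apply/integrableP; split.
  exact: measurableT_comp mf (measurable_reflect a).
have := @ge0_integral_reflect_scale a 1 (fun x => `|(f x)%:E|%E) ltr01.
rewrite expr1n invr1 mul1e => H.
under eq_integral do rewrite /= -[X in a - X]scale1r.
by rewrite /= H//; exact: measurableT_comp.
Qed.

Lemma Rintegral_reflect a (f : E -> R) :
  mu.-integrable setT (EFin \o f) ->
  \int[mu]_x f (a - x) = \int[mu]_x f x.
Proof.
move=> fi; have /integrableP[mf foo] := fi.
rewrite /Rintegral; congr fine.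
have := @integral_pushforward _ _ _ _ _ _ (measurable_reflect a) mu setT
  (EFin \o f) mf (integrable_reflect a fi).
rewrite preimage_setT => /(_ measurableT) /= <-.
apply: (@eq_measure_integral _ _ _ setT mu
  (measure_function_pushforward__canonical__measure_function_Measure
    mu (measurable_reflect a))) => A mA _ /=.
rewrite /pushforward.
rewrite (_ : (fun _ => _) = reflect_scale a 1).
  by rewrite lebesgue_reflect_scale// expr1n invr1 mul1e.
by apply/funext => x; rewrite /reflect_scale scale1r.
Qed.

Lemma translate_reflect a (f : E -> R) :
  (fun x => f (x + a)) = (fun x => f (a - (0 - x))).
Proof. by apply/funext => x; rewrite sub0r opprK addrC. Qed.

Lemma integrable_translate a (f : E -> R) :
  mu.-integrable setT (EFin \o f) ->
  mu.-integrable setT (EFin \o (fun x => f (x + a))).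
Proof.
move=> fi; rewrite translate_reflect.
exact: (integrable_reflect 0 (integrable_reflect a fi)).
Qed.

Lemma Rintegral_translate a (f : E -> R) :
  mu.-integrable setT (EFin \o f) ->
  \int[mu]_x f (x + a) = \int[mu]_x f x.
Proof.
move=> fi; rewrite -(Rintegral_reflect a fi).
rewrite -(Rintegral_reflect 0 (integrable_reflect a fi)).
by congr Rintegral; rewrite translate_reflect.
Qed.

End invariance.

(** * Smooth functions of one variable and bumps *)

Section smooth1.
Context {R : realType}.
Implicit Types (f g : R -> R).

Fixpoint Ck (k : nat) f : Prop :=
  if k is k'.+1 then (forall x : R, derivable f x 1) /\ Ck k' (derive1 f) else True.

Definition smooth1 f : Prop := forall k, Ck k f.

Lemma is_derive_derive1 f g : (forall x : R, is_derive x 1 f (g x)) -> derive1 f = g.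
Proof. by move=> fg; apply/funext => x; rewrite derive1E; case: (fg x). Qed.

Lemma Ck_is_derive k f g :
  (forall x : R, is_derive x 1 f (g x)) -> Ck k g -> Ck k.+1 f.
Proof.
move=> fg gk; split; first by move=> x; case: (fg x).
by rewrite (is_derive_derive1 fg).
Qed.

Lemma CkS k f : Ck k.+1 f -> Ck k f.
Proof.
elim: k f => [//|k IH] f [df fk]; split => //; exact: IH.
Qed.

Lemma derivable1_is_derive f (x : R) : derivable f x 1 -> is_derive x 1 f (derive1 f x).
Proof. by move=> /derivableP; rewrite derive1E. Qed.

Lemma CkD k f g : Ck k f -> Ck k g -> Ck k (f + g).
Proof.
elim: k f g => [//|k IH] f g [df fk] [dg gk].
apply: (@Ck_is_derive _ _ (derive1 f + derive1 g)); last exact: IH.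
by move=> x; apply: is_deriveD; exact: derivable1_is_derive.
Qed.

Lemma CkM k f g : Ck k f -> Ck k g -> Ck k (f * g).
Proof.
elim: k f g => [//|k IH] f g fk gk.
have [df f'k] := fk; have [dg g'k] := gk.
apply: (@Ck_is_derive _ _ (f * derive1 g + g * derive1 f)).
  by move=> x; apply: is_deriveM; exact: derivable1_is_derive.
by apply: CkD; apply: IH => //; exact: CkS.
Qed.

Lemma Ck_cst k (c : R) : Ck k (cst c).
Proof.
elim: k c => [//|k IH] c; by apply: (@Ck_is_derive _ _ (cst 0)) => // x; exact: is_derive_cst.
Qed.

Lemma Ck_affine k f (a b : R) : Ck k f -> Ck k (fun t => f (a * t + b)).
Proof.
elim: k f => [//|k IH] f [df fk].
apply: (@Ck_is_derive _ _ (cst a * (fun t => derive1 f (a * t + b)))); last first.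
  by apply: CkM; [exact: Ck_cst|exact: IH].
move=> x.
have H : is_derive x 1 (fun t => a * t + b) a.
  apply: is_derive_eq; rewrite /GRing.scale/=; lra.
have := @is_derive1_comp R f (fun t => a * t + b) x _ _
  (derivable1_is_derive (df (a * x + b))) H.
by rewrite mulrC.
Qed.

Lemma smooth1_derivable f (x : R) : smooth1 f -> derivable f x 1.
Proof. by move=> /(_ 1%N)[]. Qed.

Lemma smooth1_derive f : smooth1 f -> smooth1 (derive1 f).
Proof. by move=> sf k; have [] := sf k.+1. Qed.

Lemma smooth1_continuous f : smooth1 f -> continuous f.
Proof.
move=> sf x; apply: differentiable_continuous; apply/derivable1_diffP.
exact: smooth1_derivable.
Qed.

Lemma smooth1_cst (c : R) : smooth1 (cst c).
Proof. by move=> k; exact: Ck_cst. Qed.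

Lemma smooth1D f g : smooth1 f -> smooth1 g -> smooth1 (f + g).
Proof. by move=> sf sg k; exact: CkD. Qed.

Lemma smooth1M f g : smooth1 f -> smooth1 g -> smooth1 (f * g).
Proof. by move=> sf sg k; exact: CkM. Qed.

Lemma smooth1_affine f (a b : R) :
  smooth1 f -> smooth1 (fun t => f (a * t + b)).
Proof. by move=> sf k; exact: Ck_affine. Qed.

Lemma smooth1_id : smooth1 (@id R).
Proof.
by case=> [//|k]; apply: (@Ck_is_derive _ _ (cst 1)); exact: Ck_cst.
Qed.

Lemma smooth1X f j : smooth1 f -> smooth1 (fun t => f t ^+ j).
Proof.
move=> sf; elim: j => [|j IH]; first exact: smooth1_cst.
rewrite (_ : (fun t => _) = f * (fun t => f t ^+ j)); first exact: smooth1M.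
by apply/funext => t; rewrite exprS.
Qed.

(** The family is closed under differentiation up to linear combinations, which
    is what makes its members smooth. *)
Definition flat_exp (i : nat) : R -> R :=
  fun x => if 0 < x then x ^- i * expR (- x^-1) else 0.

Lemma flat_exp_ge0 i (x : R) : 0 <= flat_exp i x.
Proof.
rewrite /flat_exp; case: ltP => // x0.
by rewrite mulr_ge0 ?expR_ge0// invr_ge0 exprn_ge0// ltW.
Qed.

Lemma flat_exp_le i (x : R) : flat_exp i x <= (i.+2)`!%:R * x ^+ 2.
Proof.
rewrite /flat_exp; case: ltP => x0; last by rewrite mulr_ge0// sqr_ge0.
have := @expR_ge1Dxn R x^-1 i.+1 (ltW _); rewrite invr_gt0 => /(_ x0) H.
have {}H : x^-1 ^+ i.+2 / (i.+2)`!%:R <= expR x^-1.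
  by apply: le_trans H; rewrite lerDr.
rewrite expRN ler_pdivrMr ?expR_gt0//.
have f0 : 0 < (i.+2)`!%:R :> R by rewrite ltr0n fact_gt0.
move: H; rewrite ler_pdivrMr// => H.
have xi : x ^- i = x ^+ 2 * x^-1 ^+ i.+2.
  by rewrite -exprVn -[i.+2]addn2 exprD mulrCA -exprMn mulfV ?expr1n ?mulr1// gt_eqF.
rewrite xi [leRHS]mulrAC [leRHS]mulrC; apply: ler_wpM2l; first exact: sqr_ge0.
by rewrite mulrC.
Qed.

Lemma is_derive_le_sqr f (C : R) :
  f 0 = 0 -> (forall x, `|f x| <= C * x ^+ 2) -> is_derive (0 : R) 1 f 0.
Proof.
move=> f0 fC.
have C0 : 0 <= C.
  by have := fC 1; rewrite expr1n mulr1; apply: le_trans.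
suff H : h^-1 *: (f (h *: 1 + 0) - f 0) @[h --> 0^'] --> (0 : R).
  by split; [apply/cvg_ex; exists 0|exact/cvg_lim].
apply/cvgrPdist_le => /= e e0.
have eC : 0 < e / (C + 1) by rewrite divr_gt0// ltr_wpDl.
near=> h.
have hn0 : h != 0 by near: h; exact: nbhs_dnbhs_neq.
rewrite sub0r normrN f0 subr0 addr0 scaler1 normrM normfV.
rewrite ler_pdivrMl ?normr_gt0//; apply: le_trans (fC _) _.
rewrite -normr_id -[X in C * X]ger0_norm ?sqr_ge0// normrX expr2 mulrCA.
rewrite normr_id ler_wpM2l//.
have he : `|h| <= e / (C + 1).
  near: h; exact: dnbhs0_le.
apply: (@le_trans _ _ ((C + 1) * `|h|)).
  by rewrite ler_wpM2r// lerDl.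
by rewrite -ler_pdivlMl ?ltr_wpDl// mulrC.
Unshelve. all: end_near. Qed.

Lemma is_derive_flat_exp i (x : R) :
  is_derive x 1 (flat_exp i) (flat_exp i.+2 x - i%:R * flat_exp i.+1 x).
Proof.
have [x0|x0|->] := ltgtP x 0.
- rewrite /flat_exp !(ltNge 0 x) (ltW x0)/= mulr0 subr0.
  apply: (@near_eq_is_derive _ _ _ (cst 0)).
  near=> y; rewrite ltNge ifN// negbK; apply: ltW; near: y; exact: lt_nbhsl.
- have xn0 : x != 0 by rewrite gt_eqF.
  have dV : is_derive x 1 (fun y : R => y^-1) (- x ^- 2).
    by apply: is_derive_eq (is_deriveV xn0 (is_derive_id _ _)) _; rewrite /GRing.scale/= mulr1.
  have dX : is_derive x 1 (fun y : R => y ^- i) (- (i%:R * x^-1 ^+ i.+1)).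
    have := is_deriveX i dV.
    rewrite (_ : _ ^+ i = (fun y : R => y ^- i)); last first.
      by apply/funext => y; rewrite fctE exprVn.
    move/is_derive_eq; apply; rewrite /GRing.scale/= mulrN -mulrA -exprVn.
    by case: (i) => [|j]; rewrite ?mul0r// -exprD addn2.
  have dE : is_derive x 1 (fun y : R => expR (- y^-1)) (expR (- x^-1) * x ^- 2).
    have := @is_derive1_comp R expR (fun y => - y^-1) x _ _
      (is_derive_expR (- x^-1)) (is_deriveN dV).
    by rewrite opprK.
  have dXE := is_deriveM dX dE.
  apply: is_derive_eq.
    apply: near_eq_is_derive dXE.
    near=> y; rewrite /flat_exp ifT//; near: y; exact: lt_nbhsr.
  rewrite /flat_exp x0 /GRing.scale/=.
  rewrite -!exprVn; set y := x^-1; rewrite !exprS; ring.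
- rewrite {2 3}/flat_exp ltxx mulr0 subr0.
  apply: (@is_derive_le_sqr _ (i.+2)`!%:R); first by rewrite /flat_exp ltxx.
  by move=> y; rewrite ger0_norm ?flat_exp_ge0// flat_exp_le.
Unshelve. all: end_near. Qed.

Lemma smooth1_flat_exp i : smooth1 (flat_exp i).
Proof.
move=> k; elim: k i => [//|k IH] i.
apply: (Ck_is_derive (is_derive_flat_exp i)).
rewrite (_ : (fun x => _) = flat_exp i.+2 + cst (- i%:R) * flat_exp i.+1).
  by apply: CkD => //; apply: CkM => //; exact: Ck_cst.
by apply/funext => x; rewrite !fctE mulNr.
Qed.

Definition bump (lo hi : R) : R -> R :=
  fun t => flat_exp 0 (t - lo) * flat_exp 0 (hi - t).

Lemma smooth1_bump lo hi : smooth1 (bump lo hi).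
Proof.
rewrite (_ : bump lo hi = (fun t => flat_exp 0 (1 * t + (- lo))) *
                          (fun t => flat_exp 0 ((- 1) * t + hi))).
  by apply: smooth1M; apply: smooth1_affine; exact: smooth1_flat_exp.
by apply/funext => t; rewrite !fctE mul1r mulN1r [- t + hi]addrC.
Qed.

Lemma bump_ge0 lo hi t : 0 <= bump lo hi t.
Proof. by rewrite mulr_ge0// flat_exp_ge0. Qed.

Lemma flat_exp0_le1 t : flat_exp 0 t <= 1.
Proof.
rewrite /flat_exp expr0 invr1 mul1r; case: ltP => // t0.
by rewrite -expR0 ler_expR oppr_le0 invr_ge0 ltW.
Qed.

Lemma bump_le1 lo hi t : bump lo hi t <= 1.
Proof.
by rewrite -[leRHS]mul1r; apply: ler_pM => //; rewrite ?flat_exp_ge0 ?flat_exp0_le1.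
Qed.

Lemma bump_gt0 lo hi t : lo < t < hi -> 0 < bump lo hi t.
Proof.
move=> /andP[lot thi]; rewrite /bump /flat_exp !subr_gt0 lot thi.
by rewrite !expr0 invr1 !mul1r mulr_gt0// expR_gt0.
Qed.

Lemma bump_eq0 lo hi t : ~~ (lo < t < hi) -> bump lo hi t = 0.
Proof.
rewrite negb_and /bump /flat_exp !subr_gt0 => /orP[]/negbTE->; ring.
Qed.

End smooth1.

(** * Product kernels as test functions *)

Section support1.
Context {R : realType}.
Implicit Types (f g : R -> R).

Definition supp1 f (lo hi : R) : Prop :=
  forall t, ~~ (lo <= t <= hi) -> f t = 0.

Lemma supp1_derive f lo hi : supp1 f lo hi -> supp1 (derive1 f) lo hi.
Proof.
move=> sf t; rewrite negb_and -!ltNge derive1E => tlh.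
rewrite (_ : 'D_1 f t = 'D_1 (cst 0 : R -> R) t); first by rewrite derive_cst.
apply: near_eq_derive; case/orP: tlh => h; near=> y; rewrite /cst sf// negb_and -!ltNge.
  by apply/orP; left; near: y; exact: lt_nbhsl.
by apply/orP; right; near: y; exact: lt_nbhsr.
Unshelve. all: end_near. Qed.

Lemma supp1Ml f g lo hi : supp1 g lo hi -> supp1 (f * g) lo hi.
Proof. by move=> sg t tlh; rewrite fctE sg// mulr0. Qed.

Lemma smooth1_bounded f lo hi : smooth1 f -> supp1 f lo hi ->
  exists2 M, 0 < M & forall t, `|f t| <= M.
Proof.
move=> sf fs.
have : compact (f @` `[lo, hi]).
  apply: continuous_compact; last exact: segment_compact.
  by apply: continuous_subspaceT => x; exact: smooth1_continuous.
move=> /compact_bounded /pinfty_ex_gt0[M M0 /= fM].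
exists M => // t; have [tlh|tlh] := boolP (lo <= t <= hi).
  by apply: fM; exists t => //=; rewrite in_itv.
by rewrite fs// normr0 ltW.
Qed.

Lemma smooth1_lipschitz f lo hi : smooth1 f -> supp1 f lo hi ->
  exists2 L, 0 < L & forall t t', `|f t - f t'| <= L * `|t - t'|.
Proof.
move=> sf fs.
have [L L0 dfL] := smooth1_bounded (smooth1_derive sf) (supp1_derive fs).
exists L => // t t'; wlog tt' : t t' / t < t'.
  move=> H; have [|tt'|->] := ltgtP t t'; first exact: H.
  - by rewrite distrC [X in _ * X]distrC; exact: H.
  - by rewrite !subrr normr0 mulr0.
rewrite distrC [X in _ * X]distrC.
have [x _ ->] := @MVT _ f (derive1 f) _ _ tt'
  (fun x _ => derivable1_is_derive (smooth1_derivable sf))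
  (continuous_subspaceT (smooth1_continuous sf)).
by rewrite normrM ler_wpM2r.
Qed.

End support1.

Section directional.
Context {R : realType} {n : nat}.
Local Notation E := 'rV[R]_n.

Lemma is_derive_lineP (f : E -> R) (x v : E) (t df : R) :
  is_derive t 1 (fun s : R => f (s *: v + x)) df <->
  is_derive (t *: v + x) v (f : E -> R^o) df.
Proof.
have qE : (fun h : R => h^-1 *: (f ((h *: 1 + t) *: v + x) - f (t *: v + x))) =
  (fun h : R => h^-1 *: ((f : E -> R^o) (h *: v + (t *: v + x)) - f (t *: v + x))).
  by apply/funext => h; rewrite scaler1 scalerDl addrA.
split=> -[d v0]; split.
- by rewrite /derivable /= -qE.
- by rewrite -v0 /derive /= -qE.
- by rewrite /derivable /= qE.
- by rewrite -v0 /derive /= qE.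
Qed.

Lemma is_derive_line0P (f : E -> R) (x v : E) (df : R) :
  is_derive (0 : R) 1 (fun s : R => f (s *: v + x)) df <->
  is_derive x v (f : E -> R^o) df.
Proof. by rewrite -[x in is_derive x v f _]add0r -[X in X + x](scale0r v) is_derive_lineP. Qed.

End directional.

Section product_kernel.
Context {R : realType} {n : nat}.
Local Notation E := 'rV[R]_n.
Implicit Types (b : 'I_n -> R -> R) (lo hi : 'I_n -> R).

(** Tensor products are all the test functions that will be needed, and their
    partial derivatives are again tensor products. *)
Definition pk b : E -> R := fun x => \prod_k b k (x ord0 k).

Definition upd b (i : 'I_n) (f : R -> R) : 'I_n -> R -> R :=
  fun k => if k == i then f else b k.

Definition smooth_family b := forall k, smooth1 (b k).

Definition supp_family b lo hi := forall k, supp1 (b k) (lo k) (hi k).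

Lemma upd_smooth b i f :
  smooth_family b -> smooth1 f -> smooth_family (upd b i f).
Proof. by move=> sb sf k; rewrite /upd; case: eqP. Qed.

Lemma upd_supp b i f lo hi : supp_family b lo hi ->
  supp1 f (lo i) (hi i) -> supp_family (upd b i f) lo hi.
Proof. by move=> sb sf k; rewrite /upd; case: eqVneq => [->|_]. Qed.

Lemma pk_upd b i f x :
  pk (upd b i f) x = f (x ord0 i) * \prod_(k | k != i) b k (x ord0 k).
Proof.
rewrite /pk (bigD1 i)//= {1}/upd eqxx; congr (_ * _).
by apply: eq_bigr => k /negbTE ki; rewrite /upd ki.
Qed.

Lemma upd_id b i : upd b i (b i) = b.
Proof. by apply/funext => k; rewrite /upd; case: eqVneq => [->|]. Qed.

Lemma is_derive_pk b i (x : E) : smooth_family b ->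
  is_derive x (delta_mx ord0 i) (pk b : E -> R^o) (pk (upd b i (derive1 (b i))) x).
Proof.
move=> sb; apply/is_derive_line0P; rewrite pk_upd.
set c := \prod_(k | _) _.
rewrite (_ : (fun s : R => _) = (fun s => b i (1 * s + x ord0 i) * c)); last first.
  apply/funext => s; rewrite -{1}[b](upd_id b i) pk_upd !mxE !eqxx/= mulr1 mul1r.
  congr (_ * _); apply: eq_bigr => k ki.
  by rewrite !mxE (negbTE ki)/= mulr0 add0r.
have H : is_derive (0 : R) 1 (fun t : R => 1 * t + x ord0 i) 1.
  apply: is_derive_eq; rewrite /GRing.scale/=; lra.
have := @is_derive1_comp R (b i) (fun t => 1 * t + x ord0 i) 0 _ _
  (derivable1_is_derive (smooth1_derivable (sb i))) H.
rewrite mulr0 add0r mulr1 => D.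
have := is_deriveM D (is_derive_cst c (0 : R) 1).
by move/is_derive_eq; apply; rewrite /GRing.scale/= mulr0 add0r mulrC.
Qed.

Lemma partial_pk b i : smooth_family b ->
  partial i (pk b) = pk (upd b i (derive1 (b i))).
Proof.
by move=> sb; apply/funext => x; case: (is_derive_pk i x sb).
Qed.

Lemma pk_continuous b : smooth_family b -> continuous (pk b).
Proof.
move=> sb x; apply: (@cvg_big R 'I_n *%R 1 xpredT (@mul_continuous R) E (nbhs x)
  (index_enum _) (fun k x => b k (x ord0 k)) (fun k => b k (x ord0 k))) => k _.
apply: (@continuous_comp _ _ _ (fun x : E => x ord0 k) (b k)).
  exact: coord_continuous.
exact: smooth1_continuous.
Qed.

Lemma partials_pk b s : smooth_family b ->
  exists2 b', smooth_family b' & partials s (pk b) = pk b'.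
Proof.
move=> sb; elim: s => [|i s [b' sb' IH]]; first by exists b.
exists (upd b' i (derive1 (b' i))); last by rewrite /= IH partial_pk.
exact: upd_smooth (smooth1_derive _).
Qed.

Lemma smooth_pk b : smooth_family b -> smooth (pk b).
Proof.
move=> sb s; have [b' sb' ->] := partials_pk s sb; split.
  exact: pk_continuous.
by move=> i x; case: (is_derive_pk i x sb').
Qed.

Lemma pk_eq0 b lo hi x : supp_family b lo hi -> ~ cbox lo hi x -> pk b x = 0.
Proof.
move=> sb /existsNP[i /negP xi]; apply/eqP; rewrite prodf_seq_eq0.
by apply/hasP; exists i; rewrite ?mem_index_enum//= sb.
Qed.

Lemma test_pk (O : set E) b lo hi : smooth_family b -> supp_family b lo hi ->
  cbox lo hi `<=` O -> test_function O (pk b).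
Proof.
move=> sb bs lhO.
have ss : closure [set x | pk b x != 0] `<=` cbox lo hi.
  rewrite (closure_id (cbox lo hi)).1; last exact: closed_cbox.
  apply: closureS => x /=; apply: contraNP => xb.
  by apply/eqP; exact: pk_eq0 xb.
split; [exact: smooth_pk| |exact: subset_trans ss lhO].
by apply: subclosed_compact ss; [exact: closed_closure|exact: compact_cbox].
Qed.

Lemma pk_bounded b lo hi : smooth_family b -> supp_family b lo hi ->
  exists2 M, 0 < M & forall x, `|pk b x| <= M.
Proof.
move=> sb bs.
have /choice[M HM] k : exists M, 0 < M /\ forall t, `|b k t| <= M.
  by have [M M0 bM] := smooth1_bounded (sb k) (bs k); exists M.
exists (\prod_k M k); first by apply: prodr_gt0 => k _; case: (HM k).
move=> x; rewrite normr_prod; apply: ler_prod => k _.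
by rewrite normr_ge0/=; case: (HM k).
Qed.

End product_kernel.

(** * Integration by parts for test functions *)

Section integrability.
Context d (T : measurableType d) (R : realType)
  (mu : {measure set T -> \bar R}) (D : set T) (mD : measurable D).
Implicit Types (f g : T -> R) (M : R).

Lemma bounded_onP f M : (forall x, D x -> `|f x| <= M) -> [bounded f x | x in D].
Proof.
move=> fM; exists M; split; first exact: num_real.
by move=> N MN x Dx; apply: le_trans (ltW MN); exact: fM.
Qed.

Lemma bounded_integrable f M : (mu D < +oo)%E -> measurable_fun D f ->
  (forall x, D x -> `|f x| <= M) -> mu.-integrable D (EFin \o f).
Proof.
move=> Doo mf fM; apply: measurable_bounded_integrable => //.
exact: bounded_onP fM.
Qed.

Lemma integrable_mul_bounded f g M : mu.-integrable D (EFin \o f) ->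
  measurable_fun D g -> (forall x, D x -> `|g x| <= M) ->
  mu.-integrable D (EFin \o (f \* g)).
Proof.
move=> fi mg gM.
rewrite (_ : _ \o _ = (EFin \o f) \* (EFin \o g))%E; last first.
  by apply/funext => x /=; rewrite EFinM.
by apply: integrableMl => //; exact: bounded_onP gM.
Qed.

Lemma integrable_subset_support f (A : set T) : measurable A -> A `<=` D ->
  (forall x, D x -> ~ A x -> f x = 0) ->
  mu.-integrable A (EFin \o f) <-> mu.-integrable D (EFin \o f).
Proof.
move=> mA AD fA.
rewrite (integrable_mkcond (D := A))// (integrable_mkcond (D := D))//.
suff -> : (EFin \o f) \_ A = (EFin \o f) \_ D by [].
apply/funext => x; rewrite !patchE; case: ifPn => [|/negP xA].
  by rewrite inE => /AD xD; rewrite mem_set.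
case: ifPn => //; rewrite inE => xD /=; rewrite fA// => Ax.
by apply: xA; rewrite inE.
Qed.

Lemma Rintegral_subset_support f (A : set T) : A `<=` D ->
  (forall x, D x -> ~ A x -> f x = 0) ->
  \int[mu]_(x in A) f x = \int[mu]_(x in D) f x.
Proof.
move=> AD fA; rewrite Rintegral_mkcond [RHS]Rintegral_mkcond; congr Rintegral.
apply/funext => x; rewrite !patchE; case: ifPn => [|/negP xA].
  by rewrite inE => /AD xD; rewrite mem_set.
case: ifPn => //; rewrite inE => xD; rewrite fA// => Ax.
by apply: xA; rewrite inE.
Qed.

End integrability.

Section compact_support.
Context {R : realType} {n : nat}.
Local Notation E := 'rV[R]_n.
Local Notation mu := (@lebesgue_rV R n).
Local Notation cube M := (cbox (fun=> - M) (fun=> M) : set E).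
Implicit Types (f g : E -> R) (M : R).

Lemma compact_cube (K : set E) : compact K -> exists2 M, 0 < M & K `<=` cube M.
Proof.
move=> /compact_bounded /pinfty_ex_gt0[M M0 /= KM]; exists M => // x /KM xM i.
rewrite -ler_norml; apply: le_trans xM.
exact: coord_le_norm.
Qed.

Definition compactly_supported f := exists M, forall x, ~ cube M x -> f x = 0.

Lemma continuous_measurable f (D : set E) : measurable D -> continuous f ->
  measurable_fun D f.
Proof.
move=> mD cf; apply: (measurable_funS measurableT) => //.
by apply: continuous_measurable_rV; [exact: openT|move=> x _; exact: cf].
Qed.

Lemma continuous_bounded f : continuous f -> compactly_supported f ->
  exists2 B, 0 < B & forall x, `|f x| <= B.
Proof.
move=> cf [M fM].
have : compact (f @` cube M).
  by apply: continuous_compact; [exact: continuous_subspaceT|exact: compact_cbox].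
move=> /compact_bounded /pinfty_ex_gt0[B B0 /= fB].
exists B => // x; have [xM|xM] := pselect (cube M x).
  by apply: fB; exists x.
by rewrite fM// normr0 ltW.
Qed.

Lemma cube_finite M : (mu (cube M) < +oo)%E.
Proof. by rewrite lebesgue_cbox ltry. Qed.

Lemma continuous_integrable f (D : set E) : measurable D -> continuous f ->
  compactly_supported f -> mu.-integrable D (EFin \o f).
Proof.
move=> mD cf sf; have [B B0 fB] := continuous_bounded cf sf.
have [M fM] := sf.
apply: (@integrableS _ _ _ _ setT) => //.
apply/(@integrable_subset_support _ _ _ mu setT measurableT f (cube M)) => //.
- exact: measurable_cbox.
- by move=> x _; exact: fM.
- apply: (@bounded_integrable _ _ _ mu _ (measurable_cbox _ _) _ B (cube_finite M)) => //.
  by apply: continuous_measurable => //; exact: measurable_cbox.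
Qed.

(** Translation invariance kills the integrals of the difference quotients,
    which converge boundedly to the derivative. *)
Lemma Rintegral_derivative (i : 'I_n) f g :
  continuous f -> continuous g -> compactly_supported f -> compactly_supported g ->
  (forall x, is_derive x (delta_mx ord0 i) (f : E -> R^o) (g x)) ->
  \int[mu]_x g x = 0.
Proof.
move=> cf cg sf sg fg.
pose e : E := delta_mx ord0 i.
pose h k : R := k.+1%:R^-1.
have h0 k : 0 < h k by rewrite invr_gt0.
have h1 k : h k <= 1 by rewrite invf_le1 ?ler1n.
pose q k x := (h k)^-1 * (f (x + h k *: e) - f x).
have fi : mu.-integrable setT (EFin \o f) by exact: continuous_integrable.
have q0 k : \int[mu]_x q k x = 0.
  rewrite RintegralZl//; last first.
    rewrite (_ : _ \o _ = (EFin \o (fun x => f (x + h k *: e)%R)) \- (EFin \o f))%E//.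
    by apply: integrableB => //; exact: integrable_translate.
  rewrite RintegralB//; last exact: integrable_translate.
  by rewrite Rintegral_translate// subrr mulr0.
have lineD x (t : R) : is_derive t 1 (fun s : R => f (s *: e + x)) (g (t *: e + x)).
  exact/is_derive_lineP.
have [B B0 gB] := continuous_bounded cg sg.
have qB k x : `|q k x| <= B.
  have lc : {within `[0, h k], continuous (fun s : R => f (s *: e + x))}.
    by apply: derivable_within_continuous => s _; case: (lineD x s).
  have [s _] := @MVT _ (fun s : R => f (s *: e + x)) _ _ _ (h0 k)
    (fun s _ => lineD x s) lc.
  rewrite scale0r add0r subr0 [_ + x]addrC /q => ->.
  by rewrite mulrCA mulVf ?mulr1// gt_eqF.
have [M sfM] := sf.
pose N := `|M| + 1.
have qN k x : ~ cube N x -> q k x = 0.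
  move=> xN; rewrite /q !sfM ?subrr ?mulr0//; apply: contra_not xN => xM j.
    have := xM j; rewrite -!ler_norml => /le_trans; apply.
    by rewrite /N; apply: le_trans (ler_norm _) _; rewrite lerDl.
  have := xM j; rewrite -!ler_norml !mxE !eqxx/= => {}xM.
  rewrite -[x ord0 j](addrK (h k * (j == i)%:R)).
  apply: le_trans (ler_normB _ _) _; apply: lerD.
    by apply: le_trans xM _; exact: ler_norm.
  rewrite normrM ger0_norm ?(ltW (h0 k))//; case: (j == i).
    by rewrite normr1 mulr1.
  by rewrite normr0 mulr0 ler01.
have mq k : measurable_fun setT (EFin \o q k).
  apply/measurable_EFinP; apply: measurable_funM => //.
  apply: measurable_funB; last exact: continuous_measurable.
  by have /integrableP[/measurable_EFinP] := integrable_translate (h k *: e) fi.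
have cq x : (EFin \o (q ^~ x)) k @[k --> \oo] --> (g x)%:E.
  apply: cvg_EFin; first exact: nearW.
  have := lineD x 0; rewrite scale0r add0r => -[/cvg_ex[/= l ql] dE].
  have gl : g x = l by rewrite -dE; exact/cvg_lim.
  have hn0 : (forall k, h k != 0) /\ h k @[k --> \oo] --> (0 : R).
    split; first by move=> k; rewrite gt_eqF.
    exact: cvg_harmonic.
  have := (cvgr_dnbhsP _ _ _).1 ql _ hn0.
  rewrite gl; apply: cvg_trans; apply: near_eq_cvg; apply: nearW => k /=.
  by rewrite /q scaler1 addr0 scale0r add0r [x + _]addrC.
have Bi : mu.-integrable setT (EFin \o (fun x : E => B * \1_(cube N) x)).
  apply/(@integrable_subset_support _ _ _ mu setT measurableT _ (cube N)) => //.
  - exact: measurable_cbox.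
  - by move=> x _ xN; rewrite indicE memNset ?mulr0.
  - apply: (@bounded_integrable _ _ _ mu _ (measurable_cbox _ _) _ B (cube_finite N)).
      by apply: measurable_funM => //; apply: measurable_indic; exact: measurable_cbox.
    by move=> x _; rewrite indicE ger0_norm ?mulr_ge0 ?(ltW B0)// ler_piMr ?(ltW B0)// lern1 leq_b1.
have [||_ _] := @dominated_convergence _ _ _ mu setT measurableT
  (fun k => EFin \o q k) (EFin \o g) _ mq _ (aeW _ (fun x _ => cq x)) Bi _.
- by apply/measurable_EFinP; exact: continuous_measurable.
- apply: aeW => x k _ /=; rewrite lee_fin indicE.
  have [xN|xN] := pselect (cube N x); first by rewrite mem_set// mulr1.
  by rewrite qN// normr0 memNset// mulr0.
have gi : mu.-integrable setT (EFin \o g) by exact: continuous_integrable.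
rewrite -(fineK (integrable_fin_num measurableT gi)) => /fine_cvg.
rewrite -/(Rintegral mu setT g) => H.
apply/esym/(@cvg_unique _ (@norm_hausdorff _ R) _ _ _ _ _ H).
apply: cvg_near_cst; apply: nearW => k /=; exact: q0.
Qed.

End compact_support.

Section test_functions.
Context {R : realType} {n : nat}.
Local Notation E := 'rV[R]_n.
Local Notation mu := (@lebesgue_rV R n).
Variable O : set E.
Implicit Types (phi psi : E -> R).

Local Notation supp f := (closure [set x | f x != 0]).

Lemma test_continuous phi : test_function O phi -> continuous phi.
Proof. by move=> [/(_ [::])[]]. Qed.

Lemma test_is_derive phi i (x : E) : test_function O phi ->
  is_derive x (delta_mx ord0 i) (phi : E -> R^o) (partial i phi x).
Proof. by move=> [/(_ [::])[_ d] _ _]; exact: DeriveDef. Qed.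

Lemma supp_partial phi i : supp (partial i phi) `<=` supp phi.
Proof.
rewrite [X in _ `<=` X](closure_id _).1; last exact: closed_closure.
apply: closureS => x /= px; apply: contrapT => xs; move/eqP: px; apply.
rewrite /partial (_ : 'D_ _ _ _ = 'D_(delta_mx ord0 i) (cst 0 : E -> R^o) x).
  by rewrite derive_cst.
apply: near_eq_derive.
have : nbhs x (~` supp phi).
  by apply: open_nbhs_nbhs; split => //; apply: closed_openC; exact: closed_closure.
apply: filterS => y ys; apply/eqP; apply: contra_notT ys => py.
exact: subset_closure.
Qed.

Lemma test_partial phi i : test_function O phi -> test_function O (partial i phi).
Proof.
move=> [sphi cphi phiO]; split.
- move=> s; have := sphi (rcons s i).
  by rewrite /partials foldr_rcons.
- by apply: subclosed_compact cphi _; [exact: closed_closure|exact: supp_partial].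
- by apply: subset_trans phiO; exact: supp_partial.
Qed.

Lemma test_eq0 phi x : test_function O phi -> ~ O x -> phi x = 0.
Proof.
move=> [_ _ phiO] Ox; apply/eqP; apply: contra_notT Ox => px.
by apply: phiO; exact: subset_closure.
Qed.

Lemma test_compactly_supported phi :
  test_function O phi -> compactly_supported phi.
Proof.
move=> [_ /compact_cube[M _ sM] _]; exists M => x xM; apply/eqP.
by apply: contra_notT xM => px; apply: sM; exact: subset_closure.
Qed.

Lemma test_bounded phi : test_function O phi ->
  exists2 M, 0 < M & forall x, `|phi x| <= M.
Proof.
by move=> tp; apply: continuous_bounded; [exact: test_continuous|exact: test_compactly_supported].
Qed.

Lemma test_ibp phi psi i : test_function O phi -> test_function O psi ->
  measurable O ->
  \int[mu]_(x in O) (phi x * partial i psi x) =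
  - \int[mu]_(x in O) (partial i phi x * psi x).
Proof.
move=> tp ts mO.
have compM f g : compactly_supported f -> compactly_supported (f \* g : E -> R).
  by move=> [M fM]; exists M => x /fM /= ->; rewrite mul0r.
have cM (f g : E -> R) : continuous f -> continuous g -> continuous (f \* g).
  by move=> cf cg x; apply: continuousM; [exact: cf|exact: cg].
have tdp := test_partial i tp; have tds := test_partial i ts.
have c1 := cM _ _ (test_continuous tp) (test_continuous tds).
have c2 := cM _ _ (test_continuous tdp) (test_continuous ts).
have s1 := compM _ (partial i psi) (test_compactly_supported tp).
have s2 := compM _ psi (test_compactly_supported tdp).
have i1 := continuous_integrable measurableT c1 s1.
have i2 := continuous_integrable measurableT c2 s2.
apply/eqP; rewrite -subr_eq0 opprK; apply/eqP.
rewrite (@Rintegral_subset_support _ _ _ mu setT (phi \* partial i psi) O)//; last first.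
  by move=> x _ /(test_eq0 tp) /= ->; rewrite mul0r.
rewrite (@Rintegral_subset_support _ _ _ mu setT (partial i phi \* psi) O)//; last first.
  by move=> x _ /(test_eq0 ts) /= ->; rewrite mulr0.
rewrite -RintegralD//.
apply: (@Rintegral_derivative _ _ i (phi \* psi)).
- by apply: cM; exact: test_continuous.
- by move=> x; apply: continuousD; [exact: c1|exact: c2].
- by apply: compM; exact: test_compactly_supported.
- have [[M1 h1] [M2 h2]] := (s1, s2); exists (Num.max M1 M2) => x xM.
  have big M' : M' <= Num.max M1 M2 -> ~ cbox (fun=> - M') (fun=> M') x.
    move=> MM; apply: contra_not xM => xM j; rewrite -ler_norml.
    by apply: le_trans MM; rewrite ler_norml; exact: xM.
  rewrite -[LHS]/((phi \* partial i psi) x + (partial i phi \* psi) x).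
  by rewrite h1 ?h2 ?addr0//; apply: big; rewrite le_max lexx ?orbT.
- move=> x.
  have := is_deriveM (test_is_derive i x tp) (test_is_derive i x ts).
  by move/is_derive_eq; apply; rewrite /GRing.scale/= [psi x * _]mulrC.
Qed.

End test_functions.

(** * The fundamental lemma of the calculus of variations *)

Section real_convergence.
Context d (T : measurableType d) (R : realType)
  (mu : {measure set T -> \bar R}) (D : set T) (mD : measurable D).

Lemma dominated_Rintegral (f_ : nat -> T -> R) (f G : T -> R) :
  (forall k, measurable_fun D (f_ k)) ->
  (forall x, D x -> f_ k x @[k --> \oo] --> f x) ->
  mu.-integrable D (EFin \o G) ->
  (forall k x, D x -> `|f_ k x| <= G x) ->
  mu.-integrable D (EFin \o f) /\
  \int[mu]_(x in D) f_ k x @[k --> \oo] --> \int[mu]_(x in D) f x.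
Proof.
move=> mf ff Gi fG.
have [|||||fi _] := @dominated_convergence _ _ _ mu D mD
  (fun k => EFin \o f_ k) (EFin \o f) (EFin \o G).
- by move=> k; apply/measurable_EFinP.
- by apply/measurable_EFinP; exact: measurable_fun_cvg ff.
- apply: aeW => x Dx; apply: cvg_EFin; first exact: nearW.
  exact: ff.
- exact: Gi.
- by apply: aeW => x k Dx; rewrite lee_fin; exact: fG.
rewrite -(fineK (integrable_fin_num mD fi)) => /fine_cvg H.
by split.
Qed.

Lemma Rintegral_sum (I : finType) (f : I -> T -> R) :
  (forall i, mu.-integrable D (EFin \o f i)) ->
  \int[mu]_(x in D) (\sum_i f i x) = \sum_i \int[mu]_(x in D) f i x.
Proof.
move=> fi; rewrite /Rintegral; under eq_integral do rewrite -sumEFin.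
rewrite integral_sum// sum_fine// => i _.
apply: integrable_fin_num => //; exact: fi.
Qed.

End real_convergence.

Section fundamental_lemma.
Context {R : realType} {n : nat}.
Local Notation E := 'rV[R]_n.
Local Notation mu := (@lebesgue_rV R n).
Variables (O : set E) (g : E -> R).
Hypothesis oO : open O.
Hypothesis gi : mu.-integrable O (EFin \o g).
Hypothesis g0 : forall b lo hi, smooth_family b -> supp_family b lo hi ->
  cbox lo hi `<=` O -> \int[mu]_(x in O) (g x * pk b x) = 0.

Let mO : measurable O. Proof. exact: measurable_open. Qed.

Let mg : measurable_fun O g.
Proof. by have /integrableP[/measurable_EFinP] := gi. Qed.

Let norm_gi : mu.-integrable O (EFin \o (fun x => `|g x|)).
Proof.
rewrite (_ : _ \o _ = abse \o (EFin \o g)); first exact: integrable_abse.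
exact/funext.
Qed.

(** Products of [1 - (1 - bump)^j] increase to the indicator of a box. *)
Lemma integral_box_eq0 lo hi : cbox lo hi `<=` O ->
  \int[mu]_(x in O) (g x * \1_(obox lo hi) x) = 0.
Proof.
move=> lhO.
pose b j (k : 'I_n) : R -> R := fun t => 1 - (1 - bump (lo k) (hi k) t) ^+ j.
have bump01 k t : 0 <= 1 - bump (lo k) (hi k) t <= 1.
  by rewrite subr_ge0 bump_le1 gerBl bump_ge0.
have b01 j k t : 0 <= b j k t <= 1.
  rewrite /b subr_ge0 gerBl exprn_ile1//=; first by rewrite exprn_ge0//; case/andP: (bump01 k t).
  by case/andP: (bump01 k t).
  by case/andP: (bump01 k t).
have sb j : smooth_family (b j).
  move=> k; rewrite (_ : b j k = cst 1 + cst (-1) *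
     (fun t => (cst 1 + cst (-1) * bump (lo k) (hi k)) t ^+ j)); last first.
    by apply/funext => t; rewrite !fctE !mulN1r.
  apply: smooth1D; first exact: smooth1_cst.
  apply: smooth1M; first exact: smooth1_cst.
  apply: smooth1X; apply: smooth1D; first exact: smooth1_cst.
  apply: smooth1M; first exact: smooth1_cst.
  exact: smooth1_bump.
have bs j : supp_family (b j) lo hi.
  move=> k t tlh; rewrite /b bump_eq0 ?subr0 ?expr1n ?subrr//.
  by apply: contra tlh => /andP[/ltW-> /ltW->].
have [|||| _] := @dominated_Rintegral _ _ _ mu O mO (fun j x => g x * pk (b j) x)
   (fun x => g x * \1_(obox lo hi) x) (fun x => `|g x|).
- move=> j; apply: measurable_funM => //.
  by apply: continuous_measurable => //; exact: pk_continuous.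
- move=> x Ox; apply: cvgM; first exact: cvg_cst.
  rewrite indicE; have [xB|xB] := pselect (obox lo hi x).
    rewrite mem_set//= (_ : 1%:R = \prod_(k < n) (1 : R)); last by rewrite big1.
    apply: (@cvg_big R 'I_n *%R 1 xpredT (@mul_continuous R) nat \oo
      (index_enum _) (fun k j => b j k (x ord0 k)) (fun k => 1)) => k _.
    rewrite -[X in _ --> X]subr0; apply: cvgB; first exact: cvg_cst.
    apply: cvg_expr; have /andP[h0 h1] := bump01 k (x ord0 k).
    by rewrite ger0_norm// gtrBl bump_gt0.
  rewrite memNset//=; apply: cvg_near_cst; near=> j.
  move/existsNP: xB => [k /negP xk]; apply/eqP; rewrite prodf_seq_eq0.
  apply/hasP; exists k; rewrite ?mem_index_enum//=.
  by rewrite /b bump_eq0// subr0 expr1n subrr.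
- exact: norm_gi.
- move=> j x Ox; rewrite normrM ler_piMr// ger0_norm; last first.
    by apply: prodr_ge0 => k _; case/andP: (b01 j k (x ord0 k)).
  by apply: prodr_ile1 => k _; exact: b01.
move=> H; apply/esym; apply: (@cvg_unique _ (@norm_hausdorff _ R) _ _ _ _ _ H).
by apply: cvg_near_cst; apply: nearW => j; exact: g0 (sb j) (bs j) lhO.
Unshelve. all: end_near. Qed.

(** Boxes form a pi-system, so the vanishing of the integral passes to all
    measurable subsets of a box. *)
Lemma integral_box_set_eq0 lo hi (A : set E) : cbox lo hi `<=` O -> measurable A ->
  \int[mu]_(x in O) (g x * \1_(A `&` obox lo hi) x) = 0.
Proof.
move=> lhO mA.
have mB := @measurable_obox R n lo hi.
have g1i (B : set E) : measurable B ->
    mu.-integrable O (EFin \o (fun x => g x * \1_B x)).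
  move=> mB'; apply: (@integrable_mul_bounded _ _ _ mu O mO g (\1_B) 1) => //.
  by move=> x _; rewrite indicE ger0_norm ?lern1 ?leq_b1.
pose H (A : set E) := measurable A /\
  \int[mu]_(x in O) (g x * \1_(A `&` obox lo hi) x) = 0.
suff : H A by case.
have lH : lambda_system setT H.
  split => //.
  - by split => //; rewrite setTI; exact: integral_box_eq0.
  - move=> A1 A2 A21 [m1 h1] [m2 h2]; split; first exact: measurableD.
    rewrite (_ : (fun x => _) = (fun x => g x * \1_(A1 `&` obox lo hi) x -
                                        g x * \1_(A2 `&` obox lo hi) x)).
      rewrite RintegralB ?h1 ?h2 ?subrr//; apply: g1i; exact: measurableI.
    apply/funext => x; rewrite -mulrBr; congr (_ * _); rewrite !indicE.
    have [x2|x2] := pselect (A2 x).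
      rewrite memNset; last by move=> [[]].
      have x1 := A21 _ x2; have [xB|xB] := pselect (obox lo hi x).
        by rewrite !mem_set ?subrr.
      by rewrite !memNset ?subrr// => -[].
    rewrite [x \in A2 `&` _]memNset ?subr0; last by move=> [].
    congr (nat_of_bool _)%:R; apply/idP/idP; rewrite !inE; first by move=> [[]].
    by move=> [].
  - move=> F ndF HF; split; first by apply: bigcupT_measurable => k; case: (HF k).
    have [|||| _] := @dominated_Rintegral _ _ _ mu O mO
       (fun j x => g x * \1_(F j `&` obox lo hi) x)
       (fun x => g x * \1_(\bigcup_j F j `&` obox lo hi) x) (fun x => `|g x|).
    + move=> j; apply: measurable_funM => //; apply: measurable_indic.
      by apply: measurableI => //; case: (HF j).
    + move=> x Ox; apply: cvgM; first exact: cvg_cst.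
      have [[j _ Fjx]|xF] := pselect ((\bigcup_j F j) x).
        apply: cvg_near_cst; exists j => // k /= jk; rewrite !indicE !in_setI.
        rewrite [x \in F k]mem_set ?[x \in \bigcup__ _]mem_set//; first by exists j.
        by have /subsetPset := ndF _ _ jk; apply.
      apply: cvg_near_cst; apply: nearW => k; rewrite !indicE !in_setI.
      rewrite [x \in F k]memNset ?[x \in \bigcup__ _]memNset//.
      by move=> Fkx; apply: xF; exists k.
    + exact: norm_gi.
    + move=> j x Ox; rewrite normrM ler_piMr// indicE ger0_norm//.
      by rewrite lern1 leq_b1.
    move=> L; apply/esym; apply: (@cvg_unique _ (@norm_hausdorff _ R) _ _ _ _ _ L).
    by apply: cvg_near_cst; apply: nearW => j; case: (HF j).
apply: (lambda_system_subset obox_setI_closed lH) => //.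
- move=> _ [l [h ->]]; split; first exact: measurable_obox.
  have [l' [h' lhE]] : exists l' h', obox l h `&` obox lo hi = obox l' h' /\
      cbox l' h' `<=` cbox lo hi.
    exists (fun i => Num.max (l i) (lo i)), (fun i => Num.min (h i) (hi i)); split.
      apply/seteqP; split => x /=.
        move=> [x1 x2] i; rewrite gt_max lt_min.
        by have /andP[p q] := x1 i; have /andP[r s] := x2 i; rewrite p q r s.
      move=> x12; split => i; have := x12 i; rewrite gt_max lt_min;
        by move=> /andP[/andP[p q] /andP[r s]]; rewrite ?p ?q ?r ?s.
    move=> x xB i; have := xB i; rewrite ge_max le_min.
    by move=> /andP[/andP[p q] /andP[r s]]; rewrite q s.
  by case: lhE => -> lhE; apply: integral_box_eq0; exact: subset_trans lhE lhO.
- by rewrite -measurable_oboxE.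
Qed.

Lemma fundamental_lemma : ae_eq mu O g (cst 0).
Proof.
have [D [lo [hi [DO OE]]]] := open_bigcup_obox oO.
have ae_box k : D k -> ae_eq mu (obox (lo k) (hi k)) g (cst 0).
  move=> Dk; have kO : obox (lo k) (hi k) `<=` O.
    exact: subset_trans (@obox_cbox _ _ _ _) (DO k Dk).
  have mk := @measurable_obox R n (lo k) (hi k).
  have : ae_eq mu (obox (lo k) (hi k)) (EFin \o g) (cst 0%E).
    apply: integral_ae_eq => //; first exact: integrableS gi.
    move=> A Ak mA; have AO : A `<=` O by exact: subset_trans kO.
    have Ai : mu.-integrable A (EFin \o g) by exact: integrableS gi.
    rewrite integral0 -(fineK (integrable_fin_num mA Ai)).
    congr EFin; rewrite -(integral_box_set_eq0 (DO k Dk) mA) (setIidl Ak).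
    rewrite -[LHS]/(Rintegral mu A g) Rintegral_mkcond [RHS]Rintegral_mkcond.
    congr Rintegral; apply/funext => x; rewrite !patchE indicE.
    case: ifPn => xA; last by case: ifP => //; rewrite mulr0.
    by rewrite mulr1 ifT// mem_set//; apply: AO; rewrite inE in xA.
  by apply: filterS => x /= + xk => /(_ xk)[].
have N : mu.-negligible (\bigcup_k
   (if k \in (D : set nat) then ~` [set x | obox (lo k) (hi k) x -> g x = 0] else set0)).
  apply: negligible_bigcup => k; case: ifPn => [|_]; last exact: negligible_set0.
  by rewrite inE => /ae_box.
apply: (negligibleS _ N) => x /= /not_implyP[+ gx]; rewrite OE => -[k Dk xk].
by exists k => //; rewrite mem_set//= => /(_ xk).
Qed.

End fundamental_lemma.

(** * Square-integrable functions *)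

Section quadratic.
Context {R : realType}.

Lemma discriminant_le (a b c : R) : 0 <= a ->
  (forall t, 0 <= a * t ^+ 2 + 2 * b * t + c) -> b ^+ 2 <= a * c.
Proof.
move=> a0 H; have [a_gt0|] := ltP 0 a; last first.
  move=> a_le0; have a00 : a = 0 by lra.
  have [->|b0] := eqVneq b 0; first by rewrite a00; nra.
  have := H (- (c + 1) / (2 * b)); rewrite a00 mul0r add0r.
  have -> : 2 * b * (- (c + 1) / (2 * b)) = - (c + 1) by field.
  lra.
have := H (- b / a); rewrite -(ler_pM2l a_gt0) mulr0.
have -> : a * (a * (- b / a) ^+ 2 + 2 * b * (- b / a) + c) = a * c - b ^+ 2.
  by field; rewrite gt_eqF.
lra.
Qed.

End quadratic.

Section square_integrable.
Context d (T : measurableType d) (R : realType)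
  (mu : {measure set T -> \bar R}) (D : set T) (mD : measurable D).
Implicit Types (f g : T -> R).

Definition sqint f : Prop :=
  measurable_fun D f /\ mu.-integrable D (fun x => (f x ^+ 2)%:E).

Lemma sqint_mul f g : sqint f -> sqint g ->
  mu.-integrable D (EFin \o (fun x => f x * g x)).
Proof.
move=> [mf fi] [mg gi].
have H := integrableD mD fi gi.
apply: (le_integrable mD _ _ H).
  by apply/measurable_EFinP; exact: measurable_funM.
move=> x Dx /=; rewrite lee_fin normrM [leRHS]ger0_norm ?addr_ge0 ?sqr_ge0//.
rewrite -(real_normK (num_real (f x))) -(real_normK (num_real (g x))).
have := sqr_ge0 (`|f x| - `|g x|).
have : 0 <= `|f x| * `|g x| by rewrite mulr_ge0.
by move: (`|f x|) (`|g x|) => p q; nra.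
Qed.

Lemma sqint_lin (c : R) f g : sqint f -> sqint g -> sqint (fun x => c * f x + g x).
Proof.
move=> sf sg; have [mf fi] := sf; have [mg gi] := sg.
split; first by apply: measurable_funD => //; apply: measurable_funM.
rewrite (_ : (fun x => _) = (fun x => (c ^+ 2)%:E * (f x ^+ 2)%:E +
   ((2 * c)%:E * (f x * g x)%:E + (g x ^+ 2)%:E))%E); last first.
  by apply/funext => x; rewrite -!EFinM -!EFinD; congr (_%:E); ring.
apply: integrableD => //; first exact: integrableZl.
by apply: integrableD => //; apply: integrableZl => //; exact: sqint_mul.
Qed.

Lemma sqint_bounded f (M : R) : (mu D < +oo)%E -> measurable_fun D f ->
  (forall x, D x -> `|f x| <= M) -> sqint f.
Proof.
move=> Doo mf fM; split => //.
apply: (@bounded_integrable _ _ _ mu D mD (fun x => f x ^+ 2) (M ^+ 2)) => //.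
  exact: measurable_funX.
by move=> x Dx; rewrite normrX lerXn2r ?nnegrE// ?fM//; apply: le_trans (fM x Dx).
Qed.

Lemma sqint_integrable f : (mu D < +oo)%E -> sqint f ->
  mu.-integrable D (EFin \o f).
Proof.
move=> Doo sf; rewrite (_ : EFin \o f = EFin \o (fun x => f x * cst 1 x)); last first.
  by apply/funext => x /=; rewrite mulr1.
apply: sqint_mul => //; apply: (@sqint_bounded _ 1) => // x _.
by rewrite normr1.
Qed.

Lemma cauchy_schwarz_Rintegral f g : sqint f -> sqint g ->
  (\int[mu]_(x in D) (f x * g x)) ^+ 2 <=
  \int[mu]_(x in D) (f x ^+ 2) * \int[mu]_(x in D) (g x ^+ 2).
Proof.
move=> sf sg; have fg := sqint_mul sf sg.
have [_ fi] := sf; have [_ gi] := sg.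
apply: discriminant_le => [|t].
  by apply: Rintegral_ge0 => x _; exact: sqr_ge0.
have -> : \int[mu]_(x in D) (f x ^+ 2) * t ^+ 2 +
    2 * \int[mu]_(x in D) (f x * g x) * t + \int[mu]_(x in D) (g x ^+ 2) =
    \int[mu]_(x in D) ((f x * t + g x) ^+ 2).
  transitivity (\int[mu]_(x in D) ((t ^+ 2 * f x ^+ 2 + (2 * t) * (f x * g x)) + g x ^+ 2)).
    rewrite RintegralD//; last first.
      rewrite (_ : _ \o _ = (fun x => (t ^+ 2)%:E * (f x ^+ 2)%:E +
        (2 * t)%:E * (f x * g x)%:E)%E); last by apply/funext.
      by apply: integrableD => //; exact: integrableZl.
    congr (_ + _); rewrite RintegralD//; last 2 first.
    - rewrite (_ : _ \o _ = (fun x => (t ^+ 2)%:E * (f x ^+ 2)%:E)%E).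
        exact: integrableZl.
      by apply/funext.
    - rewrite (_ : _ \o _ = (fun x => (2 * t)%:E * (f x * g x)%:E)%E).
        exact: integrableZl.
      by apply/funext.
    by rewrite !RintegralZl// mulrC; congr (_ + _); ring.
  by apply: eq_Rintegral => x _; ring.
by apply: Rintegral_ge0 => x _; exact: sqr_ge0.
Qed.

End square_integrable.

(** * Sobolev spaces *)

Section sobolev_calculus.
Context {R : realType} {n m : nat}.
Local Notation E := 'rV[R]_n.
Local Notation F := (E -> 'rV[R]_m).
Local Notation mu := (@lebesgue_rV R n).
Variable O : set E.
Hypothesis oO : open O.
Hypothesis Ofin : (mu O < +oo)%E.
Implicit Types (u v g : F) (s : seq 'I_n).

Let mO : measurable O. Proof. exact: measurable_open. Qed.

Local Notation co u k := (fun x => u x ord0 k).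

Lemma L2P u : L2 O u <-> forall k, sqint mu O (co u k).
Proof. by []. Qed.

Lemma L2_lin (c : R) u v : L2 O u -> L2 O v -> L2 O (c *: u + v).
Proof.
move=> /L2P Lu /L2P Lv; apply/L2P => k.
have := sqint_lin mO c (Lu k) (Lv k).
by rewrite (_ : (fun x => c * u x ord0 k + _) = co (c *: u + v) k)//; apply/funext => x; rewrite !mxE.
Qed.

Lemma subE u v : u - v = (-1) *: v + u.
Proof. by apply/funext => x; rewrite !fctE scaleN1r addrC. Qed.

Lemma L2B u v : L2 O u -> L2 O v -> L2 O (u - v).
Proof. by move=> Lu Lv; rewrite subE; exact: L2_lin. Qed.

Lemma integrable_inner u v : L2 O u -> L2 O v ->
  mu.-integrable O (EFin \o (fun x => \sum_k u x ord0 k * v x ord0 k)).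
Proof.
move=> /L2P Lu /L2P Lv.
rewrite (_ : _ \o _ = (fun x => \sum_k (u x ord0 k * v x ord0 k)%:E)%E).
  by apply: integrable_sum => // k _; exact: sqint_mul.
by apply/funext => x /=; rewrite sumEFin.
Qed.

Lemma L2_innerE u v : L2 O u -> L2 O v ->
  L2_inner O u v = \sum_k \int[mu]_(x in O) (u x ord0 k * v x ord0 k).
Proof.
move=> /L2P Lu /L2P Lv; apply: Rintegral_sum => // k; exact: sqint_mul.
Qed.

Lemma L2_inner_ge0 u : 0 <= L2_inner O u u.
Proof.
by apply: Rintegral_ge0 => x _; apply: sumr_ge0 => k _; rewrite -expr2 sqr_ge0.
Qed.

Lemma sqr_L2_norm u : L2_norm O u ^+ 2 = L2_inner O u u.
Proof. by rewrite sqr_sqrtr// L2_inner_ge0. Qed.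

Lemma L2_norm_ge0 u : 0 <= L2_norm O u.
Proof. exact: sqrtr_ge0. Qed.

Lemma L2_innerDl (c : R) u v g : L2 O u -> L2 O v -> L2 O g ->
  L2_inner O (c *: u + v) g = c * L2_inner O u g + L2_inner O v g.
Proof.
move=> Lu Lv Lg; rewrite !L2_innerE//; last exact: L2_lin.
rewrite mulr_sumr -big_split/=; apply: eq_bigr => k _.
have I1 := sqint_mul mO (Lu k) (Lg k); have I2 := sqint_mul mO (Lv k) (Lg k).
rewrite -RintegralZl// -RintegralD//; last first.
  rewrite (_ : _ \o _ = (fun x => c%:E * (u x ord0 k * g x ord0 k)%:E)%E).
    exact: integrableZl.
  by apply/funext.
by apply: eq_Rintegral => x _; rewrite !mxE mulrDl mulrA.
Qed.

Lemma L2_innerC u v : L2_inner O u v = L2_inner O v u.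
Proof.
by apply: eq_Rintegral => x _; apply: eq_bigr => k _; rewrite mulrC.
Qed.

Lemma L2_cauchy_schwarz u v : L2 O u -> L2 O v ->
  `|L2_inner O u v| <= L2_norm O u * L2_norm O v.
Proof.
move=> Lu Lv; rewrite -ler_sqr ?nnegrE ?mulr_ge0 ?L2_norm_ge0//.
rewrite -normrX ger0_norm ?sqr_ge0// exprMn !sqr_L2_norm.
apply: discriminant_le => [|t]; first exact: L2_inner_ge0.
have Luv := L2_lin t Lu Lv.
suff -> : L2_inner O u u * t ^+ 2 + 2 * L2_inner O u v * t + L2_inner O v v =
    L2_inner O (t *: u + v) (t *: u + v) by exact: L2_inner_ge0.
rewrite L2_innerDl// ![L2_inner O _ (t *: u + v)]L2_innerC !L2_innerDl//.
rewrite (L2_innerC v u); ring.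
Qed.

Lemma L2_norm_sub u v : L2 O u -> L2 O v ->
  L2_norm O (u - v) ^+ 2 <= 2 * (L2_norm O u ^+ 2 + L2_norm O v ^+ 2).
Proof.
move=> Lu Lv; rewrite !sqr_L2_norm.
have Luv := L2B Lu Lv.
have := L2_inner_ge0 (1 *: u + v); rewrite L2_innerDl//; last exact: L2_lin.
rewrite ![L2_inner O _ (1 *: u + v)]L2_innerC !L2_innerDl//.
rewrite {1}subE L2_innerDl// ![L2_inner O _ (u - v)]L2_innerC subE !L2_innerDl//.
rewrite (L2_innerC v u); lra.
Qed.

Lemma sqint_le_L2_norm u k : L2 O u ->
  \int[mu]_(x in O) (u x ord0 k ^+ 2) <= L2_norm O u ^+ 2.
Proof.
move=> Lu; rewrite sqr_L2_norm L2_innerE// (bigD1 k)//=.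
under [X in _ <= X + _]eq_Rintegral do rewrite -expr2.
rewrite lerDl; apply: sumr_ge0 => j _; apply: Rintegral_ge0 => x _.
by rewrite -expr2 sqr_ge0.
Qed.

Lemma ae_eqP u v : ae_eq_on O u v <->
  forall k, ae_eq mu O (co u k) (co v k).
Proof.
split=> [uv k|uv].
  by move: uv; apply: filterS => x /= + Ox => /(_ Ox) ->.
have : {ae mu, forall x, forall k, O x -> u x ord0 k = v x ord0 k}.
  by apply: filter_forall => k; exact: uv.
by apply: filterS => x H Ox; apply/rowP => k; exact: H.
Qed.

Lemma L2_inner_ae u v g : L2 O u -> L2 O v -> L2 O g -> ae_eq_on O u v ->
  L2_inner O u g = L2_inner O v g.
Proof.
move=> Lu Lv Lg uv; rewrite /L2_inner /Rintegral; congr fine.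
apply: ae_eq_integral => //.
- by have /integrableP[] := integrable_inner Lu Lg.
- by have /integrableP[] := integrable_inner Lv Lg.
- by move: uv; apply: filterS => x /= + Ox => /(_ Ox) ->.
Qed.

Lemma L2_norm_ae u v : L2 O u -> L2 O v -> ae_eq_on O u v ->
  L2_norm O u = L2_norm O v.
Proof.
move=> Lu Lv uv; rewrite /L2_norm /L2_inner /Rintegral; do 2 congr (_ _).
apply: ae_eq_integral => //.
- by have /integrableP[] := integrable_inner Lu Lu.
- by have /integrableP[] := integrable_inner Lv Lv.
- by move: uv; apply: filterS => x /= + Ox => /(_ Ox) ->.
Qed.

Lemma L2_norm_eq0 u : L2 O u -> L2_norm O u = 0 -> ae_eq_on O u 0.
Proof.
move=> Lu u0; apply/ae_eqP => k.
have [mk ik] := Lu k.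
have k0 : \int[mu]_(x in O) (u x ord0 k ^+ 2) = 0.
  apply/eqP; rewrite eq_le Rintegral_ge0 ?andbT; last by move=> x _; exact: sqr_ge0.
  by apply: le_trans (sqint_le_L2_norm k Lu) _; rewrite u0 expr0n.
have : ae_eq mu O (EFin \o (fun x => u x ord0 k ^+ 2)) (cst 0%E).
  apply/ae_eq_integral_abs => //; first by have /integrableP[] := ik.
  under eq_integral do rewrite /= ger0_norm ?sqr_ge0//.
  by rewrite -(fineK (integrable_fin_num mO ik)) -/(Rintegral mu O _) k0.
apply: filterS => x /= + Ox => /(_ Ox)[] /eqP.
by rewrite sqrf_eq0 mxE => /eqP.
Qed.

Lemma integrable_L2_test u k (phi : E -> R) : L2 O u -> test_function O phi ->
  mu.-integrable O (EFin \o (fun x => u x ord0 k * phi x)).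
Proof.
move=> Lu tp; have [M _ pM] := test_bounded tp.
apply: (@integrable_mul_bounded _ _ _ mu O mO (co u k) phi M).
- exact: sqint_integrable (Lu k).
- by apply: continuous_measurable => //; exact: test_continuous tp.
- by move=> x _.
Qed.

Lemma test_partials s (phi : E -> R) : test_function O phi ->
  test_function O (partials s phi).
Proof. by move=> tp; elim: s => //= i s; exact: test_partial. Qed.

Lemma is_weak_derivative_lin s (c : R) u v g h : L2 O u -> L2 O v -> L2 O g -> L2 O h ->
  is_weak_derivative O s u g -> is_weak_derivative O s v h ->
  is_weak_derivative O s (c *: u + v) (c *: g + h).
Proof.
move=> Lu Lv Lg Lh ug vh phi k tp.
have ts := test_partials s tp.
have E w1 w2 (psi : E -> R) : L2 O w1 -> L2 O w2 -> test_function O psi ->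
    \int[mu]_(x in O) ((c *: w1 + w2) x ord0 k * psi x) =
    c * \int[mu]_(x in O) (w1 x ord0 k * psi x) + \int[mu]_(x in O) (w2 x ord0 k * psi x).
  move=> L1 L2 tpsi.
  have I1 := integrable_L2_test k L1 tpsi; have I2 := integrable_L2_test k L2 tpsi.
  rewrite -RintegralZl// -RintegralD//; last first.
    rewrite (_ : _ \o _ = (fun x => c%:E * (w1 x ord0 k * psi x)%:E)%E).
      exact: integrableZl.
    by apply/funext.
  by apply: eq_Rintegral => x _; rewrite !mxE mulrDl mulrA.
by rewrite !E// ug// vh//; ring.
Qed.

Lemma weak_derivative_unique s u g h : L2 O g -> L2 O h ->
  is_weak_derivative O s u g -> is_weak_derivative O s u h -> ae_eq_on O g h.
Proof.
move=> Lg Lh ug uh; apply/ae_eqP => k.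
have gh := L2B Lg Lh.
have : ae_eq mu O (co (g - h) k) (cst 0).
  apply: fundamental_lemma => //; first exact: sqint_integrable (gh k).
  move=> b lo hi sb bs lhO; have tp := test_pk sb bs lhO.
  have Ig := integrable_L2_test k Lg tp; have Ih := integrable_L2_test k Lh tp.
  transitivity (\int[mu]_(x in O) (g x ord0 k * pk b x - h x ord0 k * pk b x)).
    by apply: eq_Rintegral => x _; rewrite !mxE mulrBl.
  rewrite RintegralB//; apply/eqP; rewrite subr_eq0; apply/eqP.
  have := ug _ k tp; rewrite uh// => /esym/mulfI; apply.
  by rewrite signr_eq0.
by apply: filterS => x /= + Ox => /(_ Ox); rewrite !mxE => /eqP; rewrite subr_eq0 => /eqP.
Qed.

Lemma weak_derivativeP p s u : Hk O p u -> (size s <= p)%N ->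
  L2 O (weak_derivative O s u) /\ is_weak_derivative O s u (weak_derivative O s u).
Proof.
move=> [_ Hu] /Hu[g gP]; rewrite /weak_derivative.
by have := xgetPex 0 (ex_intro [set g | L2 O g /\ is_weak_derivative O s u g] g gP).
Qed.

Lemma Hk_lin p (c : R) u v : Hk O p u -> Hk O p v -> Hk O p (c *: u + v).
Proof.
move=> [Lu Hu] [Lv Hv]; split; first exact: L2_lin.
move=> s sp; have [g [Lg ug]] := Hu s sp; have [h [Lh vh]] := Hv s sp.
exists (c *: g + h); split; first exact: L2_lin.
exact: is_weak_derivative_lin.
Qed.

Lemma HkB p u v : Hk O p u -> Hk O p v -> Hk O p (u - v).
Proof. by move=> Hu Hv; rewrite subE; exact: Hk_lin. Qed.

Lemma weak_derivativeB p s u v : Hk O p u -> Hk O p v -> (size s <= p)%N ->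
  ae_eq_on O (weak_derivative O s (u - v))
             (weak_derivative O s u - weak_derivative O s v).
Proof.
move=> Hu Hv sp.
have [Lu wu] := weak_derivativeP Hu sp; have [Lv wv] := weak_derivativeP Hv sp.
have [Luv wuv] := weak_derivativeP (HkB Hu Hv) sp.
apply: (@weak_derivative_unique s (u - v)) => //; first exact: L2B.
rewrite [u - v]subE [X in is_weak_derivative _ _ _ X]subE.
by apply: is_weak_derivative_lin => //; [case: Hv|case: Hu].
Qed.

Lemma sqr_Hk_norm p u : Hk_norm O p u ^+ 2 =
  \sum_(j < p.+1) \sum_(s : j.-tuple 'I_n | sorted leq [seq val i | i <- s])
      L2_norm O (weak_derivative O s u) ^+ 2.
Proof.
rewrite sqr_sqrtr//; apply: sumr_ge0 => j _; apply: sumr_ge0 => s _.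
exact: sqr_ge0.
Qed.

Lemma Hk_norm_ge0 p u : 0 <= Hk_norm O p u.
Proof. exact: sqrtr_ge0. Qed.

Lemma Hk_norm_sub p u v : Hk O p u -> Hk O p v ->
  Hk_norm O p (u - v) ^+ 2 <= 2 * (Hk_norm O p u ^+ 2 + Hk_norm O p v ^+ 2).
Proof.
move=> Hu Hv; move: (sqr_Hk_norm p (u - v)) (sqr_Hk_norm p u) (sqr_Hk_norm p v).
move: (Hk_norm _ _ _) (Hk_norm _ _ _) (Hk_norm _ _ _) => a b c -> -> ->.
rewrite -big_split/= mulr_sumr; apply: ler_sum => j _.
rewrite -big_split/= mulr_sumr; apply: ler_sum => s _.
have sp : (size s <= p)%N by rewrite size_tuple -ltnS.
have [Lu _] := weak_derivativeP Hu sp; have [Lv _] := weak_derivativeP Hv sp.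
have [Luv _] := weak_derivativeP (HkB Hu Hv) sp.
rewrite (L2_norm_ae Luv (L2B Lu Lv) (weak_derivativeB Hu Hv sp)).
exact: L2_norm_sub.
Qed.

Lemma weak_derivative_le_Hk_norm p s u : (size s <= p)%N ->
  sorted leq [seq val i | i <- s] ->
  L2_norm O (weak_derivative O s u) <= Hk_norm O p u.
Proof.
move=> sp ss; rewrite -ler_sqr ?nnegrE ?L2_norm_ge0 ?Hk_norm_ge0// sqr_Hk_norm.
have jp : (size s < p.+1)%N by [].
rewrite (bigD1 (Ordinal jp))//= (bigD1 (in_tuple s))//= -addrA lerDl.
apply: addr_ge0; apply: sumr_ge0 => j _; first exact: sqr_ge0.
by apply: sumr_ge0 => t _; exact: sqr_ge0.
Qed.

Lemma weak_derivative0 p u : Hk O p u -> ae_eq_on O (weak_derivative O [::] u) u.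
Proof.
move=> Hu; have [Lu wu] := @weak_derivativeP p [::] u Hu (leq0n _).
apply: (@weak_derivative_unique [::] u) => //; first by case: Hu.
by move=> phi k tp; rewrite expr0 mul1r.
Qed.

Lemma L2_norm_le_Hk_norm p u : Hk O p u -> L2_norm O u <= Hk_norm O p u.
Proof.
move=> Hu; have [Lu _] := @weak_derivativeP p [::] u Hu (leq0n _).
rewrite -(L2_norm_ae Lu _ (weak_derivative0 Hu)); last by case: Hu.
exact: weak_derivative_le_Hk_norm.
Qed.

End sobolev_calculus.

Section trace_zero.
Context {R : realType} {n m : nat}.
Local Notation E := 'rV[R]_n.
Local Notation F := (E -> 'rV[R]_m).
Local Notation mu := (@lebesgue_rV R n).
Variable O : set E.
Hypothesis oO : open O.
Hypothesis Ofin : (mu O < +oo)%E.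
Implicit Types (u v g phi : F) (s : seq 'I_n).

Let mO : measurable O. Proof. exact: measurable_open. Qed.

Definition test_field phi := forall k, test_function O (fun x => phi x ord0 k).

Definition partial_field (i : 'I_n) phi : F :=
  fun x => \row_k partial i (fun x => phi x ord0 k) x.

Lemma partial_fieldE i phi k : (fun x => partial_field i phi x ord0 k) =
  partial i (fun x => phi x ord0 k).
Proof. by apply/funext => x; rewrite mxE. Qed.

Lemma test_field_partial i phi : test_field phi -> test_field (partial_field i phi).
Proof. by move=> tp k; rewrite partial_fieldE; exact: test_partial. Qed.

Lemma L2_test_field phi : test_field phi -> L2 O phi.
Proof.
move=> tp k; have [M _ pM] := test_bounded (tp k).
apply: (sqint_bounded mO (M := M)) => //.
by apply: continuous_measurable => //; exact: test_continuous (tp k).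
Qed.

Lemma partial_field_weak i phi : test_field phi ->
  is_weak_derivative O [:: i] phi (partial_field i phi).
Proof.
move=> tp psi k ts; rewrite /= expr1 mulN1r (test_ibp i (tp k) ts mO).
congr (- _); apply: eq_Rintegral => x _; congr (_ * _).
by rewrite -partial_fieldE.
Qed.

Lemma Hk1_test_field phi : test_field phi -> Hk O 1 phi.
Proof.
move=> tp; split; first exact: L2_test_field.
case=> [|i [|//]] _.
  exists phi; split; first exact: L2_test_field.
  by move=> psi k ts; rewrite expr0 mul1r.
exists (partial_field i phi); split; last exact: partial_field_weak.
exact/L2_test_field/test_field_partial.
Qed.

Lemma smoothB (f h : E -> R) : smooth f -> smooth h -> smooth (f - h).
Proof.
move=> sf sh.
have pE s : partials s (f - h) = partials s f - partials s h.
  elim: s => // i s IH /=; rewrite IH; apply/funext => x.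
  by apply: deriveB; [case: (sf s)|case: (sh s)].
move=> s; rewrite pE; have [cf df] := sf s; have [ch dh] := sh s; split.
  by move=> x; apply: continuousB; [exact: cf|exact: ch].
by move=> i x; apply: derivableB; [exact: df|exact: dh].
Qed.

Lemma test_functionB (f h : E -> R) :
  test_function O f -> test_function O h -> test_function O (f - h).
Proof.
move=> [sf cf fO] [sh ch hO].
have sub : closure [set x | (f - h) x != 0] `<=`
    closure [set x | f x != 0] `|` closure [set x | h x != 0].
  rewrite -closureU; apply: closureS => x /= fhx.
  apply/orP; apply: contraNT fhx; rewrite negb_or !negbK => /andP[/eqP f0 /eqP h0].
  by rewrite -[(f - h) x]/(f x - h x) f0 h0 subrr.
split; [exact: smoothB| |by move=> x /sub[/fO|/hO]].
apply: subclosed_compact sub; [exact: closed_closure|exact: compactU].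
Qed.

Lemma H10B u v : H10 O u -> H10 O v -> H10 O (u - v).
Proof.
move=> [Hu au] [Hv av]; split; first exact: HkB.
move=> e e0; have e2 : 0 < e / 2 by rewrite divr_gt0.
have [phi [tp up]] := au _ e2; have [psi [ts vs]] := av _ e2.
have Hup := HkB oO Ofin Hu (Hk1_test_field tp).
have Hvp := HkB oO Ofin Hv (Hk1_test_field ts).
exists (phi - psi); split.
  move=> k; rewrite (_ : (fun x => _) =
     (fun x => phi x ord0 k) - (fun x => psi x ord0 k)).
    exact: test_functionB.
  by apply/funext => x; rewrite !mxE.
have -> : u - v - (phi - psi) = (u - phi) - (v - psi).
  by apply/funext => x; apply/rowP => k; rewrite !mxE; ring.
have := Hk_norm_sub oO Ofin Hup Hvp.
have := Hk_norm_ge0 O 1 (u - phi); have := Hk_norm_ge0 O 1 (v - psi).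
have := Hk_norm_ge0 O 1 ((u - phi) - (v - psi)).
move: up vs; move: (Hk_norm O 1 (_ - _ - _)) => a.
move: (Hk_norm O 1 (u - _)) (Hk_norm O 1 (v - _)) => b c be ce a0 c0 b0 H.
rewrite -ltr_sqr ?nnegrE ?(ltW e0)//; apply: le_lt_trans H _.
have : b ^+ 2 < (e / 2) ^+ 2 by rewrite ltr_sqr ?nnegrE ?(ltW e2).
have : c ^+ 2 < (e / 2) ^+ 2 by rewrite ltr_sqr ?nnegrE ?(ltW e2).
by rewrite exprMn exprVn; lra.
Qed.

Lemma domB (H : set F) u v : closed_subspace O H ->
  dom O H u -> dom O H v -> dom O H (u - v).
Proof.
move=> [_ _ Hlin _] [Hu u0 uH] [Hv v0 vH]; split; [exact: HkB|exact: H10B|].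
by rewrite subE; exact: Hlin.
Qed.

(** As [u] is a limit of test functions in [H^1], the definition of the weak
    second derivative gives [|d_i u|^2 = - (u, d_ii u)], without a boundary
    term. *)
Lemma interpolation u i : Hk O 2 u -> H10 O u ->
  L2_norm O (weak_derivative O [:: i] u) ^+ 2 <=
  L2_norm O u * L2_norm O (weak_derivative O [:: i; i] u).
Proof.
move=> Hu [H1u apx].
have Lu : L2 O u by case: Hu.
have [Lg wg] := weak_derivativeP (s := [:: i]) Hu isT.
have [Lgg wgg] := weak_derivativeP (s := [:: i; i]) Hu isT.
move: (weak_derivative O [:: i] u) (weak_derivative O [:: i; i] u) Lg wg Lgg wgg.
move=> g gg Lg wg Lgg wgg; apply/ler_addgt0Pr => e e0.
pose C := L2_norm O g + L2_norm O gg + 1.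
have C0 : 0 < C by rewrite ltr_wpDl// addr_ge0// L2_norm_ge0.
have [phi [tp up]] := apx _ (divr_gt0 e0 C0).
have Lp := L2_test_field tp; have Hp := Hk1_test_field tp.
have Hup := HkB oO Ofin H1u Hp; have Lup := L2B oO Lu Lp.
have Ldp := L2_test_field (test_field_partial i tp).
have [d [Ld wd dn]] : exists d, [/\ L2 O d, is_weak_derivative O [:: i] (u - phi) d &
    L2_norm O d <= e / C].
  have [Ld wd] := weak_derivativeP (s := [:: i]) Hup isT.
  exists (weak_derivative O [:: i] (u - phi)); split; [exact: Ld|exact: wd|].
  by apply: le_trans (ltW up); exact: weak_derivative_le_Hk_norm.
have dE : ae_eq_on O d (g - partial_field i phi).
  apply: (weak_derivative_unique oO Ofin Ld (L2B oO Lg Ldp) wd).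
  rewrite [u - phi]subE [g - _]subE; apply: is_weak_derivative_lin => //.
  exact: partial_field_weak.
have upn : L2_norm O (u - phi) <= e / C.
  by apply: le_trans (ltW up); exact: L2_norm_le_Hk_norm.
have gp : L2_inner O g (partial_field i phi) = - L2_inner O gg phi.
  rewrite !L2_innerE// -sumrN; apply: eq_bigr => k _.
  rewrite (_ : (fun x => gg x ord0 k * _) = (fun x => gg x ord0 k * (fun x => phi x ord0 k) x))//.
  have := wg _ k (test_partial i (tp k)); have := wgg _ k (tp k).
  rewrite /= expr1 sqrrN expr1n mul1r mulN1r => -> /eqP.
  rewrite -eqr_oppLR => /eqP ->.
  by apply: eq_Rintegral => x _; rewrite -partial_fieldE.
have gd : L2_inner O g g = L2_inner O d g - (L2_inner O gg u - L2_inner O gg (u - phi)).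
  have -> : L2_inner O gg u - L2_inner O gg (u - phi) = L2_inner O gg phi.
    rewrite ![L2_inner O gg _]L2_innerC {1}subE L2_innerDl//; ring.
  rewrite (L2_inner_ae oO Ld (L2B oO Lg Ldp) Lg dE).
  rewrite -[X in _ = _ + X]gp [L2_inner O g (partial_field _ _)]L2_innerC.
  rewrite {1}subE L2_innerDl//; ring.
rewrite sqr_L2_norm gd.
have h1 := le_trans (ler_norm _) (L2_cauchy_schwarz oO Ld Lg).
have h2 := le_trans (ler_norm _) (L2_cauchy_schwarz oO Lgg Lup).
have h3 := L2_cauchy_schwarz oO Lgg Lu.
have h3' : - L2_inner O gg u <= L2_norm O gg * L2_norm O u.
  by apply: le_trans h3; rewrite -normrN ler_norm.
have k1 := ler_wpM2r (L2_norm_ge0 O g) dn.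
have k2 := ler_wpM2l (L2_norm_ge0 O gg) upn.
have k3 : e / C * (L2_norm O g + L2_norm O gg) <= e.
  rewrite mulrAC ler_pdivrMr// ler_wpM2l// ?(ltW e0)// /C; lra.
lra.
Qed.

End trace_zero.

(** * Scaled kernels *)

Section product_rule.
Context {R : realType}.

Lemma is_derive_prod (I : eqType) (r : seq I) (f : I -> R -> R) (df : I -> R) (s : R) :
  uniq r -> (forall k, is_derive s 1 (f k) (df k)) ->
  is_derive s 1 (fun t => \prod_(k <- r) f k t)
    (\sum_(i <- r) df i * \prod_(k <- r | k != i) f k s).
Proof.
move=> + fd; elim: r => [_|x r IH /= /andP[xr ur]].
  rewrite big_nil (_ : (fun t => _) = cst 1); first exact: is_derive_cst.
  by apply/funext => t; rewrite big_nil.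
rewrite (_ : (fun t => _) = f x * (fun t => \prod_(k <- r) f k t)); last first.
  by apply/funext => t; rewrite big_cons.
have := is_deriveM (fd x) (IH ur); move/is_derive_eq; apply.
rewrite big_cons big_cons eqxx /GRing.scale/= addrC mulrC; congr (_ * _ + _).
  rewrite [LHS]big_seq_cond [RHS]big_seq_cond; apply: eq_bigl => k; rewrite andbT.
  by case: (boolP (k \in r)) => //= kr; apply/esym; apply: contraNneq xr => <-.
rewrite mulr_sumr [LHS]big_seq [RHS]big_seq; apply: eq_bigr => i ir.
rewrite big_cons ifT; first exact: mulrCA.
by apply: contraNneq xr => ->.
Qed.

End product_rule.

Section scaled_kernel.
Context {R : realType} {n : nat}.
Local Notation E := 'rV[R]_n.
Implicit Types (b : 'I_n -> R -> R) (lo hi : 'I_n -> R) (y z : E).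

(** [pk (scale b s y) z] is [s^-n pk b ((z - y) / s)]. *)
Definition scale b (s : R) y : 'I_n -> R -> R :=
  fun k t => s^-1 * b k (s^-1 * (t - y ord0 k)).

Definition shift_box lo (s : R) y : 'I_n -> R := fun k => y ord0 k + s * lo k.

Definition mulx (f : R -> R) : R -> R := fun t => t * f t.

Lemma mulx_smooth f : smooth1 f -> smooth1 (mulx f).
Proof. by move=> sf; exact: smooth1M smooth1_id sf. Qed.

Lemma mulx_supp f l h : supp1 f l h -> supp1 (mulx f) l h.
Proof. by move=> sf; exact: supp1Ml. Qed.

Lemma derive1_mulx f (t : R) : smooth1 f ->
  derive1 (mulx f) t = f t + t * derive1 f t.
Proof.
move=> sf; have := is_deriveM (is_derive_id t 1) (derivable1_is_derive (smooth1_derivable sf)).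
move=> [_ H]; rewrite derive1E; move: H; rewrite /GRing.scale/= mulr1 addrC => <-.
by rewrite -derive1E.
Qed.

Lemma scale_affine b s y k : scale b s y k =
  cst s^-1 * (fun t => b k (s^-1 * t + (- (s^-1 * y ord0 k)))).
Proof. by apply/funext => t; rewrite !fctE /scale mulrBr. Qed.

Lemma scale_smooth b s y : smooth_family b -> smooth_family (scale b s y).
Proof.
move=> sb k; rewrite scale_affine; apply: smooth1M; first exact: smooth1_cst.
exact: smooth1_affine.
Qed.

Lemma scale_supp b s y lo hi : 0 < s -> supp_family b lo hi ->
  supp_family (scale b s y) (shift_box lo s y) (shift_box hi s y).
Proof.
move=> s0 bs k t tlh; rewrite /scale bs ?mulr0//; apply: contra tlh.
rewrite /shift_box ler_pdivlMl// ler_pdivrMl// => /andP[h1 h2].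
by apply/andP; split; lra.
Qed.

Lemma scale_upd b s y i f : scale (upd b i f) s y =
  upd (scale b s y) i (fun t => s^-1 * f (s^-1 * (t - y ord0 i))).
Proof.
by apply/funext => k; apply/funext => t; rewrite /scale /upd; case: eqVneq => [->|].
Qed.

Lemma pk_scale b s y z :
  pk (scale b s y) z = s ^- n * \prod_k b k (s^-1 * (z ord0 k - y ord0 k)).
Proof.
by rewrite /pk /scale big_split/= prodr_const card_ord exprVn.
Qed.

Lemma pk_scale_bound b s y z M : 0 < s -> (forall x, `|pk b x| <= M) ->
  `|pk (scale b s y) z| <= s ^- n * M.
Proof.
move=> s0 bM; rewrite pk_scale normrM ger0_norm ?invr_ge0 ?exprn_ge0 ?(ltW s0)//.
rewrite ler_wpM2l ?invr_ge0 ?exprn_ge0 ?(ltW s0)//.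
have := bM (\row_k (s^-1 * (z ord0 k - y ord0 k))); rewrite /pk.
by under eq_bigr do rewrite mxE.
Qed.

Lemma partial_scale b s y i : smooth_family b ->
  partial i (pk (scale b s y)) =
  (fun z => s^-1 * pk (scale (upd b i (derive1 (b i))) s y) z).
Proof.
move=> sb; rewrite partial_pk; last exact: scale_smooth.
apply/funext => z; rewrite scale_upd !pk_upd mulrA; congr (_ * _).
have H : is_derive (z ord0 i) 1 (fun t => s^-1 * (t - y ord0 i)) s^-1.
  by apply: is_derive_eq; rewrite /GRing.scale/= subr0 mulr1.
have := @is_derive1_comp R (b i) (fun t => s^-1 * (t - y ord0 i)) (z ord0 i) _ _
  (derivable1_is_derive (smooth1_derivable (sb i))) H.
move=> D; have := is_deriveM (is_derive_cst s^-1 _ _) D.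
move=> [_ V]; rewrite derive1E; move: V; rewrite /GRing.scale/= mulr0 addr0 => V.
by apply: (etrans V); congr (_ * _); rewrite mulrC.
Qed.

(** Changing the scale transports mass along the field [(z - y) / s], so the
    derivative is minus the divergence of the kernel times this field. *)
Lemma is_derive_scale b (s : R) y z : 0 < s -> smooth_family b ->
  is_derive s 1 (fun r => pk (scale b r y) z)
    (- \sum_i s^-1 * pk (scale (upd b i (derive1 (mulx (b i)))) s y) z).
Proof.
move=> s0 sb.
have sn0 : s != 0 by rewrite gt_eqF.
have dV : is_derive s 1 (fun r : R => r^-1) (- s ^- 2).
  by apply: is_derive_eq (is_deriveV sn0 (is_derive_id _ _)) _; rewrite /GRing.scale/= mulr1.
pose w k := z ord0 k - y ord0 k.
have dk k : is_derive s 1 (fun r => scale b r y k (z ord0 k))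
    (- (s^-1 * (s^-1 * derive1 (mulx (b k)) (s^-1 * w k)))).
  have dw : is_derive s 1 (fun r => r^-1 * w k) (- s ^- 2 * w k).
    have := is_deriveM dV (is_derive_cst (w k) s 1).
    by move/is_derive_eq; apply; rewrite /GRing.scale/= mulr0 add0r mulrC.
  have D := @is_derive1_comp R (b k) (fun r => r^-1 * w k) s _ _
    (derivable1_is_derive (smooth1_derivable (sb k))) dw.
  have := is_deriveM dV D; move/is_derive_eq; apply.
  rewrite derive1_mulx// /GRing.scale/=; field.
  exact: sn0.
have := @is_derive_prod R 'I_n (index_enum 'I_n) (fun k r => scale b r y k (z ord0 k))
   _ s (index_enum_uniq _) dk.
move/is_derive_eq; apply; rewrite -sumrN; apply: eq_bigr => i _.
rewrite scale_upd pk_upd /w; ring.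
Qed.

End scaled_kernel.

(** * Averages against a scaled kernel *)

Section averages.
Context {R : realType} {n : nat}.
Local Notation E := 'rV[R]_n.
Local Notation mu := (@lebesgue_rV R n).
Variable O : set E.
Hypothesis oO : open O.
Implicit Types (b : 'I_n -> R -> R) (lo hi : 'I_n -> R) (y z : E) (u : E -> R).

Let mO : measurable O. Proof. exact: measurable_open. Qed.

Definition average u b (s : R) y : R :=
  \int[mu]_(z in O) (u z * pk (scale b s y) z).

(** Testing against product kernels is enough for all that follows. *)
Definition weak_gradient u (g : 'I_n -> E -> R) : Prop :=
  forall i b lo hi, smooth_family b -> supp_family b lo hi -> cbox lo hi `<=` O ->
  \int[mu]_(z in O) (u z * partial i (pk b) z) =
  - \int[mu]_(z in O) (g i z * pk b z).

(** The kernel multiplied by the [i]-th coordinate; these are the components of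
    the field of [is_derive_scale]. *)
Definition moment b i := upd b i (mulx (b i)).

Lemma moment_smooth b i : smooth_family b -> smooth_family (moment b i).
Proof. by move=> sb; apply: upd_smooth => //; exact: mulx_smooth. Qed.

Lemma moment_supp b i lo hi : supp_family b lo hi -> supp_family (moment b i) lo hi.
Proof. by move=> bs; apply: upd_supp => //; exact: mulx_supp. Qed.

Lemma pk_scale_continuous b s y : smooth_family b -> continuous (pk (scale b s y)).
Proof. by move=> sb; apply: pk_continuous; exact: scale_smooth. Qed.

Lemma average_integrable u b s y lo hi : 0 < s ->
  mu.-integrable O (EFin \o u) -> smooth_family b -> supp_family b lo hi ->
  mu.-integrable O (EFin \o (fun z => u z * pk (scale b s y) z)).
Proof.
move=> s0 ui sb bs; have [M M0 bM] := pk_bounded sb bs.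
apply: (@integrable_mul_bounded _ _ _ mu O mO u _ (s ^- n * M)) => //.
  by apply: continuous_measurable => //; exact: pk_scale_continuous.
by move=> z _; exact: pk_scale_bound.
Qed.

(** The scale derivative of the kernel is a divergence, which integration by
    parts throws on [u]: the result is again a sum of averages, now of the
    gradient, and can be differentiated once more in the same way. *)
Lemma is_derive_average u g b lo hi y (h s : R) :
  mu.-integrable O (EFin \o u) -> weak_gradient u g ->
  smooth_family b -> supp_family b lo hi ->
  (forall r, 0 < r < h -> cbox (shift_box lo r y) (shift_box hi r y) `<=` O) ->
  0 < s < h ->
  is_derive s 1 (fun r => average u b r y)
    (\sum_i average (g i) (moment b i) s y).
Proof.
move=> ui ug sb bs boxO /andP[s0 sh].
pose b' i := upd b i (derive1 (mulx (b i))).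
have sb' i : smooth_family (b' i).
  by apply: upd_smooth => //; apply: smooth1_derive; exact: mulx_smooth.
have bs' i : supp_family (b' i) lo hi.
  by apply: upd_supp => //; apply: supp1_derive; exact: mulx_supp.
have /choice[M HM] i : exists M, 0 < M /\ forall x, `|pk (b' i) x| <= M.
  by have [M M0 H] := pk_bounded (sb' i) (bs' i); exists M.
have s20 : 0 < s / 2 by rewrite divr_gt0.
pose f r z := u z * pk (scale b r y) z.
pose D r z := u z * - \sum_i r^-1 * pk (scale (b' i) r y) z.
have fD (r : R) z : 0 < r -> is_derive r 1 (f ^~ z) (D r z).
  move=> r0; have := is_deriveM (is_derive_cst (u z) r 1) (is_derive_scale y z r0 sb).
  by move/is_derive_eq; apply; rewrite /GRing.scale/= mulr0 addr0.
pose C := \sum_i (s / 2)^-1 * ((s / 2) ^- n * M i).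
have C0 : 0 <= C.
  apply: sumr_ge0 => i _; have [Mi _] := HM i.
  by rewrite !mulr_ge0 ?invr_ge0 ?exprn_ge0 ?(ltW Mi)// ltW.
have Is : `]s / 2, h[%classic s.
  by rewrite /= in_itv/= sh andbT; lra.
have Ipos r : `]s / 2, h[%classic r -> 0 < r.
  by rewrite /= in_itv/= => /andP[sr _]; exact: lt_trans sr.
have intf r : `]s / 2, h[%classic r -> mu.-integrable O (EFin \o f r).
  by move=> /Ipos r0; exact: average_integrable bs.
have derf (r : R) z : `]s / 2, h[%classic r -> O z -> derivable (f ^~ z) r 1.
  by move=> /Ipos r0 _; case: (fD r z r0).
have G0 z : 0 <= `|u z| * C by rewrite mulr_ge0.
have intG : mu.-integrable O (EFin \o (fun z => `|u z| * C)).
  rewrite (_ : _ \o _ = (fun z => C%:E * `|(EFin \o u) z|)%E).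
    by apply: integrableZl => //; exact: integrable_abse.
  by apply/funext => z /=; rewrite mulrC.
have Gub (r : R) z : `]s / 2, h[%classic r -> O z -> `|partial1of2 f r z| <= `|u z| * C.
  move=> Ir Oz; have r0 := Ipos r Ir; rewrite partial1of2E.
  have [_ ->] := fD r z r0; rewrite normrM ler_wpM2l// normrN.
  apply: le_trans (ler_norm_sum _ _ _) _; apply: ler_sum => i _.
  have rs : s / 2 <= r by move: Ir; rewrite /= in_itv/= => /andP[/ltW].
  have [Mi bM] := HM i.
  rewrite normrM ger0_norm ?invr_ge0 ?(ltW r0)//.
  apply: ler_pM; rewrite ?invr_ge0 ?(ltW r0)//; first by rewrite lef_pV2.
  apply: le_trans (pk_scale_bound y z r0 bM) _.
  rewrite ler_wpM2r ?(ltW Mi)// lef_pV2 ?posrE ?exprn_gt0//.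
  by rewrite lerXn2r ?nnegrE ?(ltW r0) ?(ltW s20).
have d1 := derivable_under_integral mO Is intf derf G0 intG Gub.
have d2 := differentiation_under_integral mO Is intf derf G0 intG Gub.
split; first exact: d1.
rewrite -derive1E; apply: (etrans d2).
have -> : \int[mu]_(z in O) partial1of2 f s z = \int[mu]_(z in O) D s z.
  by apply: eq_Rintegral => z _; rewrite partial1of2E; case: (fD s z s0).
have ii i : mu.-integrable O (EFin \o (fun z => u z * pk (scale (b' i) s y) z)).
  exact: average_integrable (bs' i).
transitivity (\int[mu]_(z in O) (\sum_i (- s^-1) * (u z * pk (scale (b' i) s y) z))).
  apply: eq_Rintegral => z _; rewrite /D -sumrN mulr_sumr; apply: eq_bigr => i _.
  by rewrite mulrN mulNr mulrCA.
rewrite Rintegral_sum//; last first.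
  move=> i; rewrite (_ : _ \o _ = (fun z => (- s^-1)%:E * (u z * pk (scale (b' i) s y) z)%:E)%E).
    by apply: integrableZl => //; exact: ii.
  by apply/funext.
apply: eq_bigr => i _; rewrite RintegralZl//.
have := ug i (scale (moment b i) s y) (shift_box lo s y) (shift_box hi s y)
   (scale_smooth _ _ (moment_smooth i sb)) (scale_supp s0 (moment_supp i bs))
   (boxO s _).
rewrite s0 sh => /(_ isT); rewrite partial_scale; last exact: moment_smooth.
have -> : upd (moment b i) i (derive1 (moment b i i)) = b' i.
  by apply/funext => k; rewrite /b' /moment /upd eqxx; case: eqVneq.
move=> /eqP; rewrite -eqr_oppLR => /eqP; rewrite /average => <-.
rewrite mulNr -RintegralZl//; congr (- _); apply: eq_Rintegral => z _.
by rewrite mulrCA.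
Qed.

End averages.

Section scale_regularity.
Context {R : realType}.

(** A second derivative of size [s^(-3/2)] leaves the function Lipschitz in
    [x = sqrt s]: integrating once, the first derivative has size [s^(-1/2)],
    and the derivative of [f (x ^+ 2)] gains the factor [2 * x]. *)
Lemma lipschitz_sqrt (f f1 f2 : R -> R) (h x0 K K1 : R) :
  0 < x0 -> x0 ^+ 2 < h -> x0 <= 1 -> 0 <= K ->
  (forall s, 0 < s < h -> is_derive s 1 f (f1 s)) ->
  (forall s, 0 < s < h -> is_derive s 1 f1 (f2 s)) ->
  (forall x, 0 < x <= x0 -> `|f2 (x ^+ 2)| <= K * x ^- 3) ->
  `|f1 (x0 ^+ 2)| <= K1 ->
  forall x t, 0 < x <= x0 -> 0 < t <= x0 ->
  `|f (x ^+ 2) - f (t ^+ 2)| <= (2 * K1 + 4 * K) * `|x - t|.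
Proof.
move=> x00 x0h x01 K0 df df1 f2K f1K.
have sq x : 0 < x <= x0 -> 0 < x ^+ 2 < h.
  move=> /andP[px xx]; rewrite exprn_gt0//=; apply: le_lt_trans x0h.
  by rewrite lerXn2r ?nnegrE// ltW.
have dsq (x : R) : is_derive x 1 (fun t : R => t ^+ 2) (2 * x).
  have := is_deriveX 2 (is_derive_id x 1).
  by move/is_derive_eq; apply; rewrite /GRing.scale/= mulr1 expr1.
have dcomp (k k1 : R -> R) : (forall s, 0 < s < h -> is_derive s 1 k (k1 s)) ->
    forall x, 0 < x <= x0 -> is_derive x 1 (fun t => k (t ^+ 2)) (2 * x * k1 (x ^+ 2)).
  move=> dk x xx; have := @is_derive1_comp R k (fun t => t ^+ 2) x _ _ (dk _ (sq x xx)) (dsq x).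
  by move/is_derive_eq; apply; rewrite mulrC.
have dinv (x : R) : 0 < x -> is_derive x 1 (fun t : R => 2 * K * t^-1) (- (2 * K * x ^- 2)).
  move=> px; have xn0 : x != 0 by rewrite gt_eqF.
  have := is_deriveM (is_derive_cst (2 * K) x 1) (is_deriveV xn0 (is_derive_id x 1)).
  by move/is_derive_eq; apply; rewrite /GRing.scale/= mulr0 addr0 mulr1 mulrN.
have half (k k1 : R -> R) : (forall s, 0 < s < h -> is_derive s 1 k (k1 s)) ->
    (forall x, 0 < x <= x0 -> `|k1 (x ^+ 2)| <= K * x ^- 3) ->
    forall x, 0 < x <= x0 -> k (x0 ^+ 2) <= k (x ^+ 2) + 2 * K * x^-1.
  move=> dk kK x /andP[px]; rewrite le_eqVlt => /orP[/eqP ->|xx0].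
    by rewrite lerDl mulr_ge0 ?invr_ge0 ?mulr_ge0 ?(ltW x00).
  pose A t := k (t ^+ 2) + 2 * K * t^-1.
  have dA t : 0 < t <= x0 -> is_derive t 1 A (2 * t * k1 (t ^+ 2) - 2 * K * t ^- 2).
    by move=> tt; apply: is_deriveD; [exact: dcomp|apply: dinv; case/andP: tt].
  have inI t : t \in `[x, x0] -> 0 < t <= x0.
    by rewrite in_itv/= => /andP[xt ->]; rewrite andbT (lt_le_trans px).
  have cA : {within `[x, x0], continuous A}.
    by apply: derivable_within_continuous => t /inI tt; case: (dA t tt).
  have [c cx Ac] := @MVT _ A _ _ _ xx0 (fun t tt => dA t (inI t (subset_itv_oo_cc tt))) cA.
  have cc := inI c (subset_itv_oo_cc cx).
  have pc : 0 < c by case/andP: cc.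
  have c0 : c != 0 by rewrite gt_eqF.
  have : A x0 <= A x.
    rewrite -subr_le0 Ac; apply: mulr_le0_ge0; last by rewrite subr_ge0 ltW.
    rewrite subr_le0 -mulrA -[X in _ <= X]mulrA ler_pM2l//.
    apply: (@le_trans _ _ (c * (K * c ^- 3))).
      by rewrite ler_pM2l//; apply: le_trans (ler_norm _) (kK c cc).
    have -> : c * (K * c ^- 3) = K * c ^- 2 by field.
    by [].
  rewrite /A; have : 0 <= 2 * K * x0^-1 by rewrite !mulr_ge0 ?invr_ge0 ?(ltW x00).
  lra.
have f1b x : 0 < x <= x0 -> `|f1 (x ^+ 2)| <= K1 + 2 * K * x^-1.
  move=> xx; have h1 := half f1 f2 df1 f2K x xx.
  have h2 : - f1 (x0 ^+ 2) <= - f1 (x ^+ 2) + 2 * K * x^-1.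
    apply: (half (- f1) (- f2)) => // [s ss|t tt].
      by apply: is_deriveN; exact: df1.
    by rewrite normrN; exact: f2K.
  move: f1K; rewrite !ler_norml => /andP[? ?]; apply/andP; split; lra.
have K10 : 0 <= K1 by apply: le_trans f1K.
move=> x t; wlog xt : x t / x < t.
  move=> H xx tt; have [|tx|->] := ltgtP x t; first by move=> ?; exact: H.
  - by rewrite (distrC x t) (distrC (f _)); exact: H.
  - by rewrite !subrr normr0 mulr0.
move=> xx tt; have px : 0 < x by case/andP: xx.
have inI r : r \in `[x, t] -> 0 < r <= x0.
  rewrite in_itv/= => /andP[xr rt]; rewrite (lt_le_trans px xr)/=.
  by apply: le_trans rt _; case/andP: tt.
have cf : {within `[x, t], continuous (fun r => f (r ^+ 2))}.
  by apply: derivable_within_continuous => r /inI rr; case: (dcomp _ _ df r rr).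
have [c cx] := @MVT _ (fun r => f (r ^+ 2)) _ _ _ xt
  (fun r rr => dcomp _ _ df r (inI r (subset_itv_oo_cc rr))) cf.
rewrite (distrC x t) (distrC (f _)) => ->.
have cc := inI c (subset_itv_oo_cc cx); have /andP[pc cx0] := cc.
rewrite normrM ler_wpM2r// normrM ger0_norm ?mulr_ge0 ?(ltW pc)//.
apply: (@le_trans _ _ (2 * c * (K1 + 2 * K * c^-1))).
  by rewrite ler_wpM2l ?mulr_ge0 ?(ltW pc)//; exact: f1b.
have -> : 2 * c * (K1 + 2 * K * c^-1) = 2 * (c * K1) + 4 * K.
  by field; rewrite gt_eqF.
rewrite lerD2r ler_pM2l// ler_piMl//; exact: le_trans x01.
Qed.

End scale_regularity.

Section average_bounds.
Context {R : realType} {n : nat}.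
Local Notation E := 'rV[R]_n.
Local Notation mu := (@lebesgue_rV R n).
Variable O : set E.
Hypothesis oO : open O.
Hypothesis Ofin : (mu O < +oo)%E.
Hypothesis n3 : (n <= 3)%N.
Implicit Types (b : 'I_n -> R -> R) (lo hi : 'I_n -> R) (y z : E) (u : E -> R).

Let mO : measurable O. Proof. exact: measurable_open. Qed.

Lemma lebesgue_shift_box lo hi (s : R) y : 0 < s ->
  mu (cbox (shift_box lo s y) (shift_box hi s y)) =
  (s ^+ n * \prod_i Num.max 0 (hi i - lo i))%:E.
Proof.
move=> s0; rewrite lebesgue_cbox; congr (_%:E).
rewrite -[in s ^+ n](card_ord n) -prodr_const -big_split/=.
apply: eq_bigr => i _; rewrite maxr_pMr ?(ltW s0)// mulr0 /shift_box.
by congr (Num.max _ _); ring.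
Qed.

(** The kernel has size [s^-n] on a set of measure [s^n], so by the
    Cauchy-Schwarz inequality the average is at most [s^(-n/2)] times the [L^2]
    norm. With [s = x ^+ 2 <= 1] and [n <= 3] this is at most [x ^- 3]: here the
    dimension enters. *)
Lemma average_bound b lo hi : smooth_family b -> supp_family b lo hi ->
  exists2 C, 0 < C & forall u N y (x : R), 0 <= N -> 0 < x <= 1 ->
    cbox (shift_box lo (x ^+ 2) y) (shift_box hi (x ^+ 2) y) `<=` O ->
    sqint mu O u -> \int[mu]_(z in O) (u z ^+ 2) <= N ^+ 2 ->
    `|average O u b (x ^+ 2) y| <= C * N * x ^- 3.
Proof.
move=> sb bs; have [M M0 bM] := pk_bounded sb bs.
pose V := \prod_i Num.max 0 (hi i - lo i).
have V0 : 0 <= V by apply: prodr_ge0 => i _; rewrite le_max lexx.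
exists (M * (V + 1)); first by rewrite mulr_gt0// ltr_wpDl.
move=> u N y x N0 /andP[x0 x1] boxO su uN.
have s0 : 0 < x ^+ 2 by rewrite exprn_gt0.
set s := x ^+ 2 in s0 boxO *.
have ck := @pk_scale_continuous R n b s y sb.
have mk : measurable_fun O (pk (scale b s y)) by exact: continuous_measurable.
have kB z : `|pk (scale b s y) z| <= s ^- n * M by exact: pk_scale_bound.
have B0 : 0 <= s ^- n * M.
  by apply: mulr_ge0; [rewrite invr_ge0 exprn_ge0// ltW|exact: ltW].
have sk : sqint mu O (pk (scale b s y)).
  by apply: (sqint_bounded mO (M := s ^- n * M)).
have mc := measurable_cbox (shift_box lo s y) (shift_box hi s y).
have finb : (mu (cbox (shift_box lo s y) (shift_box hi s y)) < +oo)%E.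
  by rewrite lebesgue_shift_box// ltry.
have kint : \int[mu]_(z in O) (pk (scale b s y) z ^+ 2) <= s ^- n * (M ^+ 2 * V).
  rewrite -(@Rintegral_subset_support _ _ _ mu O _ (cbox (shift_box lo s y) (shift_box hi s y)))//; last first.
    by move=> z _ zb; rewrite (pk_eq0 (scale_supp s0 bs) zb) expr0n.
  apply: (@le_trans _ _ (\int[mu]_(z in cbox (shift_box lo s y) (shift_box hi s y)) ((s ^- n * M) ^+ 2))).
    apply: le_Rintegral => //.
    - by case: sk => _; exact: integrableS.
    - apply: (@bounded_integrable _ _ _ mu _ mc _ ((s ^- n * M) ^+ 2)) => //.
      by move=> z _; rewrite ger0_norm ?sqr_ge0.
    - by move=> z _; rewrite -real_normK ?num_real// lerXn2r ?nnegrE.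
  rewrite Rintegral_cst// [X in _ * fine X](lebesgue_shift_box lo hi y s0)/= -/V.
  have sn : s ^+ n != 0 by rewrite expf_neq0// gt_eqF.
  by rewrite le_eqVlt; apply/orP; left; apply/eqP; field.
have := cauchy_schwarz_Rintegral mO su sk.
rewrite -/(average O u b s y) => cs.
have bnd : average O u b s y ^+ 2 <= (M * (V + 1) * N * x ^- 3) ^+ 2.
  apply: le_trans cs _.
  apply: (@le_trans _ _ (N ^+ 2 * (s ^- n * (M ^+ 2 * V)))).
    by apply: ler_pM => //; apply: Rintegral_ge0 => z _; exact: sqr_ge0.
  have -> : (M * (V + 1) * N * x ^- 3) ^+ 2 = N ^+ 2 * (s ^- 3 * (M ^+ 2 * (V + 1) ^+ 2)).
    by rewrite /s; field; rewrite gt_eqF.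
  rewrite ler_wpM2l ?sqr_ge0//; apply: ler_pM => //.
  - by rewrite invr_ge0 exprn_ge0// ltW.
  - by rewrite mulr_ge0// sqr_ge0.
  - rewrite lef_pV2 ?posrE ?exprn_gt0//; apply: ler_wiXn2l => //; first exact: ltW.
    by rewrite /s exprn_ile1// ltW.
  - by rewrite ler_wpM2l ?sqr_ge0//; nra.
rewrite -ler_sqr ?nnegrE//; last first.
  by rewrite !mulr_ge0 ?invr_ge0 ?exprn_ge0 ?(ltW M0) ?(ltW x0)// addr_ge0.
by rewrite real_normK ?num_real.
Qed.

End average_bounds.

Section average_regularity.
Context {R : realType} {n : nat}.
Local Notation E := 'rV[R]_n.
Local Notation mu := (@lebesgue_rV R n).
Variable O : set E.
Hypothesis oO : open O.
Hypothesis Ofin : (mu O < +oo)%E.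
Hypothesis n3 : (n <= 3)%N.
Implicit Types (b : 'I_n -> R -> R) (lo hi : 'I_n -> R) (y z : E) (u : E -> R).

Let mO : measurable O. Proof. exact: measurable_open. Qed.

(** A scalar component of an [H^2] field, with its weak derivatives as explicit
    data, so that the averages need not know about fields. *)
Record H2_data u (g : 'I_n -> E -> R) (gg : 'I_n -> 'I_n -> E -> R) (N : R) : Prop := {
  H2_ge0 : 0 <= N;
  H2_fun : sqint mu O u /\ \int[mu]_(z in O) (u z ^+ 2) <= N ^+ 2;
  H2_grad : forall i, sqint mu O (g i) /\ \int[mu]_(z in O) (g i z ^+ 2) <= N ^+ 2;
  H2_hess : forall i j, sqint mu O (gg i j) /\ \int[mu]_(z in O) (gg i j z ^+ 2) <= N ^+ 2;
  H2_fun_grad : weak_gradient O u g;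
  H2_grad_hess : forall i, weak_gradient O (g i) (gg i) }.

(** The second derivative in the scale is a sum of averages of the second weak
    derivatives, which [average_bound] controls. *)
Lemma average_lipschitz b lo hi (x0 h : R) : smooth_family b -> supp_family b lo hi ->
  0 < x0 <= 1 -> x0 ^+ 2 < h ->
  exists2 C, 0 < C & forall u g gg N y, H2_data u g gg N ->
    (forall r, 0 < r < h -> cbox (shift_box lo r y) (shift_box hi r y) `<=` O) ->
    forall x t, 0 < x <= x0 -> 0 < t <= x0 ->
    `|average O u b (x ^+ 2) y - average O u b (t ^+ 2) y| <= C * N * `|x - t|.
Proof.
move=> sb bs /andP[x00 x01] x0h.
have /choice[C1 HC1] i : exists C1, 0 < C1 /\
    forall u N y (x : R), 0 <= N -> 0 < x <= 1 ->
    cbox (shift_box lo (x ^+ 2) y) (shift_box hi (x ^+ 2) y) `<=` O ->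
    sqint mu O u -> \int[mu]_(z in O) (u z ^+ 2) <= N ^+ 2 ->
    `|average O u (moment b i) (x ^+ 2) y| <= C1 * N * x ^- 3.
  have [C C0 HC] := average_bound oO Ofin n3 (moment_smooth i sb) (moment_supp i bs).
  by exists C.
have /choice[C2 HC2] (ij : 'I_n * 'I_n) : exists C2, 0 < C2 /\
    forall u N y (x : R), 0 <= N -> 0 < x <= 1 ->
    cbox (shift_box lo (x ^+ 2) y) (shift_box hi (x ^+ 2) y) `<=` O ->
    sqint mu O u -> \int[mu]_(z in O) (u z ^+ 2) <= N ^+ 2 ->
    `|average O u (moment (moment b ij.1) ij.2) (x ^+ 2) y| <= C2 * N * x ^- 3.
  case: ij => i j.
  have [C C0 HC] := average_bound oO Ofin n3 (moment_smooth j (moment_smooth i sb))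
    (moment_supp j (moment_supp i bs)).
  by exists C.
pose K := \sum_i \sum_j C2 (i, j).
pose K1 := \sum_i C1 i * x0 ^- 3.
have K0 : 0 <= K.
  by apply: sumr_ge0 => i _; apply: sumr_ge0 => j _; apply: ltW; case: (HC2 (i, j)).
have K10 : 0 <= K1.
  apply: sumr_ge0 => i _; rewrite mulr_ge0 ?invr_ge0 ?exprn_ge0 ?(ltW x00)//.
  by apply: ltW; case: (HC1 i).
exists (2 * K1 + 4 * K + 1); first by rewrite ltr_wpDl// addr_ge0// mulr_ge0.
move=> u g gg N y [N0 [su uN] gN ggN ug ggg] boxO x t xx tt.
have x0x0 : 0 < x0 <= x0 by rewrite x00 lexx.
have sq r : 0 < r <= x0 -> 0 < r ^+ 2 < h.
  move=> /andP[pr rr]; rewrite exprn_gt0//=; apply: le_lt_trans x0h.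
  by rewrite lerXn2r ?nnegrE// ltW.
have r1 r : 0 < r <= x0 -> 0 < r <= 1.
  by move=> /andP[-> rr]; exact: le_trans rr x01.
have I v : sqint mu O v -> mu.-integrable O (EFin \o v).
  exact: sqint_integrable.
have d1 (s : R) : 0 < s < h -> is_derive s 1 (fun r => average O u b r y)
    (\sum_i average O (g i) (moment b i) s y).
  by move=> ss; apply: (is_derive_average oO (I _ su) ug sb bs boxO ss).
have d2 (s : R) : 0 < s < h ->
    is_derive s 1 (fun r => \sum_i average O (g i) (moment b i) r y)
    (\sum_i \sum_j average O (gg i j) (moment (moment b i) j) s y).
  move=> ss.
  rewrite (_ : (fun r => _) = \sum_i (fun r => average O (g i) (moment b i) r y)); last first.
    by apply/funext => r; rewrite fct_sumE.
  apply: is_derive_sum => i.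
  apply: (is_derive_average oO _ (ggg i) (moment_smooth i sb) (moment_supp i bs) boxO ss).
  by apply: I; case: (gN i).
have f2b r : 0 < r <= x0 ->
    `|\sum_i \sum_j average O (gg i j) (moment (moment b i) j) (r ^+ 2) y| <= (K * N) * r ^- 3.
  move=> rr; rewrite /K !mulr_suml.
  apply: le_trans (ler_norm_sum _ _ _) _; apply: ler_sum => i _.
  rewrite !mulr_suml.
  apply: le_trans (ler_norm_sum _ _ _) _; apply: ler_sum => j _.
  have [_] := HC2 (i, j); apply => //; [exact: r1|exact/boxO/sq| |]; by case: (ggN i j).
have f1b : `|\sum_i average O (g i) (moment b i) (x0 ^+ 2) y| <= K1 * N.
  rewrite /K1 !mulr_suml.
  apply: le_trans (ler_norm_sum _ _ _) _; apply: ler_sum => i _.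
  rewrite mulrAC; have [_] := HC1 i; apply => //; [exact: r1|exact/boxO/sq| |]; by case: (gN i).
apply: le_trans (lipschitz_sqrt x00 x0h x01 (mulr_ge0 K0 N0) d1 d2 f2b f1b xx tt) _.
rewrite ler_wpM2r//; lra.
Qed.

Lemma prod_dist (I : Type) (r : seq I) (a a' : I -> R) (A D : R) : 1 <= A -> 0 <= D ->
  (forall k, `|a k| <= A) -> (forall k, `|a' k| <= A) -> (forall k, `|a k - a' k| <= D) ->
  `|\prod_(k <- r) a k - \prod_(k <- r) a' k| <= (size r)%:R * A ^+ size r * D.
Proof.
move=> A1 D0 aA a'A aD; have A0 : 0 <= A by exact: le_trans A1.
have PA s : `|\prod_(k <- s) a k| <= A ^+ size s.
  elim: s => [|x s IH]; first by rewrite big_nil normr1.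
  by rewrite big_cons normrM exprS; apply: ler_pM.
elim: r => [|x r IH]; first by rewrite !big_nil subrr normr0 !mul0r.
rewrite !big_cons /=.
set P := \prod_(k <- r) a k in IH *; set P' := \prod_(k <- r) a' k in IH *.
have -> : a x * P - a' x * P' = (a x - a' x) * P + a' x * (P - P') by ring.
apply: le_trans (ler_normD _ _) _; rewrite !normrM.
have AS : A ^+ size r <= A ^+ (size r).+1 by rewrite exprS ler_peMl// exprn_ge0.
have h1 : `|a x - a' x| * `|P| <= D * A ^+ (size r).+1.
  by apply: ler_pM => //; apply: le_trans AS; exact: PA.
have h2 : `|a' x| * `|P - P'| <= A * ((size r)%:R * A ^+ size r * D) by exact: ler_pM.
apply: le_trans (lerD h1 h2) _.
by rewrite -[(size r).+1%:R]natr1 exprS le_eqVlt; apply/orP; left; apply/eqP; ring.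
Qed.

Lemma pk_lipschitz b lo hi : smooth_family b -> supp_family b lo hi ->
  exists2 L, 0 < L & forall (x y : E) d, 0 <= d ->
    (forall k, `|x ord0 k - y ord0 k| <= d) -> `|pk b x - pk b y| <= L * d.
Proof.
move=> sb bs.
have /choice[M HM] k : exists M, 0 < M /\ forall t, `|b k t| <= M.
  have [M M0 bM] := smooth1_bounded (sb k) (bs k).
  by exists M.
have /choice[L HL] k : exists L, 0 < L /\
    forall t t', `|b k t - b k t'| <= L * `|t - t'|.
  have [L L0 bL] := smooth1_lipschitz (sb k) (bs k).
  by exists L.
pose A := 1 + \sum_k M k.
pose B := \sum_k L k.
have A1 : 1 <= A by rewrite lerDl; apply: sumr_ge0 => k _; rewrite ltW//; case: (HM k).
have B0 : 0 <= B by apply: sumr_ge0 => k _; rewrite ltW//; case: (HL k).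
pose e := size (index_enum 'I_n).
have Q0 : 0 <= e%:R * A ^+ e * B by rewrite !mulr_ge0// exprn_ge0// (le_trans _ A1).
exists (e%:R * A ^+ e * B + 1); first by rewrite ltr_wpDl.
move=> x y d d0 xy.
have bA k t : `|b k t| <= A.
  have [Mk bM] := HM k; apply: le_trans (bM t) _.
  rewrite /A (bigD1 k)//= addrCA lerDl addr_ge0//.
  by apply: sumr_ge0 => j _; rewrite ltW//; case: (HM j).
have := @prod_dist _ (index_enum 'I_n) (fun k => b k (x ord0 k))
  (fun k => b k (y ord0 k)) A (B * d) A1 (mulr_ge0 B0 d0).
rewrite -/e mulrA => H; apply: (@le_trans _ _ (e%:R * A ^+ e * B * d)); last first.
  by rewrite ler_wpM2r// lerDl.
apply: H => k; [exact: bA|exact: bA|].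
have [Lk bL] := HL k; apply: le_trans (bL _ _) _.
apply: ler_pM => //; first exact: ltW.
rewrite /B (bigD1 k)//= lerDl; apply: sumr_ge0 => j _.
by rewrite ltW//; case: (HL j).
Qed.

Lemma pk_scale_shift b s y z : pk (scale b s y) z = pk (scale b s 0) (z - y).
Proof. by rewrite !pk_scale; congr (_ * _); apply: eq_bigr => k _; rewrite !mxE subr0. Qed.

(** At a fixed scale the smoothness of the kernel alone makes the average
    depend regularly on its center. *)
Lemma average_lipschitz_center b lo hi (s : R) : smooth_family b -> supp_family b lo hi ->
  0 < s -> exists2 L, 0 < L & forall u N y y' d, 0 <= N -> 0 <= d ->
    sqint mu O u -> \int[mu]_(z in O) (u z ^+ 2) <= N ^+ 2 ->
    (forall k, `|y ord0 k - y' ord0 k| <= d) ->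
    `|average O u b s y - average O u b s y'| <= L * N * d.
Proof.
move=> sb bs s0.
have [Q Q0 HQ] := pk_lipschitz (@scale_smooth _ _ b s 0 sb) (@scale_supp _ _ b s 0 lo hi s0 bs).
pose w := fine (mu O).
have w0 : 0 <= w by rewrite fine_ge0.
exists (Q * (w + 1) + 1); first by rewrite ltr_wpDl// mulr_ge0 ?addr_ge0 ?(ltW Q0).
move=> u N y y' d N0 d0 su uN yd.
have kd z : `|pk (scale b s y) z - pk (scale b s y') z| <= Q * d.
  rewrite (pk_scale_shift _ _ y) (pk_scale_shift _ _ y'); apply: HQ => // k.
  rewrite !mxE.
  have -> : z ord0 k - y ord0 k - (z ord0 k - y' ord0 k) = - (y ord0 k - y' ord0 k) by ring.
  by rewrite normrN.
have ck := @pk_scale_continuous R n b s.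
have mk y1 : measurable_fun O (pk (scale b s y1)) by apply: continuous_measurable => //; exact: ck.
have md : measurable_fun O (fun z => pk (scale b s y) z - pk (scale b s y') z).
  exact: measurable_funB.
have sd := sqint_bounded mO Ofin md (fun z _ => kd z).
have cs := cauchy_schwarz_Rintegral mO su sd.
have avE : average O u b s y - average O u b s y' =
    \int[mu]_(z in O) (u z * (pk (scale b s y) z - pk (scale b s y') z)).
  rewrite /average -RintegralB//; first by apply: eq_Rintegral => z _; rewrite mulrBr.
  - by apply: (average_integrable oO _ s0 _ sb bs); exact: sqint_integrable su.
  - by apply: (average_integrable oO _ s0 _ sb bs); exact: sqint_integrable su.
have Qd0 : 0 <= Q * d by apply: le_trans (kd 0).
have kint : \int[mu]_(z in O) ((pk (scale b s y) z - pk (scale b s y') z) ^+ 2) <= (Q * d) ^+ 2 * w.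
  rewrite -Rintegral_cst//; apply: le_Rintegral => //.
  - by case: sd.
  - by apply: (@bounded_integrable _ _ _ mu _ mO _ ((Q * d) ^+ 2)) => // z _; rewrite ger0_norm ?sqr_ge0.
  - by move=> z _; rewrite -real_normK ?num_real// lerXn2r ?nnegrE.
rewrite -avE in cs.
have d0' : 0 <= Q * d * (w + 1) * N.
  by apply: mulr_ge0 => //; apply: mulr_ge0 => //; exact: addr_ge0.
apply: (@le_trans _ _ (Q * d * (w + 1) * N)).
  rewrite -ler_sqr ?nnegrE// real_normK ?num_real//; apply: le_trans cs _.
  apply: (@le_trans _ _ (N ^+ 2 * ((Q * d) ^+ 2 * w))).
    by apply: ler_pM => //; apply: Rintegral_ge0 => z _; exact: sqr_ge0.
  have -> : (Q * d * (w + 1) * N) ^+ 2 = N ^+ 2 * ((Q * d) ^+ 2 * (w + 1) ^+ 2) by ring.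
  rewrite ler_wpM2l ?sqr_ge0// ler_wpM2l ?sqr_ge0//; nra.
have := mulr_ge0 N0 d0; nra.
Qed.

End average_regularity.

(** * The averages converge to a multiple of the function *)

Section fubini.
Context {R : realType} {n : nat}.
Local Notation E := 'rV[R]_n.
Local Notation mu := (@lebesgue_rV R n).

Lemma Fubini_Rintegral (f : E -> E -> R) :
  (mu \x mu)%E.-integrable setT (fun p => (f p.1 p.2)%:E) ->
  (forall y, mu.-integrable setT (EFin \o f y)) ->
  (forall z, mu.-integrable setT (EFin \o f ^~ z)) ->
  \int[mu]_y \int[mu]_z f y z = \int[mu]_z \int[mu]_y f y z.
Proof.
move=> fi f1 f2; rewrite /Rintegral; congr fine.
have := Fubini fi => /= H.
transitivity (\int[mu]_y \int[mu]_z (f y z)%:E)%E.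
  by apply: eq_integral => y _; rewrite fineK//; exact: integrable_fin_num (f1 y).
rewrite H; apply: eq_integral => z _; rewrite fineK//.
exact: integrable_fin_num (f2 z).
Qed.

End fubini.

Section kernel_limit.
Context {R : realType} {n : nat}.
Local Notation E := 'rV[R]_n.
Local Notation mu := (@lebesgue_rV R n).
Local Notation cube M := (cbox (fun=> - M) (fun=> M) : set E).
Implicit Types (b : 'I_n -> R -> R) (lo hi : 'I_n -> R) (y z : E) (u psi : E -> R).

Lemma measurable_pk_scale b (s : R) d (T : measurableType d) (f g : T -> E) :
  smooth_family b -> measurable_fun setT f -> measurable_fun setT g ->
  measurable_fun setT (fun t => pk (scale b s (f t)) (g t)).
Proof.
move=> sb mf mg; apply: measurable_prod => k _; apply: measurable_funM => //.
have cb : measurable_fun setT (b k) by apply: continuous_measurable_fun; exact: smooth1_continuous.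
apply: (measurableT_comp cb); apply: measurable_funM => //.
have mc : measurable_fun setT (fun x : E => x ord0 k) by exact: measurable_rV_coord.
by apply: measurable_funB; [exact: (measurableT_comp mc mg)|exact: (measurableT_comp mc mf)].
Qed.

Lemma kernel_integrable b (s : R) lo hi psi z : 0 < s ->
  smooth_family b -> supp_family b lo hi ->
  continuous psi -> compactly_supported psi ->
  mu.-integrable setT (EFin \o (fun y => pk (scale b s y) z * psi y)).
Proof.
move=> s0 sb bs cp sp.
rewrite (_ : _ \o _ = EFin \o (psi \* (fun y => pk (scale b s y) z))); last first.
  by apply/funext => y /=; rewrite mulrC.
have [M M0 bM] := pk_bounded sb bs.
apply: (@integrable_mul_bounded _ _ _ mu setT measurableT _ _ (s ^- n * M)).
- exact: continuous_integrable.
- exact: (@measurable_pk_scale b s _ _ id (cst z)).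
- by move=> y _; exact: pk_scale_bound.
Qed.

Lemma average_pairing (O : set E) u b (s : R) lo hi psi : measurable O -> 0 < s ->
  mu.-integrable O (EFin \o u) ->
  smooth_family b -> supp_family b lo hi ->
  continuous psi -> compactly_supported psi ->
  \int[mu]_y (average O u b s y * psi y) =
  \int[mu]_(z in O) (u z * \int[mu]_y (pk (scale b s y) z * psi y)).
Proof.
move=> mO s0 ui sb bs cp sp.
have [M M0 bM] := pk_bounded sb bs.
have [P P0 pP] := continuous_bounded cp sp.
have [c sc] := sp.
pose v := u \_ O.
have vi : mu.-integrable setT (EFin \o v).
  have := (integrable_mkcond (EFin \o u) mO).1 ui.
  by rewrite restrict_EFin.
have mv : measurable_fun setT v by have /integrableP[/measurable_EFinP] := vi.
pose k y z := pk (scale b s y) z.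
have kB y z : `|k y z| <= s ^- n * M by exact: pk_scale_bound.
have B0 : 0 <= s ^- n * M by apply: le_trans (kB 0 0).
have mk2 : measurable_fun setT (fun p : E * E => k p.1 p.2).
  exact: (@measurable_pk_scale b s _ _ fst snd).
have mk y : measurable_fun setT (k y).
  exact: (@measurable_pk_scale b s _ _ (cst y) id).
have mp : measurable_fun setT psi by exact: continuous_measurable.
pose f y z := v z * (k y z * psi y).
have ki z : mu.-integrable setT (EFin \o (fun y => k y z * psi y)).
  exact: kernel_integrable bs cp sp.
have kpP y z : `|k y z * psi y| <= s ^- n * M * P.
  by rewrite normrM; apply: ler_pM.
have f2 z : mu.-integrable setT (EFin \o f ^~ z).
  rewrite (_ : _ \o _ = (fun y => (v z)%:E * (k y z * psi y)%:E)%E).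
    by apply: integrableZl => //; exact: ki.
  by apply/funext.
have f1 y : mu.-integrable setT (EFin \o f y).
  apply: (@integrable_mul_bounded _ _ _ mu setT measurableT v _ (s ^- n * M * P)) => //.
  by apply: measurable_funM => //; exact: measurable_cst.
have fi : (mu \x mu)%E.-integrable setT (fun p => (f p.1 p.2)%:E).
  apply/integrable21ltyP.
    apply/measurable_EFinP; apply: measurable_funM; first exact: measurableT_comp.
    by apply: measurable_funM => //; exact: measurableT_comp.
  pose W := s ^- n * M * P * fine (mu (cube c)).
  have inner z : (\int[mu]_y `|(f y z)%:E| <= (`|v z| * W)%:E)%E.
    have -> : (\int[mu]_y `|(f y z)%:E| = \int[mu]_(y in cube c) `|(f y z)%:E|)%E.
      rewrite [RHS]integral_mkcond; apply: eq_integral => y _; rewrite patchE.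
      case: ifPn => // /negP yc; rewrite /f sc ?mulr0 ?abse0//.
      by move=> ?; apply: yc; rewrite inE.
    apply: (@le_trans _ _ (\int[mu]_(y in cube c) (cst (`|v z| * (s ^- n * M * P))%:E y))%E).
      apply: ge0_le_integral => //.
      - exact: measurable_cbox.
      - apply: measurableT_comp => //; apply/measurable_funTS.
        by have /integrableP[] := f2 z.
      - by move=> y _; rewrite lee_fin normrM ler_wpM2l.
    rewrite integral_cst; last exact: measurable_cbox.
    have fc : mu (cube c) \is a fin_num by rewrite ge0_fin_numE ?cube_finite.
    by rewrite -[X in (_ * X)%E](fineK fc) -EFinM lee_fin /W !mulrA.
  have H : mu.-integrable setT (fun z => (`|v z| * W)%:E).
    rewrite (_ : (fun z => _) = (fun z => W%:E * `|(EFin \o v) z|)%E).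
      by apply: integrableZl => //; exact: integrable_abse.
    by apply/funext => z /=; rewrite mulrC.
  have /integrableP[mH] := H; apply: le_lt_trans.
  apply: ge0_le_integral => //.
  - by move=> z _; exact: integral_ge0.
  - apply: (@measurable_fun_fubini_tonelli_G _ _ _ _ _ mu (fun p : E * E => `|(f p.1 p.2)%:E|%E)) => //.
    apply: measurableT_comp => //.
    apply/measurable_EFinP; apply: measurable_funM; first exact: measurableT_comp.
    by apply: measurable_funM => //; exact: measurableT_comp.
  - by apply: measurableT_comp.
  - move=> z _; apply: le_trans (inner z) _; rewrite lee_fin; exact: ler_norm.
have := Fubini_Rintegral fi f1 f2.
have -> : \int[mu]_y \int[mu]_z f y z = \int[mu]_y (average O u b s y * psi y).
  apply: eq_Rintegral => y _; rewrite /average [X in _ = X * _]Rintegral_mkcond mulrC.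
  rewrite -RintegralZl//.
    apply: eq_Rintegral => z _; rewrite /f /v !patchE /k; case: ifP => _; first by ring.
    by rewrite mul0r mulr0.
  have := (integrable_mkcond (EFin \o (fun z => u z * pk (scale b s y) z)) mO).1.
  rewrite restrict_EFin; apply.
  apply: (@integrable_mul_bounded _ _ _ mu O mO u _ (s ^- n * M)) => //.
    exact: measurable_funTS (mk y).
  by move=> z _; exact: kB.
move=> ->; rewrite [RHS]Rintegral_mkcond; apply: eq_Rintegral => z _.
rewrite /f /v !patchE; case: ifP => _; first by rewrite RintegralZl//; exact: ki.
by rewrite -[RHS](mul0r (\int[mu]_y (k y z * psi y))) RintegralZl//; exact: ki.
Qed.

End kernel_limit.

Section mass.
Context {R : realType} {n : nat}.
Local Notation E := 'rV[R]_n.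
Local Notation mu := (@lebesgue_rV R n).
Implicit Types (b : 'I_n -> R -> R) (lo hi : 'I_n -> R) (y z : E) (u psi : E -> R).

Definition mass b : R := \int[mu]_z pk b z.

Lemma pk_compactly_supported b lo hi : supp_family b lo hi -> compactly_supported (pk b).
Proof.
move=> bs; have [M _ cM] := compact_cube (@compact_cbox _ _ lo hi).
by exists M => x xM; apply: (pk_eq0 bs) => /cM.
Qed.

Lemma pk_integrable b lo hi : smooth_family b -> supp_family b lo hi ->
  mu.-integrable setT (EFin \o pk b).
Proof.
move=> sb bs; apply: continuous_integrable => //; first exact: pk_continuous.
exact: pk_compactly_supported bs.
Qed.

Lemma mass_scale b lo hi (s : R) z : 0 < s -> smooth_family b -> supp_family b lo hi ->
  (forall x, 0 <= pk b x) -> \int[mu]_y pk (scale b s y) z = mass b.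
Proof.
move=> s0 sb bs b0.
have si : 0 < s^-1 by rewrite invr_gt0.
have bi := pk_integrable sb bs.
have mb : measurable_fun setT (EFin \o pk b) by have /integrableP[] := bi.
have := @ge0_integral_reflect_scale R n (s^-1 *: z) s^-1 (EFin \o pk b) si mb
  (fun x => b0 x).
rewrite exprVn invrK => H.
have kE y : pk (scale b s y) z = s ^- n * pk b (s^-1 *: z - s^-1 *: y).
  rewrite pk_scale; congr (_ * _); apply: eq_bigr => k _.
  by rewrite !mxE mulrBr.
transitivity (\int[mu]_y (s ^- n * pk b (s^-1 *: z - s^-1 *: y))).
  by apply: eq_Rintegral => y _.
rewrite /Rintegral.
under eq_integral do rewrite EFinM.
rewrite ge0_integralZl//; last 3 first.
- exact: measurableT_comp mb (measurable_reflect_scale _ _).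
- by move=> y _; rewrite lee_fin.
- by rewrite lee_fin invr_ge0 exprn_ge0// ltW.
rewrite H muleA -EFinM mulVf ?mul1e//.
by rewrite expf_neq0// gt_eqF.
Qed.

Lemma mass_bump_gt0 lo hi : (forall k, lo k < hi k) ->
  0 < mass (fun k => bump (lo k) (hi k)).
Proof.
move=> lh; set b := fun k => _.
have sb : smooth_family b by move=> k; exact: smooth1_bump.
have bs : supp_family b lo hi.
  move=> k t tlh; rewrite /b bump_eq0//; apply: contra tlh => /andP[h1 h2].
  by rewrite !ltW.
have b0 x : 0 <= pk b x by apply: prodr_ge0 => k _; exact: bump_ge0.
have bi := pk_integrable sb bs.
rewrite lt_neqAle Rintegral_ge0// andbT; apply/eqP => m0.
have : ae_eq mu setT (EFin \o pk b) (cst 0%E).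
  apply/ae_eq_integral_abs => //; first by have /integrableP[] := bi.
  under eq_integral do rewrite /= ger0_norm//.
  by rewrite -(fineK (integrable_fin_num measurableT bi)); congr EFin; rewrite [RHS]m0.
move=> [N [mN N0 bN]].
have oN : obox lo hi `<=` N.
  move=> x xB; apply: bN => /= /(_ I)[] /eqP.
  rewrite gt_eqF//; apply: prodr_gt0 => k _; apply: bump_gt0; exact: xB.
have := @open_measure_gt0 R n (obox lo hi) (@obox_open _ _ _ _).
have ne : obox lo hi !=set0.
  exists (\row_k ((lo k + hi k) / 2)) => k; rewrite mxE.
  by have := lh k => ?; apply/andP; split; lra.
move=> /(_ ne); rewrite ltNge => /negP; apply.
rewrite -N0; apply: le_measure => //; rewrite inE//.
exact: measurable_obox.
Qed.

Lemma coord_lipschitz_continuous (f : E -> R) (L : R) : 0 < L ->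
  (forall (x y : E) d, 0 <= d -> (forall k, `|x ord0 k - y ord0 k| <= d) ->
     `|f x - f y| <= L * d) -> continuous f.
Proof.
move=> L0 fL x; apply: (cvgrPdist_le (F := nbhs x) f (f x)).2 => /= e e0.
have eL : 0 < e / L by rewrite divr_gt0.
apply/nbhs_ballP; exists (e / L) => //= y /(ball_rVP _ _ eL) xy.
have -> : e = L * (e / L) by rewrite mulrC divfK ?gt_eqF.
by apply: fL => [|k]; rewrite ltW.
Qed.

(** Exchanging the integrals moves the averaging from [u] to the smooth [pk b'],
    which it changes by [O(s)], besides the factor [mass b]. *)
Lemma pairing_limit (O : set E) u b lo hi b' lo' hi' : measurable O ->
  mu.-integrable O (EFin \o u) ->
  smooth_family b -> supp_family b lo hi -> (forall x, 0 <= pk b x) ->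
  smooth_family b' -> supp_family b' lo' hi' ->
  exists2 C, 0 <= C & forall s : R, 0 < s ->
    `|\int[mu]_y (average O u b s y * pk b' y) -
      mass b * \int[mu]_(z in O) (u z * pk b' z)| <= C * s.
Proof.
move=> mO ui sb bs b0 sb' bs'.
have [L L0 HL] := pk_lipschitz sb' bs'.
pose m := \sum_k (`|lo k| + `|hi k|).
have m0 : 0 <= m by apply: sumr_ge0 => k _; rewrite addr_ge0.
have mass0 : 0 <= mass b by exact: Rintegral_ge0.
pose I := \int[mu]_(z in O) `|u z|.
have I0 : 0 <= I by exact: Rintegral_ge0.
exists (I * (mass b * (L * m))); first by rewrite !mulr_ge0// ltW.
move=> s s0; set psi := pk b'.
have cp : continuous psi by exact: pk_continuous.
have sp : compactly_supported psi by exact: pk_compactly_supported bs'.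
have ki z := @kernel_integrable R n b s lo hi psi z s0 sb bs cp sp.
have k1i z : mu.-integrable setT (EFin \o (fun y => pk (scale b s y) z)).
  rewrite (_ : (fun y => _) = (fun y => pk (scale b s 0) (z - y))); last first.
    by apply/funext => y; exact: pk_scale_shift.
  apply: integrable_reflect.
  exact: pk_integrable (@scale_smooth _ _ b s 0 sb) (@scale_supp _ _ b s 0 lo hi s0 bs).
have k0 y z : 0 <= pk (scale b s y) z.
  rewrite pk_scale mulr_ge0 ?invr_ge0 ?exprn_ge0 ?(ltW s0)//.
  have := b0 (\row_k (s^-1 * (z ord0 k - y ord0 k))); rewrite /pk.
  by under eq_bigr do rewrite mxE.
have close y z : pk (scale b s y) z != 0 -> forall k, `|y ord0 k - z ord0 k| <= s * m.
  move=> kn0 k; have : cbox (shift_box lo s y) (shift_box hi s y) z.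
    by apply: contrapT => zb; move: kn0; rewrite (pk_eq0 (scale_supp s0 bs) zb) eqxx.
  move=> /(_ k); rewrite /shift_box => /andP[h1 h2].
  have lom : `|lo k| <= m /\ `|hi k| <= m.
    rewrite /m (bigD1 k)//=; set r := \sum_(i | _) _.
    have r0 : 0 <= r by apply: sumr_ge0 => j _; rewrite addr_ge0.
    have := normr_ge0 (lo k); have := normr_ge0 (hi k); split; lra.
  case: lom; rewrite !ler_norml => /andP[l1 l2] /andP[h3 h4].
  have p1 : s * lo k >= s * - m by rewrite ler_pM2l.
  have p2 : s * hi k <= s * m by rewrite ler_pM2l.
  apply/andP; split; lra.
have inner z : `|\int[mu]_y (pk (scale b s y) z * psi y) - mass b * psi z| <= mass b * (L * m) * s.
  have -> : \int[mu]_y (pk (scale b s y) z * psi y) - mass b * psi z =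
      \int[mu]_y (pk (scale b s y) z * (psi y - psi z)).
    rewrite -(mass_scale z s0 sb bs b0) mulrC -RintegralZl//.
    rewrite -RintegralB//; last first.
      rewrite (_ : _ \o _ = (fun y => (psi z)%:E * (pk (scale b s y) z)%:E)%E).
        by apply: integrableZl => //; exact: k1i.
      by apply/funext.
    by apply: eq_Rintegral => y _; rewrite mulrBr [psi z * _]mulrC.
  have di : mu.-integrable setT (EFin \o (fun y => pk (scale b s y) z * (psi y - psi z))).
    rewrite (_ : _ \o _ = (fun y => (pk (scale b s y) z * psi y)%:E - (psi z)%:E * (pk (scale b s y) z)%:E)%E).
      apply: integrableB => //; first exact: ki.
      by apply: integrableZl => //; exact: k1i.
    by apply/funext => y /=; rewrite mulrBr EFinB [psi z * _]mulrC.
  apply: le_trans (le_normr_Rintegral measurableT di) _.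
  have -> : mass b * (L * m) * s = \int[mu]_y (L * (s * m) * pk (scale b s y) z).
    rewrite (@RintegralZl _ _ _ mu setT (fun y => pk (scale b s y) z) (L * (s * m)) measurableT (k1i z)).
    by rewrite (mass_scale z s0 sb bs b0); ring.
  apply: le_Rintegral => //.
  - have := integrable_abse di.
    by rewrite (_ : abse \o _ = EFin \o (fun y => `|pk (scale b s y) z * (psi y - psi z)|)).
  - rewrite (_ : _ \o _ = (fun y => (L * (s * m))%:E * (pk (scale b s y) z)%:E)%E).
      by apply: integrableZl => //; exact: k1i.
    by apply/funext.
  - move=> y _; rewrite normrM ger0_norm// mulrC.
    have [->|kn0] := eqVneq (pk (scale b s y) z) 0; first by rewrite !mulr0.
    rewrite ler_wpM2r//; apply: HL; last exact: close.
    by rewrite mulr_ge0// ltW.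
rewrite (average_pairing mO s0 ui sb bs cp sp).
have up : mu.-integrable O (EFin \o (fun z => u z * psi z)).
  have [P P0 pP] := continuous_bounded cp sp.
  apply: (@integrable_mul_bounded _ _ _ mu O mO u psi P) => //.
  exact: continuous_measurable.
have um : measurable_fun O u by have /integrableP[/measurable_EFinP] := ui.
pose J z := \int[mu]_y (pk (scale b s y) z * psi y).
have mJ : measurable_fun O J.
  apply: continuous_measurable => //.
  have [Q Q0 HQ] := pk_lipschitz (@scale_smooth _ _ b s 0 sb) (@scale_supp _ _ b s 0 lo hi s0 bs).
  have pi1 : mu.-integrable setT (EFin \o (fun y => `|psi y|)).
    have := integrable_abse (continuous_integrable measurableT cp sp).
    by rewrite (_ : abse \o _ = EFin \o (fun y => `|psi y|)).
  pose P := \int[mu]_y `|psi y|.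
  have P0 : 0 <= P by exact: Rintegral_ge0.
  apply: (@coord_lipschitz_continuous J (Q * P + 1)); first by rewrite ltr_wpDl// mulr_ge0// ltW.
  move=> z z' d d0 zz'; apply: (@le_trans _ _ (Q * d * P)); last first.
    by rewrite mulrAC ler_wpM2r// lerDl.
  have di : mu.-integrable setT (EFin \o (fun y => pk (scale b s y) z * psi y - pk (scale b s y) z' * psi y)).
    rewrite (_ : _ \o _ = (fun y => (pk (scale b s y) z * psi y)%:E - (pk (scale b s y) z' * psi y)%:E)%E).
      by apply: integrableB => //; exact: ki.
    by apply/funext.
  rewrite /J -RintegralB//.
  apply: le_trans (le_normr_Rintegral measurableT di) _.
  rewrite -RintegralZl//; apply: le_Rintegral => //.
  - have := integrable_abse di.
    by rewrite (_ : abse \o _ = EFin \o (fun y => `|pk (scale b s y) z * psi y - pk (scale b s y) z' * psi y|)).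
  - rewrite (_ : _ \o _ = (fun y => (Q * d)%:E * (`|psi y|)%:E)%E).
      exact: integrableZl.
    by apply/funext.
  - move=> y _; rewrite -mulrBl normrM ler_wpM2r// !(pk_scale_shift _ _ y).
    apply: HQ => // k; rewrite !mxE.
    have -> : z ord0 k - y ord0 k - (z' ord0 k - y ord0 k) = z ord0 k - z' ord0 k by ring.
    exact: zz'.
pose D z := J z - mass b * psi z.
have mD : measurable_fun O D.
  apply: measurable_funB => //; apply: measurable_funM => //.
  exact: continuous_measurable.
have uD : mu.-integrable O (EFin \o (fun z => u z * D z)).
  apply: (@integrable_mul_bounded _ _ _ mu O mO u D (mass b * (L * m) * s)) => //.
  by move=> z _; exact: inner.
have mup : mu.-integrable O (EFin \o (fun z => mass b * (u z * psi z))).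
  rewrite (_ : _ \o _ = (fun z => (mass b)%:E * (u z * psi z)%:E)%E).
    exact: integrableZl.
  by apply/funext.
have -> : \int[mu]_(z in O) (u z * J z) =
    \int[mu]_(z in O) (u z * D z) + mass b * \int[mu]_(z in O) (u z * psi z).
  rewrite -[mass b * _]RintegralZl// -RintegralD//.
  by apply: eq_Rintegral => z _; rewrite /D; ring.
rewrite addrK.
have ai : mu.-integrable O (EFin \o (fun z => `|u z|)).
  have := integrable_abse ui.
  by rewrite (_ : abse \o _ = EFin \o (fun z => `|u z|)).
apply: le_trans (le_normr_Rintegral mO uD) _.
have -> : I * (mass b * (L * m)) * s = \int[mu]_(z in O) (mass b * (L * m) * s * `|u z|).
  by rewrite RintegralZl// -/I; ring.
apply: le_Rintegral => //.
- have := integrable_abse uD.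
  by rewrite (_ : abse \o _ = EFin \o (fun z => `|u z * D z|)).
- rewrite (_ : _ \o _ = (fun z => (mass b * (L * m) * s)%:E * (`|u z|)%:E)%E).
    exact: integrableZl.
  by apply/funext.
- by move=> z _; rewrite normrM mulrC ler_wpM2r//; exact: inner.
Qed.

End mass.

Section local_limit.
Context {R : realType} {n : nat}.
Local Notation E := 'rV[R]_n.
Local Notation mu := (@lebesgue_rV R n).
Variable O : set E.
Hypothesis oO : open O.
Hypothesis Ofin : (mu O < +oo)%E.
Implicit Types (b : 'I_n -> R -> R) (lo hi : 'I_n -> R) (y z : E) (u W : E -> R).

Let mO : measurable O. Proof. exact: measurable_open. Qed.

Lemma average_continuous u b lo hi (s : R) : 0 < s -> sqint mu O u ->
  smooth_family b -> supp_family b lo hi -> continuous (average O u b s).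
Proof.
move=> s0 su sb bs; have [L L0 HL] := average_lipschitz_center oO Ofin sb bs s0.
pose N := 1 + \int[mu]_(z in O) (u z ^+ 2).
have I0 : 0 <= \int[mu]_(z in O) (u z ^+ 2) by apply: Rintegral_ge0 => z _; exact: sqr_ge0.
have N0 : 0 <= N by rewrite addr_ge0.
have uN : \int[mu]_(z in O) (u z ^+ 2) <= N ^+ 2 by rewrite /N; nra.
apply: (@coord_lipschitz_continuous _ _ _ (L * N + 1)); first by rewrite ltr_wpDl// mulr_ge0// ltW.
move=> x y d d0 xy; apply: le_trans (HL u N x y d N0 d0 su uN xy) _.
by rewrite ler_wpM2r// lerDl.
Qed.

Lemma eq0_of_small (a D x0 : R) : 0 < x0 ->
  (forall x, 0 < x <= x0 -> `|a| <= D * x) -> a = 0.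
Proof.
move=> x00 aD; apply/eqP; rewrite -normr_le0; apply/ler_addgt0Pr => e e0; rewrite add0r.
have D1 : 0 < `|D| + 1 by rewrite ltr_wpDl.
pose x := Num.min x0 (e / (`|D| + 1)).
have xx : 0 < x <= x0 by rewrite lt_min x00 divr_gt0//= ge_min lexx.
apply: le_trans (aD x xx) _; have /andP[px _] := xx.
have xe : x <= e / (`|D| + 1) by rewrite ge_min lexx orbT.
apply: (@le_trans _ _ ((`|D| + 1) * x)).
  by rewrite ler_wpM2r ?(ltW px)//; apply: le_trans (ler_norm _) _; rewrite lerDl.
by rewrite -ler_pdivlMl// mulrC.
Qed.

(** Both sides have the same integral against every product kernel, since by
    [pairing_limit] the averages tend weakly to [mass b * u]. *)
Lemma limit_ae_eq u W b lo hi (P : set E) (C x0 : R) :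
  open P -> P `<=` O -> sqint mu O u ->
  smooth_family b -> supp_family b lo hi -> (forall x, 0 <= pk b x) ->
  0 < x0 -> 0 <= C ->
  (forall y, P y -> forall x, 0 < x <= x0 -> `|average O u b (x ^+ 2) y - W y| <= C * x) ->
  ae_eq mu P W (fun y => mass b * u y).
Proof.
move=> oP PO su sb bs b0 x00 C0 PW.
have mP : measurable P by exact: measurable_open.
have Pfin : (mu P < +oo)%E by apply: le_lt_trans Ofin; apply: le_measure; rewrite ?inE.
have ui : mu.-integrable O (EFin \o u) by exact: sqint_integrable.
have uPi : mu.-integrable P (EFin \o u) by exact: integrableS ui.
have mu1 : measurable_fun P u by have /integrableP[/measurable_EFinP] := uPi.
have ca x : 0 < x -> continuous (average O u b (x ^+ 2)).
  by move=> px; apply: (average_continuous _ su sb bs); rewrite exprn_gt0.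
have mW : measurable_fun P W.
  pose xj j := x0 * j.+1%:R^-1.
  have xjP j : 0 < xj j <= x0.
    rewrite /xj mulr_gt0 ?invr_gt0//= ler_piMr ?(ltW x00)// invf_le1 ?ler1n//.
  apply: (@measurable_fun_cvg _ _ _ _ (fun j => average O u b (xj j ^+ 2))) => [j|y Py].
    apply: continuous_measurable => //; apply: ca; by case/andP: (xjP j).
  apply/cvgrPdist_le => /= e e0.
  have : C * xj j @[j --> \oo] --> C * (x0 * 0).
    by apply: cvgMr; apply: cvgMr; exact: cvg_harmonic.
  rewrite !mulr0 => /cvgrPdist_le /(_ e e0); apply: filterS => j.
  rewrite sub0r normrN => Cx; rewrite distrC; apply: le_trans (PW y Py _ (xjP j)) _.
  by apply: le_trans Cx; exact: ler_norm.
have x0x0 : 0 < x0 <= x0 by rewrite x00 lexx.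
have [M M0 bM] := pk_bounded sb bs.
have s0 : 0 < x0 ^+ 2 by rewrite exprn_gt0.
pose A := \int[mu]_(z in O) ((x0 ^+ 2) ^- n * M * `|u z|).
have aA y : `|average O u b (x0 ^+ 2) y| <= A.
  have ki := @average_integrable R n O oO u b _ y lo hi s0 ui sb bs.
  apply: le_trans (le_normr_Rintegral mO ki) _; apply: le_Rintegral => //.
  - have := integrable_abse ki.
    by rewrite (_ : abse \o _ = EFin \o (fun z => `|u z * pk (scale b (x0 ^+ 2) y) z|)).
  - rewrite (_ : _ \o _ = (fun z => ((x0 ^+ 2) ^- n * M)%:E * `|(EFin \o u) z|)%E).
      by apply: integrableZl => //; exact: integrable_abse.
    by apply/funext.
  - by move=> z _; rewrite normrM mulrC ler_wpM2r//; exact: pk_scale_bound.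
have WB y : P y -> `|W y| <= A + C * x0.
  move=> Py; have := PW y Py x0 x0x0; have := aA y.
  rewrite !ler_norml => /andP[? ?] /andP[? ?]; apply/andP; split; lra.
have Wi : mu.-integrable P (EFin \o W).
  exact: (bounded_integrable mP Pfin mW WB).
pose g y := W y - mass b * u y.
have mui : mu.-integrable P (EFin \o (fun y => mass b * u y)).
  rewrite (_ : _ \o _ = (fun y => (mass b)%:E * (u y)%:E)%E).
    exact: integrableZl.
  by apply/funext.
have gi : mu.-integrable P (EFin \o g).
  rewrite (_ : _ \o _ = (fun y => (W y)%:E - (mass b * u y)%:E)%E).
    exact: integrableB.
  by apply/funext.
suff : ae_eq mu P g (cst 0).
  by apply: filterS => y /= + Py => /(_ Py) /eqP; rewrite subr_eq0 => /eqP.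
apply: (fundamental_lemma oP gi) => b' lo' hi' sb' bs' boxP.
set psi := pk b'.
have cp : continuous psi by exact: pk_continuous.
have sp : compactly_supported psi by exact: pk_compactly_supported bs'.
have [Q Q0 pQ] := continuous_bounded cp sp.
have mp (D : set E) : measurable D -> measurable_fun D psi by move=> mD; exact: continuous_measurable.
have p0 z : ~ P z -> psi z = 0.
  by move=> Pz; apply: (pk_eq0 bs') => /boxP.
have bmul (f : E -> R) : mu.-integrable P (EFin \o f) ->
    mu.-integrable P (EFin \o (fun y => f y * psi y)).
  by move=> fi; apply: (@integrable_mul_bounded _ _ _ mu P mP f psi Q) => //; exact: mp.
have [C' C'0 HC'] := pairing_limit mO ui sb bs b0 sb' bs'.
pose I := \int[mu]_(y in P) `|psi y|.
have pii : mu.-integrable P (EFin \o (fun y => `|psi y|)).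
  have := integrable_abse (continuous_integrable mP cp sp).
  by rewrite (_ : abse \o _ = EFin \o (fun y => `|psi y|)).
apply: (@eq0_of_small _ (C * I + C' * x0) _ x00) => x xx.
have /andP[px xx0] := xx.
have ai : mu.-integrable P (EFin \o (average O u b (x ^+ 2))).
  apply: (bounded_integrable mP Pfin (M := A + C * x0 + C * x)) => [|y Py].
    by apply: continuous_measurable => //; exact: ca.
  have := PW y Py x xx; have := WB y Py.
  rewrite !ler_norml => /andP[? ?] /andP[? ?]; apply/andP; split; lra.
have api := bmul _ ai; have Wpi := bmul _ Wi; have upi := bmul _ uPi.
have e1 : \int[mu]_(y in P) (g y * psi y) =
    \int[mu]_(y in P) ((W y - average O u b (x ^+ 2) y) * psi y) +
    (\int[mu]_y (average O u b (x ^+ 2) y * psi y) - mass b * \int[mu]_(z in O) (u z * psi z)).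
  have -> : \int[mu]_y (average O u b (x ^+ 2) y * psi y) =
      \int[mu]_(y in P) (average O u b (x ^+ 2) y * psi y).
    apply/esym/Rintegral_subset_support => // y _ Py; by rewrite p0// mulr0.
  have -> : \int[mu]_(z in O) (u z * psi z) = \int[mu]_(z in P) (u z * psi z).
    by apply/esym/Rintegral_subset_support => // y _ Py; rewrite p0// mulr0.
  have -> : \int[mu]_(y in P) ((W y - average O u b (x ^+ 2) y) * psi y) =
      \int[mu]_(y in P) (W y * psi y) - \int[mu]_(y in P) (average O u b (x ^+ 2) y * psi y).
    by rewrite -RintegralB//; apply: eq_Rintegral => y _; rewrite mulrBl.
  have -> : \int[mu]_(y in P) (g y * psi y) =
      \int[mu]_(y in P) (W y * psi y) - mass b * \int[mu]_(y in P) (u y * psi y).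
    rewrite -[mass b * _]RintegralZl// -RintegralB//; last first.
      rewrite (_ : _ \o _ = (fun y => (mass b)%:E * (u y * psi y)%:E)%E).
        exact: integrableZl.
      by apply/funext.
    by apply: eq_Rintegral => y _; rewrite /g; ring.
  ring.
rewrite e1; apply: le_trans (ler_normD _ _) _; rewrite mulrDl; apply: lerD; last first.
  apply: le_trans (HC' _ _) _; first by rewrite exprn_gt0.
  by rewrite -mulrA ler_wpM2l// expr2 ler_wpM2r// ltW.
have dpi : mu.-integrable P (EFin \o (fun y => (W y - average O u b (x ^+ 2) y) * psi y)).
  apply: bmul; rewrite (_ : _ \o _ = (fun y => (W y)%:E - (average O u b (x ^+ 2) y)%:E)%E).
    exact: integrableB.
  by apply/funext.
apply: le_trans (le_normr_Rintegral mP dpi) _.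
have -> : C * I * x = \int[mu]_(y in P) (C * x * `|psi y|).
  by rewrite RintegralZl// -/I; ring.
apply: le_Rintegral => //.
- have := integrable_abse dpi.
  by rewrite (_ : abse \o _ = EFin \o (fun y => `|(W y - average O u b (x ^+ 2) y) * psi y|)).
- rewrite (_ : _ \o _ = (fun y => (C * x)%:E * (`|psi y|)%:E)%E).
    exact: integrableZl.
  by apply/funext.
- by move=> y Py; rewrite normrM ler_wpM2r// distrC; exact: PW.
Qed.

End local_limit.

Section local_representative.
Context {R : realType}.

(** The limit at the origin, obtained as a supremum of lower bounds. *)
Lemma lipschitz_limit0 (g : R -> R) (C x0 : R) : 0 < x0 -> 0 <= C ->
  (forall x t, 0 < x <= x0 -> 0 < t <= x0 -> `|g x - g t| <= C * `|x - t|) ->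
  exists w, forall x, 0 < x <= x0 -> `|g x - w| <= C * x.
Proof.
move=> x00 C0 gC.
pose S := [set g t - C * t | t in [set t | 0 < t <= x0]].
have x0x0 : 0 < x0 <= x0 by rewrite x00 lexx.
have ub x : 0 < x <= x0 -> ubound S (g x + C * x).
  move=> xx _ [t tt <-]; have := gC t x tt xx.
  have /andP[pt _] := tt; have /andP[px _] := xx.
  have : `|t - x| <= t + x by rewrite ler_norml; apply/andP; split; lra.
  move=> /(ler_wpM2l C0) H1 /(le_trans (ler_norm _)) H2.
  by move: H1; rewrite mulrDr; lra.
exists (sup S) => x xx; rewrite ler_distl; apply/andP; split.
  rewrite lerBlDr; apply: ge_sup; last exact: ub.
  by exists (g x0 - C * x0), x0.
have hS : has_ubound S by exists (g x0 + C * x0); exact: ub.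
by rewrite -lerBlDr; apply: (ub_le_sup hS); exists x.
Qed.

Lemma dist_quarters (a a' w w' p q : R) : `|a - a'| <= q / 2 ->
  `|a - w| <= p -> `|a' - w'| <= p -> p <= q / 4 -> `|w - w'| <= q.
Proof.
rewrite !ler_norml => /andP[? ?] /andP[? ?] /andP[? ?] ?.
by apply/andP; split; lra.
Qed.

End local_representative.

Section local_modulus.
Context {R : realType} {n : nat}.
Local Notation E := 'rV[R]_n.
Local Notation mu := (@lebesgue_rV R n).
Variable O : set E.
Hypothesis oO : open O.
Hypothesis Ofin : (mu O < +oo)%E.
Hypothesis n3 : (n <= 3)%N.
Implicit Types (lo hi : 'I_n -> R) (y z : E) (u W : E -> R).

(** The union of the boxes [y + r [lo, hi]] over [r] is a truncated cone with
    vertex [y], as soon as [0] is not in the box. *)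
Definition box_cone (U : set E) lo hi (h : R) : Prop :=
  forall y, closure O y -> U y -> forall r, 0 < r < h ->
    cbox (shift_box lo r y) (shift_box hi r y) `<=` O.

(** The averages over the boxes of the cone converge to [W] at the rate [x], the
    square root of the scale, uniformly in the vertex. Two values of [W] are
    compared through the averages at one fixed scale. *)
Lemma local_modulus (U : set E) lo hi (h : R) : open U ->
  (forall k, lo k < hi k) -> 0 < h -> box_cone U lo hi h ->
  exists delta : R -> R, (forall e, 0 < e -> 0 < delta e) /\
    forall u g gg N, H2_data O u g gg N ->
    exists2 W : E -> R, ae_eq mu (O `&` U) W u &
      forall e y y', 0 < e -> closure O y -> U y -> closure O y' -> U y' ->
        (forall k, `|y ord0 k - y' ord0 k| <= delta e) -> `|W y - W y'| <= e * N.
Proof.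
move=> oU lohi h0 cone.
pose b (k : 'I_n) := bump (lo k) (hi k).
have sb : smooth_family b by move=> k; exact: smooth1_bump.
have bs : supp_family b lo hi.
  move=> k t tlh; rewrite /b bump_eq0//; apply: contra tlh => /andP[h1 h2].
  by rewrite !ltW.
have b0 x : 0 <= pk b x by apply: prodr_ge0 => k _; exact: bump_ge0.
pose c := mass b; have c0 : 0 < c by exact: mass_bump_gt0.
pose x0 := Num.min 1 (h / 2).
have x00 : 0 < x0 by rewrite lt_min ltr01 divr_gt0.
have x01 : x0 <= 1 by rewrite ge_min lexx.
have x0h : x0 ^+ 2 < h.
  have : x0 <= h / 2 by rewrite ge_min lexx orbT.
  by rewrite expr2; nra.
have x0P : 0 < x0 <= 1 by rewrite x00.
have [C C0 HC] := average_lipschitz oO Ofin n3 sb bs x0P x0h.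
have /choice[L HL] (s : R) : exists L, 0 < s -> 0 < L /\
   forall u N y y' d, 0 <= N -> 0 <= d ->
    sqint mu O u -> \int[mu]_(z in O) (u z ^+ 2) <= N ^+ 2 ->
    (forall k, `|y ord0 k - y' ord0 k| <= d) ->
    `|average O u b s y - average O u b s y'| <= L * N * d.
  have [s0|s0] := ltP 0 s; last by exists 0.
  by have [L L0 HL] := average_lipschitz_center oO Ofin sb bs s0; exists L => _.
(* At the scale [xe e ^+ 2], replacing the two limits by averages costs
   [e * N / 2]; moving the center costs the other half. *)
pose xe e := Num.min x0 (e * c / (4 * C)).
have xeP e : 0 < e -> 0 < xe e <= x0.
  by move=> e0; rewrite lt_min x00 ge_min lexx andbT/= divr_gt0 ?mulr_gt0.
have sP e : 0 < e -> 0 < xe e ^+ 2 by move=> /xeP/andP[px _]; rewrite exprn_gt0.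
exists (fun e => e * c / (2 * L (xe e ^+ 2))); split.
  by move=> e e0; have [L0 _] := HL _ (sP e e0); rewrite divr_gt0 ?mulr_gt0.
move=> u g gg N D; have [N0 [su uN] _ _ _ _] := D.
have /choice[W0 HW0] y : exists w, closure O y -> U y ->
    forall x, 0 < x <= x0 -> `|average O u b (x ^+ 2) y - w| <= C * N * x.
  have [[cy Uy]|ny] := pselect (closure O y /\ U y); last first.
    by exists 0 => cy Uy; exfalso; apply: ny.
  have CN0 : 0 <= C * N by rewrite mulr_ge0// ltW.
  have [w Hw] := lipschitz_limit0 x00 CN0 (HC u g gg N y D (cone y cy Uy)).
  by exists w.
exists (fun y => c^-1 * W0 y).
  have CN0 : 0 <= C * N by rewrite mulr_ge0// ltW.
  have oP : open (O `&` U) by exact: openI.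
  have := @limit_ae_eq _ _ O oO Ofin u W0 b lo hi (O `&` U) (C * N) x0 oP
    (@subIsetl _ _ _) su sb bs b0 x00 CN0.
  have H : forall y, (O `&` U) y -> forall x, 0 < x <= x0 ->
      `|average O u b (x ^+ 2) y - W0 y| <= C * N * x.
    by move=> y [Oy Uy]; apply: HW0 => //; exact: subset_closure.
  move=> /(_ H); apply: filterS => y /= + Py => /(_ Py) ->.
  by rewrite mulKf// gt_eqF.
move=> e y y' e0 cy Uy cy' Uy' yd.
have [L0 HLe] := HL _ (sP e e0).
have de0 : 0 <= e * c / (2 * L (xe e ^+ 2)) by rewrite ltW// divr_gt0 ?mulr_gt0.
have h1 := HLe u N y y' _ N0 de0 su uN yd.
have h2 := HW0 y cy Uy _ (xeP e e0); have h3 := HW0 y' cy' Uy' _ (xeP e e0).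
have xle : C * N * xe e <= e * c * N / 4.
  have xl : xe e <= e * c / (4 * C) by rewrite ge_min lexx orbT.
  have -> : e * c * N / 4 = C * N * (e * c / (4 * C)) by field; rewrite gt_eqF.
  by rewrite ler_wpM2l// mulr_ge0// ltW.
have le2 : L (xe e ^+ 2) * N * (e * c / (2 * L (xe e ^+ 2))) = e * c * N / 2.
  by field; rewrite gt_eqF.
rewrite le2 in h1.
rewrite -mulrBr normrM ger0_norm ?invr_ge0 ?(ltW c0)// ler_pdivrMl//.
have -> : c * (e * N) = e * c * N by ring.
exact: dist_quarters h1 h2 h3 xle.
Qed.

End local_modulus.

(** * The interior cone condition *)

Section cone.
Context {R : realType}.

Lemma enorm_le_l1 n (x : 'rV[R]_n) : enorm x <= \sum_i `|x ord0 i|.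
Proof.
have S0 : 0 <= \sum_i `|x ord0 i| by apply: sumr_ge0.
rewrite /enorm -[leRHS]ger0_norm// -sqrtr_sqr ler_sqrt ?sqr_ge0//.
rewrite expr2 mulr_suml; apply: ler_sum => i _.
rewrite -real_normK ?num_real// expr2 ler_wpM2l// (bigD1 i)//= lerDl.
exact: sumr_ge0.
Qed.

Lemma coord_le_enorm n (x : 'rV[R]_n) i : `|x ord0 i| <= enorm x.
Proof.
rewrite /enorm -sqrtr_sqr ler_sqrt ?sumr_ge0 ?sqr_ge0//; last first.
  by move=> j _; exact: sqr_ge0.
rewrite (bigD1 i)//= lerDl; apply: sumr_ge0 => j _; exact: sqr_ge0.
Qed.

Lemma graph_le (a1 a2 g1 g2 c1 c2 : R) : `|a1 - a2| <= c2 -> `|g1 - g2| <= c1 ->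
  g1 < a1 -> g2 <= a2 + (c1 + c2).
Proof. by rewrite !ler_norml => /andP[? ?] /andP[? ?] ?; lra. Qed.

Lemma graph_lt (a v g1 g2 c1 c2 s : R) : `|v| <= c2 -> `|g1 - g2| <= c1 ->
  c1 + c2 < s -> g2 <= a -> g1 < a + s + v.
Proof. by rewrite !ler_norml => /andP[? ?] /andP[? ?] ? ?; lra. Qed.

Lemma coord_mulmx_le n (v : 'rV[R]_n) (Q : 'M[R]_n) (d : R) k :
  (forall i, `|v ord0 i| <= d) ->
  `|(v *m Q) ord0 k| <= d * \sum_j \sum_i `|Q i j|.
Proof.
move=> vd; rewrite mxE; apply: le_trans (ler_norm_sum _ _ _) _.
apply: (@le_trans _ _ (d * \sum_i `|Q i k|)).
  rewrite mulr_sumr; apply: ler_sum => i _.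
  by rewrite normrM ler_wpM2r.
have d0 : 0 <= d by apply: le_trans (vd k).
rewrite ler_wpM2l// [leRHS](bigD1 k)//= lerDl; apply: sumr_ge0 => j _.
exact: sumr_ge0.
Qed.

Lemma enorm_col'_mulmx_le n (v : 'rV[R]_n) (Q : 'M[R]_n) (d : R) k :
  (forall i, `|v ord0 i| <= d) ->
  enorm (col' k (v *m Q)) <= d * (n%:R * \sum_j \sum_i `|Q i j|).
Proof.
move=> vd; apply: le_trans (enorm_le_l1 _) _.
have d0 : 0 <= d by apply: le_trans (vd k).
have q0 : 0 <= \sum_j \sum_i `|Q i j| by apply: sumr_ge0 => j _; exact: sumr_ge0.
apply: (@le_trans _ _ (\sum_(j < n.-1) d * \sum_j \sum_i `|Q i j|)).
  by apply: ler_sum => j _; rewrite mxE; exact: coord_mulmx_le.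
rewrite sumr_const card_ord -[leLHS]mulr_natl [leLHS]mulrCA ler_wpM2l// ler_wpM2r// ler_nat.
exact: leq_pred.
Qed.

Lemma box_cone_interior n (O : set 'rV[R]_n) x0 : open O -> O x0 ->
  exists U lo hi h, [/\ open U, U x0, (forall k, lo k < hi k), 0 < h & box_cone O U lo hi h].
Proof.
move=> oO Ox; have /nbhs_ballP[e /= e0 eO] : nbhs x0 O by exact: open_nbhs_nbhs.
have e2 : 0 < e / 2 by rewrite divr_gt0.
exists (obox (fun i => x0 ord0 i - e / 2) (fun i => x0 ord0 i + e / 2)).
exists (fun=> -1), (fun=> 1), (e / 2); split => //.
- exact: obox_open.
- by move=> i; apply/andP; split; lra.
- move=> y _ Uy r /andP[r0 rh] z zB; apply: eO; apply/ball_rVP => // i.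
  have := zB i; rewrite /shift_box mulr1 mulrN1 => /andP[? ?].
  have /andP[? ?] := Uy i; rewrite ltr_norml; apply/andP; split; lra.
Qed.

(** At a boundary point the cone points along the axis of the graph; its
    aperture has to beat the Lipschitz constant. *)
Lemma box_cone_boundary n (O : set 'rV[R]_n) x0 : lipschitz_boundary O ->
  (closure O `\` interior O) x0 ->
  exists U lo hi h, [/\ open U, U x0, (forall k, lo k < hi k), 0 < h & box_cone O U lo hi h].
Proof.
move=> lip /lip[r [Q [k [L [gamma [r0 QQ gL graph]]]]]].
pose q := n.+1%:R * \sum_j \sum_i `|Q i j|.
have q0' : 0 <= \sum_j \sum_i `|Q i j| by apply: sumr_ge0 => j _; exact: sumr_ge0.
have q0 : 0 <= q by rewrite mulr_ge0.
have qk (v : 'rV[R]_n) (d : R) : (forall i, `|v ord0 i| <= d) -> `|(v *m Q) ord0 k| <= d * q.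
  move=> vd; have d0 : 0 <= d by apply: le_trans (vd k).
  apply: le_trans (coord_mulmx_le Q k vd) _; rewrite ler_wpM2l// /q ler_peMl//.
  by rewrite ler1n.
have qc (v : 'rV[R]_n) (d : R) : (forall i, `|v ord0 i| <= d) -> enorm (col' k (v *m Q)) <= d * q.
  move=> vd; have d0 : 0 <= d by apply: le_trans (vd k).
  apply: le_trans (enorm_col'_mulmx_le Q k vd) _; rewrite ler_wpM2l// /q ler_wpM2r//.
  by rewrite ler_nat.
have gL' y z : `|gamma y - gamma z| <= `|L| * enorm (y - z).
  apply: le_trans (gL y z) _; rewrite ler_wpM2r ?ler_norm// sqrtr_ge0//.
pose K := (`|L| + 1) * q.
have K0 : 0 <= K by rewrite mulr_ge0// addr_ge0.
have below (y x : 'rV[R]_n) (d : R) : (forall i, `|x ord0 i - y ord0 i| <= d) ->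
    gamma (col' k (x *m Q)) < (x *m Q) ord0 k ->
    gamma (col' k (y *m Q)) <= (y *m Q) ord0 k + K * d.
  move=> xy gx; have vd i : `|(x - y) ord0 i| <= d by rewrite !mxE.
  have d0 : 0 <= d by apply: le_trans (vd k).
  have h1 := qk _ _ vd; have h2 := qc _ _ vd.
  have h3 := gL' (col' k (x *m Q)) (col' k (y *m Q)).
  have h4 : enorm (col' k (x *m Q) - col' k (y *m Q)) <= d * q.
    suff <- : col' k ((x - y) *m Q) = col' k (x *m Q) - col' k (y *m Q) by [].
    by rewrite mulmxBl; apply/rowP => i; rewrite !mxE.
  have {h3}h3 := le_trans h3 (ler_wpM2l (normr_ge0 L) h4).
  have h5 : ((x - y) *m Q) ord0 k = (x *m Q) ord0 k - (y *m Q) ord0 k.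
    by rewrite mulmxBl !mxE.
  rewrite h5 in h1.
  have -> : K * d = `|L| * (d * q) + d * q by rewrite /K; ring.
  exact: graph_le h1 h3 gx.
have sumc (c : R) : 0 < c -> \sum_(i < n) c < n.+1%:R * c.
  by move=> c0; rewrite sumr_const card_ord -[ltLHS]mulr_natl ltr_pM2r// ltr_nat.
have closed_below y : closure O y -> \sum_i `|(y - x0) ord0 i| < r / 2 ->
    gamma (col' k (y *m Q)) <= (y *m Q) ord0 k.
  move=> cy yr; apply/ler_addgt0Pr => t t0.
  have K1 : 0 < K + 1 by rewrite ltr_wpDl.
  pose d := Num.min (t / (K + 1)) (r / (2 * n.+1%:R)).
  have d0 : 0 < d by rewrite lt_min !divr_gt0 ?mulr_gt0.
  have [x [Ox yx]] := cy _ (nbhsx_ballx y d d0).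
  have {}yx i : `|x ord0 i - y ord0 i| <= d.
    by rewrite distrC ltW//; exact: ((ball_rVP _ _ d0).1 yx).
  have xr : enorm (x - x0) < r.
    apply: le_lt_trans (enorm_le_l1 _) _.
    apply: (@le_lt_trans _ _ (\sum_i (d + `|(y - x0) ord0 i|))).
      apply: ler_sum => i _; rewrite !mxE.
      have -> : x ord0 i - x0 ord0 i = (x ord0 i - y ord0 i) + (y ord0 i - x0 ord0 i) by ring.
      by apply: le_trans (ler_normD _ _) _; rewrite lerD2r.
    rewrite big_split/=; have := sumc d d0.
    have : n.+1%:R * d <= r / 2.
      have dr : d <= r / (2 * n.+1%:R) by rewrite ge_min lexx orbT.
      have -> : r / 2 = n.+1%:R * (r / (2 * n.+1%:R)) by field; rewrite ?nat1r ?natr1 pnatr_eq0.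
      by rewrite ler_wpM2l.
    lra.
  apply: le_trans (below y x d yx ((graph x xr).1 Ox)) _; rewrite lerD2l.
  apply: (@le_trans _ _ ((K + 1) * d)); first by rewrite ler_wpM2r ?(ltW d0)// lerDl.
  by rewrite -ler_pdivlMl// mulrC ge_min lexx.
pose e : 'rV[R]_n := delta_mx ord0 k *m Q^T.
have eQ : e *m Q = delta_mx ord0 k.
  by rewrite -mulmxA (mulmx1C QQ) mulmx1.
pose rho := (2 * (K + 1))^-1.
have rho0 : 0 < rho by rewrite invr_gt0 mulr_gt0// ltr_wpDl.
have Krho : K * rho < 1.
  by rewrite /rho ltr_pdivrMr ?mulr_gt0// ?ltr_wpDl//; lra.
pose r1 := r / (2 * n.+1%:R).
have r10 : 0 < r1 by rewrite divr_gt0// mulr_gt0.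
pose m := \sum_i (`|e ord0 i| + rho).
have m0 : 0 <= m by apply: sumr_ge0 => i _; rewrite addr_ge0// ltW.
exists (obox (fun i => x0 ord0 i - r1) (fun i => x0 ord0 i + r1)).
exists (fun i => e ord0 i - rho), (fun i => e ord0 i + rho), (r / (2 * (m + 1))).
split => //.
- exact: obox_open.
- by move=> i; apply/andP; split; lra.
- by move=> i /=; lra.
- by rewrite divr_gt0// mulr_gt0// ltr_wpDl.
move=> y cy Uy s /andP[s0 sh] z zB.
have Uy1 i : `|(y - x0) ord0 i| <= r1.
  by have /andP[? ?] := Uy i; rewrite !mxE ler_norml; apply/andP; split; lra.
have yx0 : \sum_i `|(y - x0) ord0 i| < r / 2.
  apply: (@le_lt_trans _ _ (\sum_(i < n) r1)); first by apply: ler_sum => i _.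
  apply: lt_le_trans (sumc r1 r10) _; rewrite /r1 le_eqVlt; apply/orP; left; apply/eqP.
  by field; rewrite ?nat1r ?natr1 pnatr_eq0.
pose v := z - y - s *: e.
have vs i : `|v ord0 i| <= s * rho.
  have /andP[] := zB i; rewrite /shift_box !mxE.
  by rewrite ler_norml => ? ?; apply/andP; split; lra.
have zE : z = y + s *: e + v by apply/rowP => i; rewrite !mxE; ring.
have zx0 : enorm (z - x0) < r.
  apply: le_lt_trans (enorm_le_l1 _) _.
  apply: (@le_lt_trans _ _ (\sum_i (`|(y - x0) ord0 i| + s * (`|e ord0 i| + rho)))).
    apply: ler_sum => i _.
    have -> : (z - x0) ord0 i = (y - x0) ord0 i + (s * e ord0 i + v ord0 i).
      by rewrite zE !mxE; ring.
    apply: le_trans (ler_normD _ _) _; rewrite lerD2l.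
    apply: le_trans (ler_normD _ _) _; rewrite mulrDr; apply: lerD => //.
    by rewrite normrM ger0_norm// ltW.
  rewrite big_split/= -mulr_sumr -/m.
  have : s * (m + 1) < r / 2.
    have -> : r / 2 = r / (2 * (m + 1)) * (m + 1).
      by field; rewrite gt_eqF// ltr_wpDl.
    by rewrite ltr_pM2r// ltr_wpDl.
  nra.
apply/(graph z zx0).
have gy := closed_below y cy yx0.
have zQk : (z *m Q) ord0 k = (y *m Q) ord0 k + s + (v *m Q) ord0 k.
  by rewrite zE !mulmxDl -scalemxAl eQ !mxE !eqxx/= mulr1.
have zQc : col' k (z *m Q) - col' k (y *m Q) = col' k (v *m Q).
  rewrite zE !mulmxDl -scalemxAl eQ; apply/rowP => j; rewrite !mxE.
  by rewrite [lift _ _ == _]eq_sym (negbTE (neq_lift _ _)) andbF mulr0; ring.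
have h1 := qk _ _ vs; have h2 := qc _ _ vs.
have h3 := gL' (col' k (z *m Q)) (col' k (y *m Q)); rewrite zQc in h3.
have {h3}h3 := le_trans h3 (ler_wpM2l (normr_ge0 L) h2).
rewrite zQk.
have h4 : `|L| * (s * rho * q) + s * rho * q < s.
  have -> : `|L| * (s * rho * q) + s * rho * q = s * (K * rho) by rewrite /K; ring.
  by rewrite gtr_pMr.
exact: graph_lt h1 h3 h4 gy.
Qed.

End cone.

(** * Continuous representatives *)

Section gluing.
Context {R : realType} {n : nat}.
Local Notation E := 'rV[R]_n.
Local Notation mu := (@lebesgue_rV R n).
Variable O : set E.
Hypothesis oO : open O.
Implicit Types (y z : E) (u W f g : E -> R) (U : set E).

(** The pointwise form of continuity on the closure, for functions that are
    controlled on a patch only. *)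
Definition cont_at f y : Prop :=
  forall e, 0 < e -> \forall y' \near nbhs y, closure O y' -> `|f y - f y'| <= e.

Lemma cont_at_local f g U y : open U -> U y -> closure O y ->
  (forall z, closure O z -> U z -> f z = g z) -> cont_at f y -> cont_at g y.
Proof.
move=> oU Uy cy fg cf e e0; have := cf e e0.
have nU : nbhs y U by exact: open_nbhs_nbhs.
apply: filterS2 nU => z Uz fz cz; rewrite -!fg//; exact: fz.
Qed.

Lemma open_nonnegligible (V : set E) : open V -> V !=set0 -> ~ mu.-negligible V.
Proof.
move=> oV V0 [N [mN N0 VN]]; have := open_measure_gt0 oV V0.
rewrite ltNge => /negP; apply; rewrite -N0; apply: le_measure => //; rewrite inE//.
exact: measurable_open.
Qed.

(** Nonempty open sets are not negligible, so every neighborhood of [y] has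
    points where the two functions coincide. *)
Lemma cont_at_agree f g U y : open U -> U y -> closure O y ->
  cont_at f y -> cont_at g y -> ae_eq mu (O `&` U) f g -> f y = g y.
Proof.
move=> oU Uy cy cf cg fg; apply/eqP; rewrite -subr_eq0 -normr_le0.
apply/ler_addgt0Pr => e e0; rewrite add0r.
have e2 : 0 < e / 2 by rewrite divr_gt0.
have nU : nbhs y U by exact: open_nbhs_nbhs.
have [V [oV Vy] VP] : exists2 V, open_nbhs y V & V `<=` U `&`
    [set z | closure O z -> `|f y - f z| <= e / 2] `&`
    [set z | closure O z -> `|g y - g z| <= e / 2].
  have : nbhs y (U `&` [set z | closure O z -> `|f y - f z| <= e / 2] `&`
    [set z | closure O z -> `|g y - g z| <= e / 2]).
    apply: filterI; last exact: cg.
    by apply: filterI => //; exact: cf.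
  by rewrite nbhsE.
have ne : (O `&` V) !=set0 by apply: cy; exact: open_nbhs_nbhs.
have [z [[Oz Vz] fgz]] : exists z, (O `&` V) z /\ f z = g z.
  apply: contrapT => nz; apply: (open_nonnegligible (openI oO oV) ne).
  apply: negligibleS fg => z [Oz Vz] /= H; apply: nz; exists z; split => //.
  by apply: H; split => //; case: (VP z Vz) => -[].
have [[_ /= fz] /= gz] := VP z Vz.
have cz : closure O z by exact: subset_closure.
have h1 := fz cz; have h2 := gz cz; rewrite fgz in h1.
have -> : f y - g y = (f y - g z) - (g y - g z) by ring.
apply: le_trans (ler_normB _ _) _; lra.
Qed.

(** Countably many boxes suffice to see every point of [N]. *)
Lemma negligible_local (N : set E) :
  (forall x, N x -> exists U, [/\ open U, U x & mu.-negligible (N `&` U)]) ->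
  mu.-negligible N.
Proof.
move=> H; have [lo [hi base]] := @countable_box_base R n.
have Z : mu.-negligible (\bigcup_k
    (if `[<mu.-negligible (N `&` obox (lo k) (hi k))>] then N `&` obox (lo k) (hi k) else set0)).
  by apply: negligible_bigcup => k; case: asboolP => // _; exact: negligible_set0.
apply: negligibleS Z => x Nx; have [U [oU Ux nU]] := H x Nx.
have [k xk kU] := base U x oU Ux; exists k => //.
rewrite asboolT; first by split.
apply: negligibleS nU; apply: setIS; apply: subset_trans kU; exact: obox_cbox.
Qed.

(** Local representatives agree on overlaps, by [cont_at_agree]. *)
Lemma glue u : (forall x, closure O x -> exists U W, [/\ open U, U x,
     ae_eq mu (O `&` U) W u & forall y, closure O y -> U y -> cont_at W y]) ->
  exists2 W, (forall y, closure O y -> cont_at W y) & ae_eq mu O W u.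
Proof.
move=> H.
have /choice[F HF] x : exists UW : set E * (E -> R), closure O x ->
    [/\ open UW.1, UW.1 x, ae_eq mu (O `&` UW.1) UW.2 u &
        forall y, closure O y -> UW.1 y -> cont_at UW.2 y].
  have [cx|cx] := pselect (closure O x); last by exists (set0, u).
  by have [U [W UW]] := H x cx; exists (U, W).
pose W y := (F y).2 y.
have WE x y : closure O x -> closure O y -> (F x).1 y -> W y = (F x).2 y.
  move=> cx cy xy; have [oU Ux aeU cU] := HF x cx; have [oV Vy aeV cV] := HF y cy.
  apply: (@cont_at_agree (F y).2 (F x).2 ((F x).1 `&` (F y).1)) => //.
  - exact: openI.
  - exact: cV.
  - exact: cU.
  - move: aeU; apply: filterS2 aeV => z h1 h2 [Oz [z1 z2]].
    by rewrite h1// h2.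
exists W.
  move=> y cy; have [oU Uy aeU cU] := HF y cy.
  apply: (@cont_at_local (F y).2 W (F y).1 y) => //; last exact: cU.
  by move=> z cz zU; rewrite (WE y).
change (mu.-negligible (~` [set x | O x -> W x = u x])).
apply: negligible_local => x /= /not_implyP[Ox _].
have cx : closure O x by exact: subset_closure.
have [oU Ux aeU _] := HF x cx; exists (F x).1; split => //.
apply: negligibleS aeU => y [/= + Uy] /=; apply: contra_not => H1 Oy.
by rewrite (WE x)//; [exact: H1|exact: subset_closure].
Qed.

Lemma within_continuous_rowP m (w : E -> 'rV[R]_m) :
  {within closure O, continuous w} <->
  forall k y, closure O y -> cont_at (fun z => w z ord0 k) y.
Proof.
rewrite subspace_continuousP; split => [H k y cy e e0|H y cy].
  have /cvg_ballP := H y cy; move=> /(_ e e0); rewrite near_withinE.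
  apply: filterS => z + cz => /(_ cz) [_ /(_ ord0 k)].
  by rewrite /ball/= => /ltW.
apply/cvg_ballP => e e0; rewrite near_withinE.
have e2 : 0 < e / 2 by rewrite divr_gt0.
have NF : \forall z \near nbhs y,
    forall k, closure O z -> `|w y ord0 k - w z ord0 k| <= e / 2.
  by apply: filter_forall => k; exact: H.
apply: filterS NF => z Hz cz; apply/(ball_rVP _ _ e0) => k.
by apply: le_lt_trans (Hz k cz) _; lra.
Qed.

End gluing.

Section lipschitz_domain.
Context {R : realType} {n : nat}.
Local Notation E := 'rV[R]_n.
Local Notation mu := (@lebesgue_rV R n).
Variable O : set E.
Hypothesis dO : bounded_lipschitz_domain O.
Hypothesis n3 : (n <= 3)%N.
Implicit Types (y z : E) (u W f : E -> R) (U : set E).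

Let oO : open O. Proof. by case: dO. Qed.

Lemma domain_finite : (mu O < +oo)%E.
Proof. by case: dO => _ _ _ bO _; apply: bounded_finite_measure => //; exact: measurable_open. Qed.

Let Ofin := domain_finite.

Lemma closure_bounded : exists2 M, 0 < M & closure O `<=` cbox (fun=> - M) (fun=> M).
Proof.
case: dO => _ _ _ /pinfty_ex_gt0[M M0 /= OM] _; exists M => //.
rewrite [X in _ `<=` X](closure_id _).1; last exact: closed_cbox.
apply: closureS => x /OM xM i; rewrite -ler_norml; apply: le_trans xM.
exact: coord_le_norm.
Qed.

Lemma closure_compact : compact (closure O).
Proof.
have [M _ OM] := closure_bounded.
apply: subclosed_compact OM; [exact: closed_closure|exact: compact_cbox].
Qed.

(** Near an interior point a small box serves as the cone; near a boundary
    point the cone follows the axis of the local graph. *)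
Lemma patch_modulus x0 : closure O x0 -> exists U (delta : R -> R),
  [/\ open U, U x0, forall e, 0 < e -> 0 < delta e &
    forall u g gg N, H2_data O u g gg N ->
    exists2 W : E -> R, ae_eq mu (O `&` U) W u &
      forall e y y', 0 < e -> closure O y -> U y -> closure O y' -> U y' ->
        (forall k, `|y ord0 k - y' ord0 k| <= delta e) -> `|W y - W y'| <= e * N].
Proof.
move=> cx.
have [U [lo [hi [h [oU Ux lohi h0 cone]]]]] : exists U lo hi h,
    [/\ open U, U x0, (forall k, lo k < hi k), 0 < h & box_cone O U lo hi h].
  have [Ox|Ox] := pselect (O x0); first exact: box_cone_interior.
  case: dO => _ _ _ _ lip; apply: (box_cone_boundary lip); split => //.
  by move=> /interior_subset.
have [delta [d0 HW]] := local_modulus oO Ofin n3 oU lohi h0 cone.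
by exists U, delta.
Qed.

Lemma near_coord_le y (d : R) : 0 < d ->
  \forall z \near nbhs y, forall k, `|y ord0 k - (z : E) ord0 k| <= d.
Proof.
move=> d0; apply/nbhs_ballP; exists d => //= z /(ball_rVP _ _ d0) yz k.
exact: ltW.
Qed.

Lemma modulus_cont_at W U y (delta : R -> R) N : open U -> U y -> 0 <= N ->
  (forall e, 0 < e -> 0 < delta e) ->
  (forall e y', 0 < e -> closure O y' -> U y' ->
     (forall k, `|y ord0 k - y' ord0 k| <= delta e) -> `|W y - W y'| <= e * N) ->
  cont_at O W y.
Proof.
move=> oU Uy N0 d0 WN e e0.
have eN : 0 < e / (N + 1) by rewrite divr_gt0// ltr_wpDl.
have nU : nbhs y U by exact: open_nbhs_nbhs.
have := near_coord_le y (d0 _ eN); apply: filterS2 nU => z Uz yz cz.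
apply: le_trans (WN _ z eN cz Uz yz) _.
by rewrite mulrAC ler_pdivrMr ?ltr_wpDl// ler_wpM2l ?(ltW e0)// lerDl.
Qed.

Lemma continuous_representative u g gg N : H2_data O u g gg N ->
  exists2 W, (forall y, closure O y -> cont_at O W y) & ae_eq mu O W u.
Proof.
move=> D; have [N0 _ _ _ _ _] := D; apply: glue => // x cx.
have [U [delta [oU Ux d0 HW]]] := patch_modulus cx.
have [W aeW WN] := HW u g gg N D; exists U, W; split => // y cy Uy.
apply: (modulus_cont_at oU Uy N0 d0) => e y' e0 cy' Uy'; exact: WN.
Qed.

(** The patches share a modulus of continuity, by compactness of the closure;
    as it depends on the patches alone, it serves all functions at once. *)
Lemma uniform_modulus : exists Delta : R -> R, (forall e, 0 < e -> 0 < Delta e) /\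
  forall u g gg N Z, H2_data O u g gg N ->
  (forall y, closure O y -> cont_at O Z y) -> ae_eq mu O Z u ->
  forall e y y', 0 < e -> closure O y -> closure O y' ->
    (forall k, `|y ord0 k - y' ord0 k| <= Delta e) -> `|Z y - Z y'| <= e * N.
Proof.
pose P (e d : R) y := forall u g gg N Z, H2_data O u g gg N ->
  (forall y, closure O y -> cont_at O Z y) -> ae_eq mu O Z u ->
  forall y', closure O y' -> (forall k, `|y ord0 k - y' ord0 k| <= d) -> `|Z y - Z y'| <= e * N.
suff /choice[Delta HD] e : exists d, 0 < e -> 0 < d /\ forall y, closure O y -> P e d y.
  exists Delta; split; first by move=> e e0; case: (HD e e0).
  move=> u g gg N Z D cZ aeZ e y y' e0 cy cy' yy'.
  by have [_ H] := HD e e0; exact: (H y cy u g gg N Z D cZ aeZ y' cy' yy').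
have [e0|e0] := ltP 0 e; last by exists 0.
have ncov := (compact_near_coveringP (closure O)).1 closure_compact.
have loc x : closure O x ->
    \forall y \near x & d \near (0 : R)^'+, (closure O y -> P e d y).
  move=> cx; have [U [delta [oU Ux d0 HW]]] := patch_modulus cx.
  have /nbhs_ballP[rho /= rho0 rhoU] : nbhs x U by exact: open_nbhs_nbhs.
  have r2 : 0 < rho / 2 by rewrite divr_gt0.
  exists (ball x (rho / 2), [set d | d < Num.min (rho / 2) (delta e)]) => /=.
    split; first exact: nbhsx_ballx.
    by apply: nbhs_right_lt; rewrite lt_min r2 d0.
  move=> [y d] /= [xy]; rewrite lt_min => /andP[dr dd] cy.
  move=> u g gg N Z D cZ aeZ y' cy' yy'.
  have xyk := (ball_rVP x y r2).1 xy.
  have Uy : U y.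
    by apply: rhoU; apply/(ball_rVP _ _ rho0) => k; apply: lt_trans (xyk k) _; lra.
  have Uy' : U y'.
    apply: rhoU; apply/(ball_rVP _ _ rho0) => k.
    have -> : x ord0 k - y' ord0 k = (x ord0 k - y ord0 k) + (y ord0 k - y' ord0 k) by ring.
    apply: le_lt_trans (ler_normD _ _) _.
    by have := xyk k; have := yy' k; lra.
  have [N0 _ _ _ _ _] := D.
  have [W aeW WN] := HW u g gg N D.
  have ZW z : closure O z -> U z -> Z z = W z.
    move=> cz Uz; apply: (cont_at_agree oO oU Uz cz) => //; first exact: cZ.
      apply: (modulus_cont_at oU Uz N0 d0) => e' z' e'0 cz' Uz'; exact: WN.
    move: aeZ; apply: filterS2 aeW => t h1 h2 [Ot Ut].
    by rewrite h2// h1.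
  rewrite !ZW//; apply: (WN e) => // k.
  by apply: le_trans (yy' k) _; exact: ltW.
have := ncov R (0 : R)^'+ (fun d y => closure O y -> P e d y) _ loc.
move=> near_d; near (0 : R)^'+ => d; exists d => _; split => [|y cy].
  by near: d; exact: nbhs_right_gt.
have : closure O `<=` [set y | closure O y -> P e d y] by near: d; exact: near_d.
by move=> /(_ y cy); apply.
Unshelve. all: end_near. Qed.

End lipschitz_domain.

(** * The continuous representative of a Sobolev field *)

Section fields.
Context {R : realType} {n m : nat}.
Local Notation E := 'rV[R]_n.
Local Notation F := (E -> 'rV[R]_m).
Local Notation mu := (@lebesgue_rV R n).
Variable O : set E.
Hypothesis dO : bounded_lipschitz_domain O.
Hypothesis n3 : (n <= 3)%N.
Implicit Types (u v w Z : F).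

Let oO : open O. Proof. by case: dO. Qed.
Let mO : measurable O. Proof. exact: measurable_open. Qed.
Let Ofin := domain_finite dO.

Lemma partial_pkC i j (b : 'I_n -> R -> R) : smooth_family b ->
  partial i (partial j (pk b)) = partial j (partial i (pk b)) :> (E -> R).
Proof.
move=> sb; have [->//|ij] := eqVneq i j.
have sd k : smooth_family (upd b k (derive1 (b k))).
  by apply: upd_smooth => //; exact: smooth1_derive.
rewrite (partial_pk j sb) (partial_pk i sb) (partial_pk i (sd j)) (partial_pk j (sd i)).
congr pk; apply/funext => k; rewrite /upd.
have ji : (j == i) = false by rewrite eq_sym (negbTE ij).
have [->|ki] := eqVneq k i; first by rewrite (negbTE ij) ?ji ?eqxx ?(negbTE ij).
by rewrite ji.
Qed.

(** The norm of [H^2] lists mixed derivatives in increasing order of the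
    directions only, hence the sorted pair [s i j]. *)
Lemma Hk2_data w k : Hk O 2 w -> exists g gg,
  H2_data O (fun x => w x ord0 k) g gg (Hk_norm O 2 w).
Proof.
move=> Hw; have Lw : L2 O w by case: Hw.
pose s (i j : 'I_n) : seq 'I_n := if (i <= j)%N then [:: i; j] else [:: j; i].
have ss i j : sorted leq [seq val i | i <- s i j].
  by rewrite /s; case: leqP => /= ij; rewrite andbT// ltnW.
have s2 i j : (size (s i j) <= 2)%N by rewrite /s; case: ifP.
pose g i := weak_derivative O [:: i] w.
pose gg i j := weak_derivative O (s i j) w.
have gP i : L2 O (g i) /\ is_weak_derivative O [:: i] w (g i).
  exact: (weak_derivativeP (s := [:: i]) Hw).
have ggP i j : L2 O (gg i j) /\ is_weak_derivative O (s i j) w (gg i j).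
  exact: (weak_derivativeP Hw).
exists (fun i x => g i x ord0 k), (fun i j x => gg i j x ord0 k); split.
- exact: Hk_norm_ge0.
- split; first exact: Lw.
  apply: le_trans (sqint_le_L2_norm oO k Lw) _.
  by rewrite lerXn2r ?nnegrE ?L2_norm_ge0 ?Hk_norm_ge0//; exact: L2_norm_le_Hk_norm.
- move=> i; have [Lg _] := gP i; split; first exact: Lg.
  apply: le_trans (sqint_le_L2_norm oO k Lg) _.
  by rewrite lerXn2r ?nnegrE ?L2_norm_ge0 ?Hk_norm_ge0//; exact: weak_derivative_le_Hk_norm.
- move=> i j; have [Lg _] := ggP i j; split; first exact: Lg.
  apply: le_trans (sqint_le_L2_norm oO k Lg) _.
  by rewrite lerXn2r ?nnegrE ?L2_norm_ge0 ?Hk_norm_ge0//; exact: weak_derivative_le_Hk_norm.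
- move=> i b lo hi sb bs boxO; have [_ wg] := gP i.
  by have := wg _ k (test_pk sb bs boxO); rewrite /= expr1 mulN1r.
- move=> i j b lo hi sb bs boxO; have [_ wg] := gP i; have [_ wgg] := ggP i j.
  have tp := test_pk sb bs boxO.
  have := wg _ k (test_partial j tp); rewrite /= expr1 mulN1r => H.
  have := wgg _ k tp.
  have -> : partials (s i j) (pk b) = partial i (partial j (pk b)).
    rewrite /s; case: (i <= j)%N; last exact: (partial_pkC j i sb).
    by rewrite /partials.
  rewrite H (_ : size (s i j) = 2%N); last by rewrite /s; case: ifP.
  by rewrite sqrrN expr1n mul1r => <-; rewrite opprK.
Qed.

Lemma cont_repP w : Hk O 2 w ->
  {within closure O, continuous (cont_rep O w)} /\ ae_eq_on O w (cont_rep O w).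
Proof.
move=> Hw.
have /choice[W HW] k : exists W : E -> R, (forall y, closure O y -> cont_at O W y) /\
    ae_eq mu O W (fun x => w x ord0 k).
  have [g [gg D]] := Hk2_data k Hw.
  by have [W cW aeW] := continuous_representative dO n3 D; exists W.
pose Z : F := fun x => \row_k W k x.
suff H : [set v | {within closure O, continuous v} /\ ae_eq_on O w v] Z.
  exact: (xgetPex 0 (ex_intro _ Z H)).
split.
  apply/within_continuous_rowP => k y cy; have [cW _] := HW k.
  rewrite (_ : (fun z => _) = W k); first exact: cW.
  by apply/funext => z; rewrite mxE.
apply/ae_eqP => k; have [_] := HW k; apply: filterS => x /= + Ox => /(_ Ox) <-.
by rewrite mxE.
Qed.

Lemma field_modulus : exists Delta : R -> R, (forall e, 0 < e -> 0 < Delta e) /\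
  forall w Z, Hk O 2 w -> {within closure O, continuous Z} -> ae_eq_on O w Z ->
  forall k e y y', 0 < e -> closure O y -> closure O y' ->
    (forall i, `|y ord0 i - y' ord0 i| <= Delta e) ->
    `|Z y ord0 k - Z y' ord0 k| <= e * Hk_norm O 2 w.
Proof.
have [Delta [D0 HD]] := uniform_modulus dO n3; exists Delta; split => //.
move=> w Z Hw cZ wZ k e y y' e0 cy cy' yy'.
have [g [gg D]] := Hk2_data k Hw.
have cZk := (within_continuous_rowP O Z).1 cZ k.
apply: (HD _ _ _ _ (fun x => Z x ord0 k) D cZk) => //.
by have := (ae_eqP O w Z).1 wZ k; apply: filterS => x /= + Ox => /(_ Ox) ->.
Qed.

Lemma L2_norm_small w Z (d : R) : L2 O w -> ae_eq_on O w Z ->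
  (forall y k, O y -> `|Z y ord0 k| <= d) ->
  L2_norm O w ^+ 2 <= d ^+ 2 * (m%:R * fine (mu O)).
Proof.
move=> Lw wZ Zd; rewrite sqr_L2_norm L2_innerE//.
rewrite mulrCA mulr_natl -[X in _ *+ X]card_ord -sumr_const; apply: ler_sum => k _.
have [mw iw] := Lw k.
have fO : mu O \is a fin_num by rewrite ge0_fin_numE//; exact: Ofin.
have -> : d ^+ 2 * fine (mu O) = fine (\int[mu]_(x in O) cst (d ^+ 2)%:E x)%E.
  by rewrite integral_cst// fineM//.
rewrite /Rintegral fine_le//.
- apply: integrable_fin_num => //; move: iw; rewrite (_ : (fun x => (w x ord0 k ^+ 2)%:E) = EFin \o (fun x => w x ord0 k * w x ord0 k))//.
  by rewrite integral_cst// fin_numM.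
apply: ae_ge0_le_integral => //.
- by move=> x _; rewrite lee_fin -expr2 sqr_ge0.
- by have /measurable_EFinP := measurable_funM mw mw.
- by move=> x _; rewrite lee_fin /cst sqr_ge0.
have := (ae_eqP O w Z).1 wZ k; apply: filterS => x /= wZx Ox.
rewrite lee_fin -expr2 -real_normK ?num_real// wZx//.
by rewrite lerXn2r ?nnegrE ?(le_trans _ (Zd x k Ox))// Zd.
Qed.


End fields.

(** * Uniqueness from the nodes *)

Section nodes.
Context {R : realType} {n m : nat}.
Local Notation E := 'rV[R]_n.
Local Notation F := (E -> 'rV[R]_m).
Local Notation mu := (@lebesgue_rV R n).
Variable O : set E.
Hypothesis dO : bounded_lipschitz_domain O.
Hypothesis n3 : (n <= 3)%N.
Implicit Types (u v w Z : F).

Let oO : open O. Proof. by case: dO. Qed.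
Let Ofin := domain_finite dO.

Lemma node_near N (x : 'I_N -> E) (d : R) y : (1 <= N)%N -> closure O y ->
  0 < d -> fill_distance O x <= d -> exists j, forall i, `|y ord0 i - x j ord0 i| <= 2 * d.
Proof.
move=> N1 cy d0 xd; have [M _ OM] := closure_bounded dO.
pose D z := [set enorm (z - x j) | j in [set: 'I_N]].
have D0 z : has_lbound (D z) by exists 0 => _ [j _ <-]; exact: sqrtr_ge0.
have ub : has_ubound [set inf (D z) | z in closure O].
  exists (\sum_i (M + `|x (Ordinal N1) ord0 i|)) => _ [z /OM zM <-].
  apply: (@le_trans _ _ (enorm (z - x (Ordinal N1)))).
    by apply: ge_inf => //; exists (Ordinal N1).
  apply: le_trans (enorm_le_l1 _) _; apply: ler_sum => i _; rewrite !mxE.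
  by apply: le_trans (ler_normB _ _) _; rewrite lerD2r ler_norml; exact: zM.
have yd : inf (D y) <= d by apply: le_trans xd; apply: (ub_le_sup ub); exists y.
(* The strict inequality that picks a node near the infimum costs the factor
   [2], or any other above [1]. *)
have [||_ [j _ <-] yj] := @inf_lt _ (D y) (2 * d); first by exists (enorm (y - x (Ordinal N1))), (Ordinal N1).
  by apply: le_lt_trans yd _; lra.
exists j => i; apply: le_trans (ltW yj).
by have := coord_le_enorm (y - x j) i; rewrite !mxE.
Qed.

(** Interpolation turns smallness in [L^2] relative to the [H^2] norm into
    smallness in [H^1]. *)
Lemma Hk1_norm_small : exists2 C : R, 0 < C & forall w (t : R), Hk O 2 w -> H10 O w ->
  0 <= t -> t <= 1 -> L2_norm O w <= t * Hk_norm O 2 w ->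
  Hk_norm O 1 w ^+ 2 <= C * (t * Hk_norm O 2 w ^+ 2).
Proof.
pose C : R := \sum_(j < 2) \sum_(s : j.-tuple 'I_n | sorted leq [seq val i | i <- s]) 1.
have C0 : 0 <= C by apply: sumr_ge0 => j _; apply: sumr_ge0.
exists (C + 1); first by rewrite ltr_wpDl.
move=> w t Hw w0 t0 t1 wt; have N0 := Hk_norm_ge0 O 2 w.
have tN0 : 0 <= t * Hk_norm O 2 w ^+ 2 by rewrite mulr_ge0// sqr_ge0.
suff : Hk_norm O 1 w ^+ 2 <= C * (t * Hk_norm O 2 w ^+ 2).
  by move=> /le_trans; apply; rewrite ler_wpM2r// lerDl.
rewrite sqr_Hk_norm /C mulr_suml; apply: ler_sum => j _.
rewrite mulr_suml; apply: ler_sum => s _; rewrite mul1r.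
case: s => -[|i [|? ?]] sj /=; last by have := ltn_ord j; rewrite -(eqP sj).
- have [L0 _] := weak_derivativeP (s := [::]) Hw isT.
  rewrite (L2_norm_ae oO L0 _ (weak_derivative0 oO Ofin Hw)); last by case: Hw.
  apply: (@le_trans _ _ ((t * Hk_norm O 2 w) ^+ 2)).
    by rewrite lerXn2r ?nnegrE ?L2_norm_ge0// mulr_ge0.
  by rewrite exprMn ler_wpM2r ?sqr_ge0// expr2 ler_piMl.
- apply: le_trans (interpolation oO Ofin i Hw w0) _.
  rewrite (_ : t * _ = t * Hk_norm O 2 w * Hk_norm O 2 w); last by rewrite expr2 mulrA.
  rewrite ler_pM ?L2_norm_ge0//; apply: weak_derivative_le_Hk_norm => //=.
  by rewrite leqnn.
Qed.

(** A continuous field with a zero near every point is pointwise small, by the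
    uniform modulus of continuity, hence small in [H^1]. *)
Lemma H1_norm_dense_zeros : exists delta : R -> R, (forall e, 0 < e -> 0 < delta e) /\
  forall e w Z, 0 < e -> Hk O 2 w -> H10 O w ->
    {within closure O, continuous Z} -> ae_eq_on O w Z ->
    (forall y, closure O y -> exists2 z, closure O z /\ Z z = 0 &
       forall i, `|y ord0 i - z ord0 i| <= delta e) ->
    Hk_norm O 1 w <= e * Hk_norm O 2 w.
Proof.
have [C C0 HC] := Hk1_norm_small; have [Delta [D0 HD]] := field_modulus dO n3 (m := m).
pose K : R := m%:R * fine (mu O).
have K0 : 0 <= K by rewrite mulr_ge0// fine_ge0.
(* [t e] is the relative [L^2] smallness that interpolation turns into [e] in
   [H^1], and [d e] the pointwise smallness that gives it. *)
pose t e : R := Num.min 1 (e ^+ 2 / C); pose d e := t e / (K + 1).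
have t_gt0 e : 0 < e -> 0 < t e by move=> e0; rewrite lt_min ltr01 divr_gt0 ?exprn_gt0.
have K1 : 0 < K + 1 by rewrite ltr_wpDl.
have d_gt0 e : 0 < e -> 0 < d e by move=> e0; rewrite divr_gt0// t_gt0.
exists (Delta \o d); split => [e e0|]; first exact/D0/d_gt0.
move=> e w Z e0 Hw w0 cZ wZ Z0; set N := Hk_norm O 2 w.
have N0 : 0 <= N by exact: Hk_norm_ge0.
have Zsmall y k : O y -> `|Z y ord0 k| <= d e * N.
  move=> Oy; have cy : closure O y by exact: subset_closure.
  have [z [cz Zz] yz] := Z0 y cy.
  have := HD w Z Hw cZ wZ k (d e) y z (d_gt0 e e0) cy cz yz.
  by rewrite Zz mxE subr0.
have te0 := t_gt0 e e0.
have Lsmall : L2_norm O w <= t e * N.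
  rewrite -ler_sqr ?nnegrE ?L2_norm_ge0 ?mulr_ge0 ?(ltW te0)//.
  have Lw : L2 O w by case: Hw.
  apply: le_trans (L2_norm_small dO Lw wZ Zsmall) _; rewrite -/K.
  have -> : (d e * N) ^+ 2 * K = K / (K + 1) ^+ 2 * (t e * N) ^+ 2.
    by rewrite /d; field; lra.
  rewrite ler_piMl ?sqr_ge0// ler_pdivrMr ?exprn_gt0// mul1r.
  by rewrite expr2; nra.
rewrite -ler_sqr ?nnegrE ?Hk_norm_ge0 ?mulr_ge0 ?(ltW e0)//.
apply: le_trans (HC w (t e) Hw w0 (ltW te0) _ Lsmall) _; first by rewrite ge_min lexx.
rewrite exprMn mulrA ler_wpM2r ?sqr_ge0// mulrC -ler_pdivlMr//.
by rewrite ge_min lexx orbT.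
Qed.

End nodes.

Lemma ae_eq_onB {R : realType} {n m : nat} (O : set 'rV[R]_n)
    (u u' v v' : 'rV[R]_n -> 'rV[R]_m) :
  ae_eq_on O u u' -> ae_eq_on O v v' -> ae_eq_on O (u - v) (u' - v').
Proof.
by apply: filterS2 => x /= hu hv Ox; rewrite !fctE hu// hv.
Qed.

Lemma L2_norm_subC {R : realType} {n m : nat} (O : set 'rV[R]_n)
    (u v : 'rV[R]_n -> 'rV[R]_m) : L2_norm O (u - v) = L2_norm O (v - u).
Proof.
rewrite /L2_norm /L2_inner; congr Num.sqrt; apply: eq_Rintegral => x _.
by apply: eq_bigr => k _; rewrite !mxE; ring.
Qed.

(** The difference of the equations of two solutions reads
    [A (u - v) = B v - B u]. *)
Lemma DA_norm_sub_solutions {R : realType} {n m : nat} (O : set 'rV[R]_n)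
    (H : set ('rV[R]_n -> 'rV[R]_m)) (a : 'I_n -> 'I_n -> 'rV[R]_n -> R)
    (B : ('rV[R]_n -> 'rV[R]_m) -> ('rV[R]_n -> 'rV[R]_m)) f u v :
  bounded_lipschitz_domain O -> closed_subspace O H ->
  closed_linear_operator O H (dom O H) (opA O H a) ->
  (forall u, dom O H u -> H (B u)) ->
  solutions O H a B f u -> solutions O H a B f v ->
  DA_norm O H a (u - v) = L2_norm O (B u - B v).
Proof.
move=> dO hH [AH Alin _] hB [du eu] [dv ev].
have oO : open O by case: dO.
have Ofin := domain_finite dO.
have HL2 : H `<=` L2 O by case: hH.
have dw := domB oO Ofin hH du dv.
rewrite /DA_norm L2_norm_subC; apply: L2_norm_ae => //.
- exact/HL2/AH.
- by apply: L2B => //; apply: HL2; exact: hB.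
have := Alin (-1) v u dv du; rewrite -subE.
move: (opA O H a (u - v)) (opA O H a u) (opA O H a v) eu ev => Aw Au Av eu ev ew.
apply: filterS3 ev eu ew => x hv hu hw Ox.
move: (hw Ox) (hu Ox) (hv Ox); rewrite !fctE => -> <- AB.
by apply/eqP; rewrite scaleN1r addrC subr_eq addrAC eq_sym subr_eq -AB addrC.
Qed.

(** The bound [q] on [q1] and [q2] makes the [H^1] norm [h1] at most half of
    what [h2 > 0] would require. *)
Lemma absorb {R : realFieldType} (c b q q1 q2 h1 h2 : R) : 0 < c -> 0 < b ->
  0 < b * (1 + q + q) -> q1 <= q -> q2 <= q -> 0 <= h1 ->
  h1 <= c / 2 / (b * (1 + q + q)) * h2 -> c * h2 <= b * (1 + q1 + q2) * h1 -> h2 <= 0.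
Proof.
move=> c0 b0 d0 q1q q2q h10 h12 h.
have h3 : c * h2 <= b * (1 + q + q) * h1.
  by apply: le_trans h _; rewrite ler_wpM2r// ler_wpM2l ?(ltW b0)// !lerD.
have h4 : b * (1 + q + q) * h1 <= c / 2 * h2.
  apply: le_trans (ler_wpM2l (ltW d0) h12) _; rewrite mulrA [_ * (_ / _)]mulrC divfK//.
  by rewrite gt_eqF.
have : c * h2 <= c * (h2 / 2) by apply: le_trans h3 (le_trans h4 _); rewrite mulrAC mulrA.
by rewrite ler_pM2l//; lra.
Qed.

Theorem theorem2p1 (R : realType) (n m : nat) (Omega : set 'rV[R]_n)
    (H : set ('rV[R]_n -> 'rV[R]_m))
    (a : 'I_n -> 'I_n -> 'rV[R]_n -> R)
    (B : ('rV[R]_n -> 'rV[R]_m) -> ('rV[R]_n -> 'rV[R]_m))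
    (n23 : n = 2%N \/ n = 3%N)
    (m1n : m = 1%N \/ m = n)
    (hOmega : bounded_lipschitz_domain Omega)
    (hH : closed_subspace Omega H)
    (hA : closed_linear_operator Omega H (dom Omega H) (opA Omega H a))
    (hA1 : lipschitz_coef Omega a)
    (hA2 : symmetric_coef Omega a)
    (hA3 : elliptic_coef Omega a)
    (hA4 : DA_norm_equiv Omega H a)
    (hB : forall u, dom Omega H u -> H (B u))
    (hB1 : ae_eq_on Omega (B 0) 0)
    (hB2 : B_lipschitz Omega H B)
    (hi : forall f, H f -> solutions Omega H a B f !=set0) :
  exists delta1 : R -> R, (forall r, 0 < r -> 0 < delta1 r) /\
    forall M : ('rV[R]_n -> 'rV[R]_m) -> R,
      (forall f, H f -> 0 < M f /\
        forall u, solutions Omega H a B f u -> DA_norm Omega H a u <= M f) ->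
    forall f u v, H f ->
      solutions Omega H a B f u -> solutions Omega H a B f v ->
    forall (N : nat) (x : 'I_N -> 'rV[R]_n),
      (1 <= N)%N -> (forall j, closure Omega (x j)) ->
      0 < fill_distance Omega x -> fill_distance Omega x <= delta1 (M f) ->
      (forall j, cont_rep Omega u (x j) = cont_rep Omega v (x j)) ->
      ae_eq_on Omega u v.
Proof.
have n3 : (n <= 3)%N by case: n23 => ->.
have oO : open Omega by case: hOmega.
have Ofin := domain_finite hOmega.
case: hA4 => a1 [a2 [a1_gt0 _ Abound]]; case: hB2 => CB [p [CB_gt0 p_gt1 Blip]].
have [delta [delta_gt0 Hdelta]] := H1_norm_dense_zeros hOmega n3 (m := m).
pose C r := CB * (1 + (r / a1) `^ (p - 1) + (r / a1) `^ (p - 1)).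
have C_gt0 r : 0 < C r.
  by rewrite mulr_gt0// -addrA ltr_pwDl// addr_ge0// powR_ge0.
(* The factor [1 / 2] leaves room to absorb the right-hand side. *)
pose e r := a1 / 2 / C r.
have e_gt0 r : 0 < e r by rewrite !divr_gt0.
exists (fun r => delta (e r) / 2); split => [r _|]; first by rewrite divr_gt0// delta_gt0.
move=> M HM f u v Hf Su Sv N x N1 xO _ xd uv.
have [_ Mub] := HM f Hf; set r := M f in xd Mub.
have [[du _] [dv _]] := (Su, Sv).
have H2le w : solutions Omega H a B f w -> Hk_norm Omega 2 w <= r / a1.
  move=> Sw; have [dw _] := Sw; have /andP[+ _] := Abound w dw.
  by move=> /le_trans/(_ (Mub w Sw)); rewrite mulrC -ler_pdivlMr.
have powle w : solutions Omega H a B f w ->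
    Hk_norm Omega 2 w `^ (p - 1) <= (r / a1) `^ (p - 1).
  move=> Sw; apply: ge0_ler_powR; rewrite ?nnegrE ?subr_ge0 ?(ltW p_gt1) ?Hk_norm_ge0//.
    exact: le_trans (Hk_norm_ge0 _ _ _) (H2le w Sw).
  exact: H2le.
have dw := domB oO Ofin hH du dv.
have [Hw w0 _] := dw; have [Hu _ _] := du; have [Hv _ _] := dv.
have [cu aeu] := cont_repP hOmega n3 Hu; have [cv aev] := cont_repP hOmega n3 Hv.
pose Z := cont_rep Omega u - cont_rep Omega v.
have cZ : {within closure Omega, continuous Z} by move=> y; apply: cvgB; [exact: cu|exact: cv].
have H1small : Hk_norm Omega 1 (u - v) <= e r * Hk_norm Omega 2 (u - v).
  apply: (Hdelta _ _ Z (e_gt0 r) Hw w0 cZ); first exact: ae_eq_onB.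
  move=> y cy.
  have [|j yj] := node_near hOmega N1 cy _ xd; first by rewrite divr_gt0// delta_gt0.
  exists (x j); first by split; [exact: xO|rewrite /Z !fctE uv subrr].
  by move=> i; apply: le_trans (yj i) _; rewrite mulrC divfK.
have H2zero : Hk_norm Omega 2 (u - v) = 0.
  apply/eqP; rewrite eq_le Hk_norm_ge0 andbT.
  have /andP[+ _] := Abound _ dw.
  rewrite (DA_norm_sub_solutions hOmega hH hA hB Su Sv).
  move=> /le_trans/(_ (Blip u v du dv)).
  exact: (absorb a1_gt0 CB_gt0 (C_gt0 r) (powle u Su) (powle v Sv) (Hk_norm_ge0 _ _ _) H1small).
have Lw : L2 Omega (u - v) by case: Hw.
have w_eq0 : ae_eq_on Omega (u - v) 0.
  apply: L2_norm_eq0 => //; apply/eqP; rewrite eq_le L2_norm_ge0 andbT -H2zero.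
  exact: L2_norm_le_Hk_norm.
by apply: filterS w_eq0 => y /= + Oy => /(_ Oy)/eqP; rewrite !fctE subr_eq0 => /eqP.
Qed.
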